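(* Consider the nonparametric $p$-value model of the context with $\kappa_{n,i}=k_n^{-r}$ for some $r>0$ and $\varepsilon_{n,i}=k_n^{-1}$. Let $\mathcal D$ be a dense subset of $(0,\infty)$ and $M$ a measure on $(0,\infty]$ with $M(\{\infty\})=0$ such that for all $x\in\mathcal D$ one has $M(x,\infty)<\infty$ and $$\max_{1\le i\le k_n}\Bigl|\int_0^1h_{n,i}\mathbf 1\{h_{n,i}>e^x-1\}\,d\lambda-M(x,\infty)\Bigr|\to0.$$ Then $T_n$ converges in distribution (on $[-\infty,\infty]$) to $\xi_1$ under $P_{(n)}$ and to $\xi_2$ under $Q_{(n)}$, where: (a) If $r<1$, then $\xi_1\equiv\xi_2\equiv0$. (b) If $r=1$, then for $j\in\{1,2\}$ $\xi_j$ is infinitely divisible with Lévy–Khintchine triplet $(\gamma_j,0,\eta_j)$, where $\eta_1,\eta_2$ are concentrated on $(0,\infty)$ with $$\frac{d\eta_1}{dM}(x)=\frac1{e^x-1},\qquad\frac{d\eta_2}{dM}(x)=\frac{e^x}{e^x-1},\qquad x>0,$$ and $$0=\gamma_1-\int_{(0,\infty)}\Bigl(1-e^x+\frac x{1+x^2}\Bigr)d\eta_1(x),\qquad\gamma_2=\gamma_1+\int_{(0,\infty)}(e^x-1)\frac x{1+x^2}\,d\eta_1(x).$$ (c) If $r>1$, then $\xi_1\equiv-1$ and $\xi_2\sim e^{-1}\epsilon_{-1}+(1-e^{-1})\epsilon_\infty$.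
   Context: $\lambda$ is Lebesgue measure; $\epsilon_a$ is the Dirac measure at $a\in[-\infty,\infty]$. $k_n\in\mathbb N$, $k_n\to\infty$. All noise distributions $P_{n,i}$ are the uniform distribution on $(0,1)$. The signal distribution $\mu_{n,i}$, $1\le i\le k_n$, is the probability measure on $(0,1)$ with Lebesgue density $$u\mapsto\frac1{\kappa_{n,i}}h_{n,i}\Bigl(\frac u{\kappa_{n,i}}\Bigr)+r_{n,i}(u)\ \ge0,\qquad\int_0^1r_{n,i}\,d\lambda=0,$$ where $h_{n,i}$ is a Lebesgue probability density on $(0,1)$ (extended by $0$ outside $(0,1)$) and the perturbations satisfy $\sum_{i=1}^{k_n}\varepsilon_{n,i}^2\int_0^1r_{n,i}^2\,d\lambda\to0$. $Q_{n,i}=(1-\varepsilon_{n,i})P_{n,i}+\varepsilon_{n,i}\mu_{n,i}$, $P_{(n)}=\bigotimes_{i=1}^{k_n}P_{n,i}$, $Q_{(n)}=\bigotimes_{i=1}^{k_n}Q_{n,i}$, $T_n=\sum_{i=1}^{k_n}\log\frac{dQ_{n,i}}{dP_{n,i}}(Y_{n,i})$ with $Y_{n,i}$ the coordinates. An infinitely divisible distribution on $\mathbb R$ has Lévy–Khintchine triplet $(\gamma,\sigma^2,\eta)$ ($\eta$ a measure on $\mathbb R\setminus\{0\}$ with $\int\min(x^2,1)\,d\eta<\infty$) if its characteristic function is $$t\mapsto\exp\Bigl[\mathrm i\gamma t-\frac{\sigma^2t^2}{2}+\int_{\mathbb R\setminus\{0\}}\Bigl(e^{\mathrm itx}-1-\frac{\mathrm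 itx}{1+x^2}\Bigr)d\eta(x)\Bigr].$$ *)

(* Defs.v *)
From HB Require Import structures.
From mathcomp Require Import all_boot all_order all_algebra.
From mathcomp Require Import all_classical all_reals all_analysis.
From mathcomp Require Import measurable_realfun complex.

Set Implicit Arguments.
Unset Strict Implicit.
Unset Printing Implicit Defensive.

Import Order.TTheory GRing.Theory Num.Theory.
Import numFieldNormedType.Exports.

Local Open Scope classical_set_scope.
Local Open Scope ring_scope.

(* Finite products of probability measures, on the product sigma-algebra of
   the library's measurable structure on tuples. *)
Section finite_product.
Context d (T : measurableType d) (R : realType).

Definition tuple_cons n (p : T * n.-tuple T) : n.+1.-tuple T :=
  [the n.+1.-tuple T of p.1 :: p.2].

Lemma measurable_tuple_cons n :
  measurable_fun [set: T * n.-tuple T] (@tuple_cons n).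
Proof. exact: measurable_cons. Qed.

HB.instance Definition _ n :=
  @isMeasurableFun.Build _ _ _ _ (@tuple_cons n) (@measurable_tuple_cons n).

Section binary.
Context d' (T' : measurableType d').
Variables (P : probability T R) (Q : probability T' R).

Definition prod2 : set (T * T') -> \bar R := (P \x Q)%E.

HB.instance Definition _ := Measure.on prod2.

Let prod2_setT : prod2 setT = 1%E.
Proof.
rewrite /prod2 -setXTT product_measure1E//.
transitivity (1 * 1 : \bar R)%E; last exact: mule1.
by congr (_ * _)%E; exact: probability_setT.
Qed.

HB.instance Definition _ := @Measure_isProbability.Build _ _ R prod2 prod2_setT.

End binary.

Fixpoint prod_prob n : ('I_n -> probability T R) -> probability (n.-tuple T) R :=
  match n with
  | 0 => fun _ => dirac [tuple]
  | m.+1 => fun P =>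
      distribution (prod2 (P ord0) (prod_prob (fun i => P (lift ord0 i))))
        (@tuple_cons m)
  end.

End finite_product.

(* (1 - e) P + e Q *)
Section mixture.
Context d (T : measurableType d) (R : realType).
Variables (e : R) (e01 : 0 <= e <= 1) (P Q : probability T R).
Local Open Scope ereal_scope.

Let e_ge0 : (0 <= e)%R. Proof. by case/andP: e01. Qed.
Let e_le1 : (0 <= 1 - e)%R. Proof. by rewrite subr_ge0; case/andP: e01. Qed.

Definition mixture : set T -> \bar R :=
  measure_add (mscale (NngNum e_le1) P) (mscale (NngNum e_ge0) Q).

Lemma mixtureE A : mixture A = (1 - e)%:E * P A + e%:E * Q A.
Proof. exact: measure_addE. Qed.

HB.instance Definition _ := Measure.on mixture.

Let mixture_setT : mixture setT = 1.
Proof.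
by rewrite mixtureE !probability_setT !mule1 -EFinD subrK.
Qed.

HB.instance Definition _ :=
  @Measure_isProbability.Build _ _ R mixture mixture_setT.

End mixture.

Lemma invn_itv01 (R : realType) (n : nat) : 0 <= (n%:R : R)^-1 <= 1.
Proof.
rewrite invr_ge0 ler0n /=; case: n => [|n]; first by rewrite invr0 ler01.
by rewrite invf_le1 ?ltr0Sn// ler1n.
Qed.

(* lne 0 = -oo, so the log-likelihood ratio takes values in [-oo, +oo]. *)
Section log_likelihood_ratio.
Context d (T : measurableType d) (R : realType).
Local Open Scope charge_scope.

Definition dQdP (P Q : probability T R) : T -> \bar R :=
  'd (charge_of_finite_measure Q) '/d P.

Lemma measurable_dQdP P Q : measurable_fun setT (dQdP P Q).
Proof.
have [QP|QP] := pselect (charge_of_finite_measure Q `<< P).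
  exact: (measurable_int _ (Radon_Nikodym_integrable QP)).
by rewrite /dQdP /Radon_Nikodym; case: pselect.
Qed.

Lemma measurable_lne : measurable_fun setT (@lne R).
Proof.
rewrite (_ : @lne R = fun x => if (x <= 0)%E then -oo%E
    else if x == +oo%E then +oo%E else (ln (fine x))%:E); last first.
  by apply/funext => -[r| |]; rewrite ?lee_fin ?leNye ?leye_eq.
apply: measurable_fun_ifT => //; first exact: measurable_fun_lee.
apply: measurable_fun_ifT => //; first exact: measurable_fun_eqe.
by apply/measurable_EFinP; apply: measurableT_comp; [exact: measurable_ln|].
Qed.

Definition log_lr n (P Q : 'I_n -> probability T R) (y : n.-tuple T) : \bar R :=
  (\sum_(i < n) lne (dQdP (P i) (Q i) (tnth y i)))%E.

Lemma measurable_log_lr n (P Q : 'I_n -> probability T R) :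
  measurable_fun setT (log_lr P Q).
Proof.
apply: emeasurable_sum => i; apply: (measurableT_comp measurable_lne).
apply: (measurableT_comp (measurable_dQdP _ _)); exact: measurable_tnth.
Qed.

HB.instance Definition _ n P Q :=
  @isMeasurableFun.Build _ _ _ _ (@log_lr n P Q) (@measurable_log_lr n P Q).

End log_likelihood_ratio.

(* law of \sum_i log (dQ_i/dP_i)(Y_i) when Y_i ~ S_i are independent *)
Definition log_lr_law d (T : measurableType d) (R : realType) n
    (P Q S : 'I_n -> probability T R) : probability (\bar R) R :=
  distribution (prod_prob S) (log_lr P Q).

Section weak_convergence.
Context (R : realType).

Definition weak_cvg (nu : nat -> probability (\bar R) R)
    (xi : probability (\bar R) R) : Prop :=
  forall f : \bar R -> R, continuous f -> (exists C, forall x, `|f x| <= C) ->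
    (\int[nu n]_x f x)%R @[n --> \oo] --> (\int[xi]_x f x)%R.

End weak_convergence.

Section levy_khintchine.
Context (R : realType).
Local Open Scope complex_scope.

Definition cexp (z : R[i]) : R[i] :=
  (expR (complex.Re z))%:C * (cos (complex.Im z) +i* sin (complex.Im z)).

Definition Cintegral d (T : measurableType d) (mu : {measure set T -> \bar R})
    (D : set T) (f : T -> R[i]) : R[i] :=
  (\int[mu]_(x in D) complex.Re (f x))%R +i*
  (\int[mu]_(x in D) complex.Im (f x))%R.

Definition char_fun (P : probability (measurableTypeR R) R) (t : R) : R[i] :=
  Cintegral P setT (fun x => cexp ('i * (t * x)%:C)).

Definition infinitely_divisible (P : probability (measurableTypeR R) R) : Prop :=
  forall m, (0 < m)%N -> exists Q : probability (measurableTypeR R) R,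
    forall A, measurable A ->
      P A = prod_prob (fun _ : 'I_m => Q) [set y | A (\sum_(i < m) tnth y i)].

(* The Levy measure, a measure on R \ {0}, is encoded as a measure on R which
   does not charge 0. *)
Definition LK_triplet (P : probability (measurableTypeR R) R) (gamma sigma2 : R)
    (eta : {measure set (measurableTypeR R) -> \bar R}) : Prop :=
  [/\ 0 <= sigma2,
      eta [set 0] = 0%E,
      (\int[eta]_(x in [set~ 0%R]) (Num.min (x ^+ 2) 1)%:E < +oo)%E &
      forall t : R, char_fun P t =
        cexp ('i * (gamma * t)%:C - (sigma2 * t ^+ 2 / 2)%:C +
              Cintegral eta [set~ 0] (fun x =>
                cexp ('i * (t * x)%:C) - 1 - 'i * (t * x / (1 + x ^+ 2))%:C))].

End levy_khintchine.

Section p_value_model.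
Context (R : realType).
Local Notation lambda := (@lebesgue_measure R).

Definition unif01 : probability (measurableTypeR R) R := uniform_prob (@ltr01 R).

Definition density01 (h : R -> R) : Prop :=
  [/\ measurable_fun setT h, forall u, 0 <= h u,
      forall u, u \notin `]0, 1[ -> h u = 0 &
      (\int[lambda]_(u in `]0%R, 1%R[) (h u)%:E = 1)%E].

Definition signal_density (kappa : R) (h rho : R -> R) (u : R) : R :=
  kappa^-1 * h (u / kappa) + rho u.

(* Q_i = (1 - 1/m) P_i + (1/m) mu_i with P_i uniform and m the sample size *)
Definition contaminated m (mu : 'I_m -> probability (measurableTypeR R) R)
    (i : 'I_m) : probability (measurableTypeR R) R :=
  mixture (invn_itv01 R m) unif01 (mu i).

(* eta is concentrated on (0, +oo) and d eta / d M = g there; the points of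
   R are embedded in the carrier [-oo, +oo] of M. *)
Definition concentrated_density (M : {measure set (\bar R) -> \bar R})
    (g : R -> R) (eta : {measure set (measurableTypeR R) -> \bar R}) : Prop :=
  eta `]-oo, 0%R]%classic = 0%E /\
  forall A : set (measurableTypeR R), measurable A -> A `<=` `]0%R, +oo[%classic ->
    eta A = (\int[M]_(y in EFin @` A) (g (fine y))%:E)%E.

End p_value_model.

(* Main.v *)
(* Under the product of the P_i, T_n = sum_i ln (1 + W_i) where W_i = A_i + B_i
   has mean 0, A_i >= 0 being the rescaled signal and B_i a perturbation whose
   second moments sum to o(1). For a smooth bounded f,
     E f(x + ln (1 + W_i)) - f x = (1 / k_n) (G f x + o(1)) uniformly in x,
   where G = 0 if r < 1, G f = - f' if r > 1, and, if r = 1,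
     G f x = \int (f (x + y) - f x) d eta_1(y) - f' x.
   The case r = 1 holds because \int psi(h) = \int h (psi(h) / h) is determined
   by the tail masses \int h 1{h > t} as soon as psi vanishes quadratically at 0;
   these tail masses also force M to have mass 1 and eta_1 to be finite. Hence
   the summands may be exchanged one by one, in the manner of Lindeberg, for
   shifted compound Poisson variables whose sum has exactly the law xi_1.
   Under the product of the Q_i, E_Q f(T_n) = E_P f(T_n) e^{T_n}, with a bounded
   integrand if f vanishes near +oo; this determines xi_2 on [-oo, +oo[, the
   rest of its mass being at +oo. The exponential tilting of a compound Poisson
   law with Levy measure eta is compound Poisson with Levy measure e^x eta. *)
Require Import Defs.
From HB Require Import structures.
From mathcomp Require Import all_boot all_order all_algebra.
From mathcomp Require Import all_classical all_reals all_analysis.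
From mathcomp Require Import measurable_realfun ring lra complex.

Import Order.TTheory GRing.Theory Num.Theory.
Import numFieldNormedType.Exports Normc.

Local Open Scope classical_set_scope.
Local Open Scope ring_scope.

Set Implicit Arguments.
Unset Strict Implicit.
Unset Printing Implicit Defensive.

(** The signal [A_i] has integral [1 / k_n] but in general no second moment, so a plain Taylor
    expansion in [W_i] fails. As [W_i] has mean 0, its linear term can be subtracted at no cost; the
    remainder [log_increment] is bounded on [w >= 0] by multiples of both [w] and [w ^ 2]. The cross
    term of [A_i] and [B_i] is of order [|B_i| * min 1 A_i]; since the square of [min 1 A_i] is at
    most [A_i], a weighted AM-GM inequality bounds its sum, up to constants, by [d] times the sum of
    the second moments of [B_i] plus [1 / d], with [d] fixed before [n] grows. The only scale left
    is [s_n = k_n * kappa_n = k_n ^ (1 - r)]; the three regimes are its limits +oo, 1 and 0. That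
    [M] has mass 1 follows from [1 - t <= \int h 1{h > t} <= 1] as [t] tends to 0; that [eta_1] is
    finite, from the sets [{h > t}] having measure at most 1. So finite intensities [c] suffice.
    Because [e^x / (e^x - 1) = 1 / (e^x - 1) + 1], tilting raises the intensity to [c + 1], and the
    factor [e] gained in total mass is cancelled by the shift by -1. *)

Section density.
Context d (T : measurableType d) (R : realType).
Implicit Types (P Q : probability T R) (q : T -> R).

Definition has_density P Q q : Prop :=
  [/\ measurable_fun setT q, forall u, 0 <= q u &
      forall A, measurable A -> Q A = (\int[P]_(u in A) (q u)%:E)%E].

Section single.
Variables (P Q : probability T R) (q : T -> R) (dq : has_density P Q q).

Let mq : measurable_fun setT (EFin \o q).
Proof. by case: dq => mq _ _; exact/measurable_EFinP. Qed.

Lemma density_dominates : Q `<< P.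
Proof.
apply/null_content_dominatesP => A mA PA; case: dq => _ _ ->//.
apply: null_set_integral => //; exact: measurable_funTS.
Qed.

(** Both functions have the same integral over every measurable set. Pointwise nothing is known
    about the abstract derivative [dQdP], so each later statement on the log-likelihood ratio has to
    pass through this exceptional null set. *)
Lemma dQdP_ae : ae_eq P setT (dQdP P Q) (EFin \o q).
Proof.
apply: integral_ae_eq => //.
- by apply: Radon_Nikodym_integrable; exact: density_dominates.
- move=> A _ mA; rewrite -Radon_Nikodym_integral//; last exact: density_dominates.
  by case: dq => _ _; exact.
Qed.

Lemma ge0_integral_density (f : T -> \bar R) : measurable_fun setT f ->
  (forall x, 0 <= f x)%E ->
  (\int[Q]_x f x = \int[P]_x (f x * (q x)%:E))%E.
Proof.
move=> mf f0; have QP := density_dominates.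
rewrite -(Radon_Nikodym_SigmaFinite.change_of_variables QP f0 measurableT mf).
have mg := measurable_int _ (Radon_Nikodym_SigmaFinite.f_integrable QP).
apply: ae_eq_integral => //; [exact: emeasurable_funM..|].
apply: ae_eqe_mul2l; apply: integral_ae_eq => //.
- exact: Radon_Nikodym_SigmaFinite.f_integrable.
- move=> A _ mA; rewrite -Radon_Nikodym_SigmaFinite.f_integral//.
  by case: dq => _ _; exact.
Qed.

End single.
End density.

Local Opaque integral.

(** * Lindeberg replacement on finite products *)

Section bounded_measurable.
Context d (T : measurableType d) (R : realType).
Implicit Types f g : T -> R.

(** All test functions stay in this class, which is stable under averaging over a coordinate;
    linearity, Fubini and image laws then need no separate integrability argument. *)
Definition bmeas f := measurable_fun setT f /\ exists C, forall x, `|f x| <= C.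

Lemma bmeas_cst (r : R) : bmeas (fun=> r).
Proof. by split=> //; exists `|r|. Qed.

Lemma bmeasD f g : bmeas f -> bmeas g -> bmeas (fun x => f x + g x).
Proof.
move=> [mf [C fC]] [mg [K gK]]; split; first exact: measurable_funD.
by exists (C + K) => x; rewrite (le_trans (ler_normD _ _))// lerD.
Qed.

Lemma bmeasB f g : bmeas f -> bmeas g -> bmeas (fun x => f x - g x).
Proof.
move=> [mf [C fC]] [mg [K gK]]; split; first exact: measurable_funB.
by exists (C + K) => x; rewrite (le_trans (ler_normB _ _))// lerD.
Qed.

Lemma bmeasM f g : bmeas f -> bmeas g -> bmeas (fun x => f x * g x).
Proof.
move=> [mf [C fC]] [mg [K gK]]; split; first exact: measurable_funM.
by exists (C * K) => x; rewrite normrM ler_pM.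
Qed.

Lemma bmeas_integrable (P : {finite_measure set T -> \bar R}) f :
  bmeas f -> P.-integrable setT (EFin \o f).
Proof.
move=> [mf [C fC]]; apply: measurable_bounded_integrable => //.
  exact: fin_num_fun_lty.
exists C; split; first exact: num_real.
by move=> x Cx y _ /=; rewrite (le_trans (fC y))// ltW.
Qed.

Lemma EFin_Rintegral (P : {finite_measure set T -> \bar R}) f : bmeas f ->
  (\int[P]_x f x)%R%:E = (\int[P]_x (f x)%:E)%E.
Proof.
by move=> bf; rewrite fineK//; apply: integrable_fin_num => //;
  exact: bmeas_integrable.
Qed.

End bounded_measurable.

Lemma bmeas_comp d d' (T : measurableType d) (T' : measurableType d')
    (R : realType) (f : T' -> R) (g : T -> T') :
  measurable_fun setT g -> bmeas f -> bmeas (fun x => f (g x)).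
Proof.
move=> mg [mf [C fC]]; split; first exact: (measurableT_comp mf mg).
by exists C => x.
Qed.

Section real_integrable.
Context d (T : measurableType d) (R : realType) (mu : {measure set T -> \bar R}).
Implicit Types f g : T -> R.

Lemma integrable_EFinD f g : mu.-integrable setT (EFin \o f) ->
  mu.-integrable setT (EFin \o g) ->
  mu.-integrable setT (EFin \o (fun u => f u + g u)).
Proof. by move=> fi gi; apply: (integrableD measurableT fi gi). Qed.

Lemma integrable_EFinB f g : mu.-integrable setT (EFin \o f) ->
  mu.-integrable setT (EFin \o g) ->
  mu.-integrable setT (EFin \o (fun u => f u - g u)).
Proof. by move=> fi gi; apply: (integrableB measurableT fi gi). Qed.

Lemma integrable_EFinZ k f : mu.-integrable setT (EFin \o f) ->
  mu.-integrable setT (EFin \o (fun u => k * f u)).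
Proof. by move=> fi; apply: (integrableZl measurableT k fi). Qed.

Lemma integrable_dominated f g : measurable_fun setT f ->
  mu.-integrable setT (EFin \o g) -> (forall u, `|f u| <= g u) ->
  mu.-integrable setT (EFin \o f).
Proof.
move=> mf ig fg; apply: le_integrable ig => //; first exact/measurable_EFinP.
move=> u _ /=; rewrite lee_fin; apply: le_trans (fg u) _; exact: ler_norm.
Qed.

Lemma le_Rintegral_norm f g : measurable_fun setT f ->
  mu.-integrable setT (EFin \o g) -> (forall u, `|f u| <= g u) ->
  `|\int[mu]_u f u| <= \int[mu]_u g u.
Proof.
move=> mf ig fg; have fi := integrable_dominated mf ig fg.
apply: le_trans (le_normr_Rintegral measurableT fi) _.
by apply: le_Rintegral => //=; exact: integrable_norm fi.
Qed.

End real_integrable.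

Section expectation.
Context d (T : measurableType d) (R : realType) (P : probability T R).
Implicit Types f g : T -> R.

Lemma Rintegral_cst1 (r : R) : \int[P]_x r = r.
Proof.
by rewrite Rintegral_cst//; have /= -> := probability_setT P; rewrite mulr1.
Qed.

Lemma Rintegral_norm_le f C : P.-integrable setT (EFin \o f) ->
  (forall x, `|f x| <= C) -> `|\int[P]_x f x| <= C.
Proof.
move=> fi fC; rewrite (le_trans (le_normr_Rintegral measurableT fi))//.
rewrite -[leRHS]Rintegral_cst1; apply: le_Rintegral => //=.
- exact: (integrable_norm fi).
- by apply: bmeas_integrable; exact: bmeas_cst.
Qed.

Lemma Rintegral_normB_le f g e : bmeas f -> bmeas g ->
  (forall x, `|f x - g x| <= e) -> `|\int[P]_x f x - \int[P]_x g x| <= e.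
Proof.
move=> bf bg fg; rewrite -RintegralB//; [|exact: bmeas_integrable..].
by apply: Rintegral_norm_le => //; apply: bmeas_integrable; exact: bmeasB.
Qed.

End expectation.

Lemma Rintegral_distribution d d' (T : measurableType d)
    (T' : measurableType d') (R : realType) (P : probability T R)
    (X : {mfun T >-> T'}) (f : T' -> R) : bmeas f ->
  \int[distribution P X]_y f y = \int[P]_x f (X x).
Proof.
move=> bf; rewrite /Rintegral integral_distribution//.
  by apply/measurable_EFinP; case: bf.
apply: (bmeas_integrable P); apply: bmeas_comp => //.
Qed.

Section product.
Context d d' (T : measurableType d) (T' : measurableType d') (R : realType).
Variables (P : probability T R) (Q : probability T' R).

(** [prod2] only adds the probability structure to the product measure; the Fubini theorems are
    applied to the product measure itself. *)
Lemma integral_prod2E (f : T * T' -> \bar R) :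
  (\int[prod2 P Q]_z f z = \int[(P \x Q)%E]_z f z)%E.
Proof. by apply: eq_measure_integral => A mA _. Qed.

Lemma bmeas_integrable_prod (f : T * T' -> R) : bmeas f ->
  (P \x Q)%E.-integrable setT (EFin \o f).
Proof.
move=> [mf [C fC]]; apply: measurable_bounded_integrable => //.
  by have /= := @probability_setT _ _ _ (prod2 P Q); rewrite /prod2 => ->; exact: ltry.
exists C; split; first exact: num_real.
by move=> x Cx y _ /=; rewrite (le_trans (fC y))// ltW.
Qed.

Lemma bmeas_fubini1 (f : T * T' -> R) : bmeas f ->
  bmeas (fun x => \int[Q]_y f (x, y)).
Proof.
move=> bf; have [mf [C fC]] := bf; split; last first.
  exists C => x; apply: Rintegral_norm_le => //.
  by apply: bmeas_integrable; apply: (@bmeas_comp _ _ _ _ _ f (pair x)).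
apply: measurableT_comp => //.
apply: (@measurable_fubini_F _ _ _ _ _ P Q (EFin \o f)).
exact: bmeas_integrable_prod.
Qed.

Lemma Rintegral_prod1 (f : T * T' -> R) : bmeas f ->
  \int[prod2 P Q]_z f z = \int[P]_x \int[Q]_y f (x, y).
Proof.
move=> bf; rewrite /Rintegral integral_prod2E.
rewrite -integral12_prod_meas1; last first.
  exact: bmeas_integrable_prod.
congr fine; apply: eq_integral => x _; rewrite fineK//.
apply: integrable_fin_num => //; apply: (bmeas_integrable Q).
exact: (@bmeas_comp _ _ _ _ _ f (pair x)).
Qed.

Lemma Rintegral_prod2 (f : T * T' -> R) : bmeas f ->
  \int[prod2 P Q]_z f z = \int[Q]_y \int[P]_x f (x, y).
Proof.
move=> bf; rewrite /Rintegral integral_prod2E.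
rewrite -integral21_prod_meas1; last first.
  exact: bmeas_integrable_prod.
congr fine; apply: eq_integral => x _; rewrite fineK//.
apply: integrable_fin_num => //; apply: (bmeas_integrable P).
exact: (@bmeas_comp _ _ _ _ _ f (pair^~ x)).
Qed.

End product.

Section product_prob.
Context d (T : measurableType d) (R : realType).

Lemma Rintegral_prod_prob0 (P : 'I_0 -> probability T R) (f : 0.-tuple T -> R) :
  \int[prod_prob P]_y f y = f [tuple].
Proof.
rewrite /Rintegral /= integral_dirac//; first by rewrite diracT mul1e.
apply: (eq_measurable_fun (cst (f [tuple])%:E)) => // y _ /=.
by rewrite [y]tuple0.
Qed.

Lemma Rintegral_prod_probS n (P : 'I_n.+1 -> probability T R)
    (f : n.+1.-tuple T -> R) : bmeas f ->
  \int[prod_prob P]_y f y =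
  \int[P ord0]_a \int[prod_prob (fun i => P (lift ord0 i))]_y
     f (tuple_cons (a, y)).
Proof.
move=> bf; rewrite /= (Rintegral_distribution _ (@tuple_cons _ T n))//.
rewrite Rintegral_prod1//.
by apply: (@bmeas_comp _ _ _ _ _ f) => //; exact: measurable_tuple_cons.
Qed.

(** The replacement argument needs both orders of integration: the first coordinate innermost when
    it is the one exchanged, outermost when the others are. *)
Lemma Rintegral_prod_probS' n (P : 'I_n.+1 -> probability T R)
    (f : n.+1.-tuple T -> R) : bmeas f ->
  \int[prod_prob P]_y f y =
  \int[prod_prob (fun i => P (lift ord0 i))]_y \int[P ord0]_a
     f (tuple_cons (a, y)).
Proof.
move=> bf; rewrite /= (Rintegral_distribution _ (@tuple_cons _ T n))//.
rewrite Rintegral_prod2//.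
by apply: (@bmeas_comp _ _ _ _ _ f) => //; exact: measurable_tuple_cons.
Qed.

End product_prob.

Lemma bmeas_translate d (T : measurableType d) (R : realType) (f : R -> R) (g : T -> R) x :
  bmeas f -> measurable_fun setT g -> bmeas (fun a => f (x + g a)).
Proof.
by move=> bf mg; apply: (@bmeas_comp _ _ _ _ _ f) => //; exact: measurable_funD.
Qed.

Section independent_sums.
Context d (T : measurableType d) (R : realType).

Definition sum_coord n (X : 'I_n -> T -> R) (y : n.-tuple T) : R :=
  \sum_(i < n) X i (tnth y i).

Lemma measurable_sum_coord n (X : 'I_n -> T -> R) :
  (forall i, measurable_fun setT (X i)) -> measurable_fun setT (sum_coord X).
Proof.
move=> mX; apply: measurable_sum => i.
by apply: measurableT_comp; [exact: mX|exact: measurable_tnth].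
Qed.

Lemma sum_coord_cons n (X : 'I_n.+1 -> T -> R) a y :
  sum_coord X (tuple_cons (a, y)) =
  X ord0 a + sum_coord (fun i => X (lift ord0 i)) y.
Proof.
rewrite /sum_coord big_ord_recl; congr (X _ _ + _).
apply: eq_bigr => i _; congr (X _ _).
by rewrite !(tnth_nth a).
Qed.

Lemma Rintegral_sum_coordS n (P : 'I_n.+1 -> probability T R)
    (X : 'I_n.+1 -> T -> R) (f : R -> R) x :
  bmeas f -> (forall i, measurable_fun setT (X i)) ->
  \int[prod_prob P]_y f (x + sum_coord X y) =
  \int[P ord0]_a \int[prod_prob (fun i => P (lift ord0 i))]_y
    f (x + X ord0 a + sum_coord (fun i => X (lift ord0 i)) y).
Proof.
move=> bf mX; rewrite Rintegral_prod_probS; last first.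
  exact: (bmeas_translate x bf (measurable_sum_coord mX)).
by under eq_Rintegral do under eq_Rintegral do rewrite sum_coord_cons addrA.
Qed.

Lemma Rintegral_sum_coordS' n (P : 'I_n.+1 -> probability T R)
    (X : 'I_n.+1 -> T -> R) (f : R -> R) x :
  bmeas f -> (forall i, measurable_fun setT (X i)) ->
  \int[prod_prob P]_y f (x + sum_coord X y) =
  \int[prod_prob (fun i => P (lift ord0 i))]_y \int[P ord0]_a
    f (x + sum_coord (fun i => X (lift ord0 i)) y + X ord0 a).
Proof.
move=> bf mX; rewrite Rintegral_prod_probS'; last first.
  exact: (bmeas_translate x bf (measurable_sum_coord mX)).
by under eq_Rintegral do under eq_Rintegral do
  rewrite sum_coord_cons addrA addrAC.
Qed.

End independent_sums.

Lemma bmeas_average d (T : measurableType d) (R : realType)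
    (P : probability T R) (f : R -> R) (g : T -> R) :
  bmeas f -> measurable_fun setT g -> bmeas (fun x : R => \int[P]_a f (x + g a)).
Proof.
move=> bf mg.
(* The Dirac mass is a dummy law on the first factor; it only provides a product space on which
   Fubini applies. *)
apply: (@bmeas_fubini1 _ _ R T R (dirac (0 : R)) P
  (fun z : (R : measurableType _) * T => f (z.1 + g z.2))).
apply: (@bmeas_comp _ _ _ _ _ f) => //; apply: measurable_funD => //.
exact: measurableT_comp.
Qed.

(* Replace the summands one at a time; in each replacement the other summands
   only translate the test function. *)
Lemma lindeberg_replacement d d' (T : measurableType d) (T' : measurableType d')
    (R : realType) (f : R -> R) n
    (P : 'I_n -> probability T R) (Q : 'I_n -> probability T' R)
    (X : 'I_n -> T -> R) (Z : 'I_n -> T' -> R)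
    (e : 'I_n -> R) :
  bmeas f ->
  (forall i, measurable_fun setT (X i)) -> (forall i, measurable_fun setT (Z i)) ->
  (forall i x, `|\int[P i]_a f (x + X i a) - \int[Q i]_b f (x + Z i b)| <= e i) ->
  forall x, `|\int[prod_prob P]_y f (x + sum_coord X y) -
              \int[prod_prob Q]_y f (x + sum_coord Z y)| <= \sum_(i < n) e i.
Proof.
move=> bf; elim: n P Q X Z e => [|n ih] P Q X Z e mX mZ PQ x.
  by rewrite !Rintegral_prod_prob0 /sum_coord !big_ord0 subrr normr0.
pose G x := \int[prod_prob (fun i => Q (lift ord0 i))]_y
  f (x + sum_coord (fun i => Z (lift ord0 i)) y).
have mZ' : measurable_fun setT (sum_coord (fun i : 'I_n => Z (lift ord0 i))).
  exact: measurable_sum_coord.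
have mX' : measurable_fun setT (sum_coord (fun i : 'I_n => X (lift ord0 i))).
  exact: measurable_sum_coord.
have bG : bmeas G by exact: bmeas_average.
rewrite big_ord_recl.
(* The intermediate term takes its first summand from [X] and the others from [Z]. The induction
   hypothesis compares it with the sum of all [X], for each fixed value of the first coordinate, and
   [PQ ord0] compares it with the sum of all [Z]. *)
rewrite (le_trans (ler_distD (\int[P ord0]_a G (x + X ord0 a)) _ _))// addrC.
apply: lerD; last first.
  rewrite Rintegral_sum_coordS//; apply: Rintegral_normB_le.
  - apply: (@bmeas_translate _ _ _ (fun x : R => \int[prod_prob (fun i => P (lift ord0 i))]_y
      f (x + sum_coord (fun i => X (lift ord0 i)) y))) => //.
    exact: bmeas_average.
  - exact: bmeas_translate.
  - by move=> a; apply: ih => // i y; exact: PQ.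
rewrite Rintegral_sum_coordS'//.
have -> : \int[P ord0]_a G (x + X ord0 a) =
    \int[prod_prob (fun i => Q (lift ord0 i))]_y \int[P ord0]_a
    f (x + sum_coord (fun i => Z (lift ord0 i)) y + X ord0 a).
  have bh : bmeas (fun z : T * n.-tuple T' =>
      f (x + X ord0 z.1 + sum_coord (fun i => Z (lift ord0 i)) z.2)).
    apply: (@bmeas_comp _ _ _ _ _ f) => //; apply: measurable_funD => //.
      by apply: measurable_funD => //; exact: measurableT_comp.
    exact: measurableT_comp.
  rewrite -(Rintegral_prod1 _ _ bh) (Rintegral_prod2 _ _ bh).
  by under eq_Rintegral do under eq_Rintegral do rewrite addrAC.
apply: Rintegral_normB_le.
- apply: (@bmeas_translate _ _ _ (fun x : R => \int[P ord0]_a f (x + X ord0 a))) => //.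
  exact: bmeas_average.
- apply: (@bmeas_translate _ _ _ (fun x : R => \int[Q ord0]_a f (x + Z ord0 a))) => //.
  exact: bmeas_average.
- by move=> y; exact: PQ.
Qed.

(** * Likelihood ratios of product measures *)

(** Since [q >= 0], multiplication by [q] commutes with positive and negative parts, so the formula
    for nonnegative functions applies to each part; both sides agree even when [f] is not
    integrable. *)
Lemma Rintegral_change_of_measure d (T : measurableType d) (R : realType)
    (mu nu : {measure set T -> \bar R}) (q f : T -> R) : (forall x, 0 <= q x) ->
  (forall g : T -> \bar R, measurable_fun setT g -> (forall x, 0 <= g x)%E ->
    (\int[nu]_x g x = \int[mu]_x (g x * (q x)%:E))%E) ->
  measurable_fun setT f ->
  \int[nu]_x f x = \int[mu]_x (f x * q x).
Proof.
move=> q0 ge0E mf; rewrite /Rintegral integralE [X in _ = fine X]integralE.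
have mF : measurable_fun setT (EFin \o f) by exact/measurable_EFinP.
congr (fine (_ - _)%E).
- rewrite (ge0E _ (measurable_funepos mF)) => [|x]; last exact: funepos_ge0.
  apply: eq_integral => x _; rewrite !funeposE -EFin_max -EFinM -EFin_max.
  by rewrite maxr_pMl// mul0r.
- rewrite (ge0E _ (measurable_funeneg mF)) => [|x]; last exact: funeneg_ge0.
  apply: eq_integral => x _; rewrite !funenegE -EFinN -EFin_max -EFinM -EFinN -EFin_max.
  by rewrite maxr_pMl// mul0r mulNr.
Qed.

Lemma Rintegral_density d (T : measurableType d) (R : realType)
    (P Q : probability T R) (q f : T -> R) :
  has_density P Q q -> measurable_fun setT f ->
  \int[Q]_x f x = \int[P]_x (f x * q x).
Proof.
move=> dq mf; apply: Rintegral_change_of_measure mf; first by case: dq.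
by move=> g mg g0; exact: (ge0_integral_density dq mg g0).
Qed.

Section product_density.
Context d (T : measurableType d) (R : realType).

Lemma ge0_integral_prod_probS n (P : 'I_n.+1 -> probability T R)
    (f : n.+1.-tuple T -> \bar R) :
  measurable_fun setT f -> (forall y, 0 <= f y)%E ->
  (\int[prod_prob P]_y f y =
   \int[P ord0]_a \int[prod_prob (fun i => P (lift ord0 i))]_y
     f (tuple_cons (a, y)))%E.
Proof.
move=> mf f0 /=.
rewrite (@ge0_integral_distribution _ _ _ _ _ _ (@tuple_cons _ T n) f mf f0).
rewrite integral_prod2E fubini_tonelli1//; last by move=> z; exact: f0.
by apply: (measurableT_comp mf); exact: measurable_tuple_cons.
Qed.

Lemma measurable_fun_section_cons n (P' : probability (n.-tuple T) R)
    (f : n.+1.-tuple T -> \bar R) :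
  measurable_fun setT f -> (forall y, 0 <= f y)%E ->
  measurable_fun setT (fun a : T => \int[P']_y f (tuple_cons (a, y)))%E.
Proof.
move=> mf f0.
apply: (@measurable_fun_fubini_tonelli_F _ _ T (n.-tuple T) R P'
  (f \o @tuple_cons _ T n)).
  by apply: (measurableT_comp mf); exact: measurable_tuple_cons.
by move=> z; exact: f0.
Qed.

Lemma measurable_prod_tnth n (q : 'I_n -> T -> R) :
  (forall i, measurable_fun setT (q i)) ->
  measurable_fun setT (fun y : n.-tuple T => \prod_(i < n) q i (tnth y i)).
Proof.
move=> mq; apply: measurable_prod => i _.
by apply: measurableT_comp; [exact: mq|exact: measurable_tnth].
Qed.

Lemma ge0_integral_prod_density n (P Q : 'I_n -> probability T R)
    (q : 'I_n -> T -> R) (f : n.-tuple T -> \bar R) :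
  (forall i, has_density (P i) (Q i) (q i)) ->
  measurable_fun setT f -> (forall y, 0 <= f y)%E ->
  (\int[prod_prob Q]_y f y =
   \int[prod_prob P]_y (f y * (\prod_(i < n) q i (tnth y i))%:E))%E.
Proof.
elim: n P Q q f => [|n ih] P Q q f dq mf f0.
  by apply: eq_integral => y _; rewrite big_ord0 mule1.
have mq i : measurable_fun setT (q i) by case: (dq i).
have q0 i u : 0 <= q i u by case: (dq i) => _ + _; exact.
have mp := measurable_prod_tnth mq.
have mfp : measurable_fun setT (fun y : n.+1.-tuple T =>
    f y * (\prod_(i < n.+1) q i (tnth y i))%:E)%E.
  by apply: emeasurable_funM => //; exact/measurable_EFinP.
have fp0 (y : n.+1.-tuple T) : (0 <= f y * (\prod_(i < n.+1) q i (tnth y i))%:E)%E.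
  by rewrite mule_ge0// lee_fin prodr_ge0.
rewrite (ge0_integral_prod_probS _ mf f0) (ge0_integral_prod_probS _ mfp fp0).
rewrite (ge0_integral_density (dq ord0)); last 2 first.
- exact: measurable_fun_section_cons.
- by move=> a; exact: integral_ge0.
apply: eq_integral => a _.
have mfa : measurable_fun setT (fun y : n.-tuple T => f (tuple_cons (a, y))).
  have mpa : measurable_fun setT (pair a : n.-tuple T -> T * n.-tuple T) by [].
  exact: (measurableT_comp mf (measurableT_comp (@measurable_tuple_cons _ T n) mpa)).
have mfap : measurable_fun setT (fun y : n.-tuple T => f (tuple_cons (a, y)) *
    (\prod_(i < n) q (lift ord0 i) (tnth y i))%:E)%E.
  apply: emeasurable_funM => //; apply/measurable_EFinP.
  exact: (measurable_prod_tnth (fun i => mq (lift ord0 i))).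
rewrite (ih _ _ _ _ (fun i => dq (lift ord0 i)) mfa (fun y => f0 _)).
rewrite -(@ge0_integralZr _ _ _ _ _ measurableT _ mfap); last 2 first.
- by move=> y _; rewrite mule_ge0// lee_fin prodr_ge0.
- by rewrite lee_fin.
apply: eq_integral => y _; rewrite -muleA -EFinM; congr (_ * _%:E)%E.
rewrite big_ord_recl mulrC; congr (_ * _).
by apply: eq_bigr => i _; rewrite !(tnth_nth a).
Qed.

Lemma Rintegral_prod_density n (P Q : 'I_n -> probability T R)
    (q : 'I_n -> T -> R) (f : n.-tuple T -> R) :
  (forall i, has_density (P i) (Q i) (q i)) -> measurable_fun setT f ->
  \int[prod_prob Q]_y f y =
  \int[prod_prob P]_y (f y * \prod_(i < n) q i (tnth y i)).
Proof.
move=> dq mf; apply: Rintegral_change_of_measure mf.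
  by move=> y; apply: prodr_ge0 => i _; case: (dq i).
by move=> g mg g0; exact: (ge0_integral_prod_density dq mg g0).
Qed.

Lemma Rintegral_prod_prob_tnth n (P : 'I_n -> probability T R) (f : T -> R) i :
  bmeas f -> \int[prod_prob P]_y f (tnth y i) = \int[P i]_u f u.
Proof.
move=> bf; elim: n P i => [|n ih] P i; first by case: i.
rewrite Rintegral_prod_probS; last first.
  by apply: (@bmeas_comp _ _ _ _ _ f) => //; exact: measurable_tnth.
case: (unliftP ord0 i) => [j ->|->].
  transitivity (\int[P ord0]_a \int[P (lift ord0 j)]_u f u).
    apply: eq_Rintegral => a _; rewrite -(ih (fun i => P (lift ord0 i)) j).
    by apply: eq_Rintegral => y _; congr f; rewrite !(tnth_nth a).
  by rewrite Rintegral_cst1.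
apply: eq_Rintegral => a _.
transitivity (\int[prod_prob (fun i => P (lift ord0 i))]_y f a).
  by apply: eq_Rintegral => y _; congr f; rewrite (tnth_nth a).
by rewrite Rintegral_cst1.
Qed.

(** Each coordinate has marginal [P i], so a null set of one coordinate lifts to a null set of the
    product. The finite union is taken along a list of indices, which allows an induction at fixed
    [n]. *)
Lemma prod_prob_tnth_null n (P : 'I_n -> probability T R)
    (N : 'I_n -> set T) : (forall i, (P i).-negligible (N i)) ->
  (prod_prob P).-negligible [set y | exists i, N i (tnth y i)].
Proof.
move=> PN; suff H (s : seq 'I_n) : (prod_prob P).-negligible
    [set y | exists2 i, i \in s & N i (tnth y i)].
  apply: negligibleS (H (enum 'I_n)) => y [i Ni].
  by exists i => //; rewrite mem_enum.
elim: s => [|i s ih].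
  by apply: negligibleS (negligible_set0 _) => y [].
apply: (@negligibleS _ _ _ _ ([set y | N i (tnth y i)] `|`
    [set y | exists2 i, i \in s & N i (tnth y i)])).
  move=> y [j]; rewrite inE => /orP[/eqP ->|js Nj]; first by left.
  by right; exists j.
apply: negligibleU => //.
have [A [mA PA NA]] := PN i.
exists [set y | A (tnth y i)]; split; last by move=> y /NA.
  by rewrite -[X in measurable X]setTI; exact: measurable_tnth.
have bA : bmeas (\1_A : T -> R).
  by split; [exact: measurable_indic|exists 1 => x; rewrite ger0_norm// indicE lern1 leq_b1].
have mAi : measurable [set y : n.-tuple T | A (tnth y i)].
  by rewrite -[X in measurable X]setTI; exact: measurable_tnth.
have bAi : bmeas (\1_[set y : n.-tuple T | A (tnth y i)] : _ -> R).
  by split; [exact: measurable_indic|exists 1 => x; rewrite ger0_norm// indicE lern1 leq_b1].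
have E0 := Rintegral_prod_prob_tnth P i bA; have {E0} := congr1 EFin E0.
rewrite [in X in _ = X](EFin_Rintegral _ bA) (integral_indic _ measurableT mA) setIT.
rewrite (EFin_Rintegral _ bAi) (integral_indic _ measurableT mAi) setIT => E1.
exact: etrans E1 PA.
Qed.

Lemma Rintegral_ae_eq (P : probability T R) (f g : T -> R) :
  measurable_fun setT f -> measurable_fun setT g ->
  P.-negligible [set x | f x <> g x] ->
  \int[P]_x f x = \int[P]_x g x.
Proof.
move=> mf mg fg; congr fine; apply: ae_eq_integral => //.
- exact/measurable_EFinP.
- exact/measurable_EFinP.
- apply: negligibleS fg => x /= /not_implyP[_]; apply: contra_not => -> //.
Qed.

End product_density.

Section likelihood_ratio.
Context d (T : measurableType d) (R : realType).
Variables (n : nat) (P Q : 'I_n -> probability T R) (q : 'I_n -> T -> R).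
Hypothesis dq : forall i, has_density (P i) (Q i) (q i).
Hypothesis q_gt0 : forall i u, 0 < q i u.

Let mq i : measurable_fun setT (q i). Proof. by case: (dq i). Qed.
Let mlnq i : measurable_fun setT (fun u => ln (q i u)).
Proof. exact: (measurableT_comp (@measurable_ln R) (mq i)). Qed.

Definition sum_ln := sum_coord (fun i u => ln (q i u)).

Lemma measurable_sum_ln : measurable_fun setT sum_ln.
Proof. exact: measurable_sum_coord. Qed.

Lemma expR_sum_ln y : expR (sum_ln y) = \prod_(i < n) q i (tnth y i).
Proof. by rewrite /sum_ln /sum_coord expR_sum; apply: eq_bigr => i _; rewrite lnK// posrE. Qed.

Lemma log_lr_eq y : (forall i, dQdP (P i) (Q i) (tnth y i) = (q i (tnth y i))%:E) ->
  log_lr P Q y = (sum_ln y)%:E.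
Proof.
move=> H; rewrite /log_lr /sum_ln /sum_coord -sumEFin; apply: eq_bigr => i _.
by rewrite H lne_EFin.
Qed.

(** The exceptional sets of the derivatives are null under [P i], hence under [S i], hence their
    lifts under the product. Off these sets positivity of the [q i] makes every logarithm finite, so
    the extended ratio is the real number [sum_ln]. *)
Lemma Rintegral_log_lr_law (S : 'I_n -> probability T R) (f : \bar R -> R) :
  (forall i, S i `<< P i) -> bmeas f ->
  \int[log_lr_law P Q S]_x f x = \int[prod_prob S]_y f (sum_ln y)%:E.
Proof.
move=> SP bf; rewrite (Rintegral_distribution (prod_prob S) (log_lr P Q) bf).
have mf : measurable_fun setT f by case: bf.
apply: Rintegral_ae_eq.
- apply: (measurableT_comp mf); exact: measurable_log_lr.
- apply: (measurableT_comp mf); apply/measurable_EFinP; exact: measurable_sum_ln.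
apply: (@negligibleS _ _ _ _ [set y | exists i,
    [set u | dQdP (P i) (Q i) u <> (q i u)%:E] (tnth y i)]).
  move=> y /=; apply: contra_notP => H; congr f; apply: log_lr_eq => i.
  by apply: contrapT => Hi; apply: H; exists i.
apply: (@prod_prob_tnth_null _ _ _ _ S
  (fun i => [set u | dQdP (P i) (Q i) u <> (q i u)%:E])) => i.
have [A [mA SA AH]] := null_dominates_ae_eq measurableT (SP i) (dQdP_ae (dq i)).
exists A; split => // u Hu; apply: AH => /=; apply/not_implyP; split => //.
Qed.

Lemma Rintegral_log_lr_law_tilt (f : \bar R -> R) : bmeas f ->
  \int[log_lr_law P Q Q]_x f x =
  \int[prod_prob P]_y (f (sum_ln y)%:E * expR (sum_ln y)).
Proof.
move=> bf; rewrite Rintegral_log_lr_law//; last first.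
  by move=> i; exact: (density_dominates (dq i)).
have mE : measurable_fun setT (fun y => (sum_ln y)%:E).
  by apply/measurable_EFinP; exact: measurable_sum_ln.
have bf' : bmeas (fun y => f (sum_ln y)%:E) by exact: bmeas_comp.
under [RHS]eq_Rintegral do rewrite expR_sum_ln.
by apply: Rintegral_prod_density dq _; case: bf'.
Qed.

End likelihood_ratio.

Local Opaque prod_prob.

(** * Compound Poisson laws *)

Section convolution.
Context (R : realType).
Local Notation TR := (measurableTypeR R).
Implicit Types mu nu : probability TR R.

Definition add_pair (z : TR * TR) : TR := z.1 + z.2.

Lemma measurable_add_pair : measurable_fun setT add_pair.
Proof. exact: measurable_funD. Qed.

HB.instance Definition _ :=
  @isMeasurableFun.Build _ _ _ _ add_pair measurable_add_pair.

Definition convolution mu nu : probability TR R :=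
  distribution (prod2 mu nu) add_pair.

Fixpoint conv_power nu n : probability TR R :=
  if n is m.+1 then convolution nu (conv_power nu m) else @dirac _ TR (0 : R) R.

Lemma measurable_ge0_average nu (f : TR -> \bar R) :
  measurable_fun setT f -> (forall x, 0 <= f x)%E ->
  measurable_fun setT (fun x : R => \int[nu]_y f (x + y)%R)%E.
Proof.
move=> mf f0.
apply: (@measurable_fun_fubini_tonelli_F _ _ TR TR R nu (f \o add_pair)) => //.
  by apply: measurableT_comp => //; exact: measurable_add_pair.
by move=> z; exact: f0.
Qed.

Lemma ge0_integral_convolution mu nu (f : TR -> \bar R) :
  measurable_fun setT f -> (forall x, 0 <= f x)%E ->
  (\int[convolution mu nu]_z f z = \int[mu]_x \int[nu]_y f (x + y)%R)%E.
Proof.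
move=> mf f0; rewrite ge0_integral_distribution// integral_prod2E.
rewrite fubini_tonelli1//; last by move=> z; exact: f0.
by apply: measurableT_comp => //; exact: measurable_add_pair.
Qed.

Lemma Rintegral_convolution mu nu (f : TR -> R) : bmeas f ->
  \int[convolution mu nu]_z f z = \int[mu]_x \int[nu]_y f (x + y).
Proof.
move=> bf; rewrite Rintegral_distribution// Rintegral_prod1//.
by apply: (@bmeas_comp _ _ _ _ _ f) => //; exact: measurable_add_pair.
Qed.

Lemma ge0_integral_conv_powerD nu n m (f : TR -> \bar R) :
  measurable_fun setT f -> (forall x, 0 <= f x)%E ->
  (\int[conv_power nu (n + m)]_z f z =
   \int[conv_power nu n]_x \int[conv_power nu m]_y f (x + y)%R)%E.
Proof.
move=> mf f0; elim: n f mf f0 => [|n ih] f mf f0.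
  rewrite add0n /= integral_dirac//; last exact: measurable_ge0_average.
  by rewrite diracT mul1e; under [RHS]eq_integral do rewrite add0r.
rewrite addSn ![conv_power _ _.+1]/=.
rewrite !ge0_integral_convolution//; last 2 first.
- exact: measurable_ge0_average.
- by move=> x; apply: integral_ge0.
have mfx (x : R) : measurable_fun setT (fun y : TR => f (x + y)).
  by apply: (measurableT_comp mf); exact: measurable_funD.
apply: eq_integral => x _; rewrite (ih _ (mfx x) (fun y => f0 (x + y))).
by under eq_integral do under eq_integral do rewrite addrA.
Qed.

End convolution.

(** Summation along antidiagonals: each row is shifted by its index and padded with zeros, after
    which the two series of nonnegative terms may be interchanged. *)
Lemma nneseries_triangle (R : realType) (a : nat -> nat -> \bar R) :
  (forall n m, 0 <= a n m)%E ->
  (\sum_(n <oo) \sum_(m <oo) a n m =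
   \sum_(N <oo) \sum_(0 <= n < N.+1) a n (N - n)%N)%E.
Proof.
move=> a0; pose b n N := if (n <= N)%N then a n (N - n)%N else 0%E.
have b0 n N : (0 <= b n N)%E by rewrite /b; case: ifP.
transitivity (\sum_(n <oo) \sum_(N <oo) b n N)%E.
  apply: eq_eseriesr => n _; rewrite [RHS](nneseries_split 0 n)// add0n.
  rewrite big1_seq ?add0e; last first.
    by move=> i /andP[_]; rewrite mem_index_iota /b => /andP[_ lin]; rewrite leqNgt lin.
  rewrite -(nneseries_addn n)//; apply: eq_eseriesr => m _.
  by rewrite /b leq_addl addnK.
rewrite nneseries_interchange//; apply: eq_eseriesr => N _.
rewrite [LHS](nneseries_split 0 N.+1)// add0n [X in (_ + X)%E]eseries0 ?adde0.
  by apply: eq_big_nat => n /andP[_ nN]; rewrite /b -ltnS nN.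
by move=> i Ni _; rewrite /b leqNgt Ni.
Qed.

Section compound_poisson.
Context (R : realType).
Local Notation TR := (measurableTypeR R).
Implicit Types (c : R) (nu : probability TR R).

(* |c| makes the weights nonnegative for every c; only c >= 0 is meaningful. *)
Definition poisson_weight c n : R := expR (- `|c|) * (`|c| ^+ n / n`!%:R).

Lemma poisson_weight_ge0 c n : 0 <= poisson_weight c n.
Proof. by rewrite mulr_ge0// ?expR_ge0// divr_ge0// exprn_ge0. Qed.

Lemma nneseries_poisson_weight c : (\sum_(n <oo) (poisson_weight c n)%:E = 1)%E.
Proof.
rewrite (_ : 1%E = (expR (- `|c|))%:E * (expR `|c|)%:E)%E; last first.
  by rewrite -EFinM expRN mulVf ?gt_eqF ?expR_gt0.
under eq_eseriesr do rewrite /poisson_weight EFinM.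
rewrite nneseriesZl/=; last first.
  by move=> n _; rewrite lee_fin divr_ge0// exprn_ge0.
congr *%E; rewrite expRE -EFin_lim; last first.
  rewrite /pseries/=; under eq_fun do rewrite mulrC.
  exact: is_cvg_series_exp_coeff.
apply/congr_lim/funext => n/=; rewrite /pseries/= /series/= -sumEFin//.
by under eq_bigr do rewrite mulrC.
Qed.

(** The binomial formula. It is the scalar part of the semigroup property of compound Poisson laws
    in the intensity. *)
Lemma poisson_weightD a b N : 0 <= a -> 0 <= b ->
  \sum_(0 <= n < N.+1) poisson_weight a n * poisson_weight b (N - n) =
  poisson_weight (a + b) N.
Proof.
move=> a0 b0; rewrite big_mkord /poisson_weight !ger0_norm ?addr_ge0//.
rewrite addrC exprDn opprD expRD mulr_suml mulr_sumr.
apply: eq_bigr => i _.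
have iN : (i <= N)%N by rewrite -ltnS.
rewrite -(bin_fact iN) !natrM !invfM.
set u := (i`!%:R)^-1; set v := ((N - i)`!%:R)^-1.
have k0 : ('C(N, i)%:R : R) != 0 by rewrite pnatr_eq0 -lt0n bin_gt0.
move: u v => u v.
rewrite -[in RHS]mulr_natl.
by field.
Qed.


(** The law of the sum of a Poisson number, of mean [c], of independent jumps of law [nu]; its Levy
    measure is [c] times [nu]. The explicit series permits sums and tilts to be computed term by
    term. *)
Definition cpoisson_mixture c nu : set TR -> \bar R :=
  mseries (fun n => mscale (NngNum (poisson_weight_ge0 c n)) (conv_power nu n)) 0.

HB.instance Definition _ c nu := Measure.on (cpoisson_mixture c nu).

Let ge0_integral_cpoisson_mixture c nu (f : TR -> \bar R) :
  measurable_fun setT f -> (forall x, 0 <= f x)%E ->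
  (\int[cpoisson_mixture c nu]_x f x =
   \sum_(n <oo) (poisson_weight c n)%:E * \int[conv_power nu n]_x f x)%E.
Proof.
move=> mf f0; rewrite ge0_integral_measure_series//.
by apply: eq_eseriesr => n _; rewrite ge0_integral_mscale.
Qed.

Let cpoisson_mixture_setT c nu : cpoisson_mixture c nu setT = 1%E.
Proof.
rewrite -[LHS]mul1e -integral_cst// ge0_integral_cpoisson_mixture//.
under eq_eseriesr => n _.
  rewrite integral_cst// mul1e.
  have /= -> := probability_setT (conv_power nu n).
  by rewrite mule1; over.
exact: nneseries_poisson_weight.
Qed.

HB.instance Definition _ c nu :=
  @Measure_isProbability.Build _ _ R (cpoisson_mixture c nu)
    (cpoisson_mixture_setT c nu).

Definition cpoisson c nu : probability TR R := cpoisson_mixture c nu.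

Lemma ge0_integral_cpoisson c nu (f : TR -> \bar R) :
  measurable_fun setT f -> (forall x, 0 <= f x)%E ->
  (\int[cpoisson c nu]_x f x =
   \sum_(n <oo) (poisson_weight c n)%:E * \int[conv_power nu n]_x f x)%E.
Proof. exact: ge0_integral_cpoisson_mixture. Qed.

Local Opaque cpoisson.

(** In the double series over numbers of jumps, the convolution of the [n]-th and [m]-th powers of
    [nu] depends on [n + m] only; grouping by antidiagonals leaves the weights of
    [poisson_weightD]. *)
Lemma convolution_cpoisson a b nu (A : set TR) : 0 <= a -> 0 <= b ->
  measurable A ->
  convolution (cpoisson a nu) (cpoisson b nu) A = cpoisson (a + b) nu A.
Proof.
move=> a0 b0 mA.
have mI : measurable_fun setT (fun x : TR => (\1_A x)%:E : \bar R).
  exact/measurable_EFinP/measurable_indic.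
have I0 x : (0 <= (\1_A x)%:E :> \bar R)%E by rewrite lee_fin.
rewrite -[A in LHS]setIT -[A in RHS]setIT -!integral_indic//.
rewrite (ge0_integral_convolution _ _ mI I0) [RHS](ge0_integral_cpoisson _ _ mI I0).
set I := fun n => (\int[conv_power nu n]_x (\1_A x)%:E)%E.
have mI' x : measurable_fun setT (fun y : TR => (\1_A (x + y))%:E : \bar R).
  apply: (measurableT_comp mI); exact: measurable_funD.
have I0' (x y : R) : (0 <= (\1_A (x + y))%:E :> \bar R)%E by exact: I0.
have mav n : measurable_fun setT
    (fun x : TR => \int[conv_power nu n]_y (\1_A (x + y)%R)%:E)%E.
  exact: (measurable_ge0_average _ mI I0).
rewrite (ge0_integral_cpoisson _ _ (measurable_ge0_average _ mI I0)); last first.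
  by move=> x; apply: integral_ge0.
transitivity (\sum_(n <oo) \sum_(m <oo)
    (poisson_weight a n * poisson_weight b m)%:E * I (n + m)%N)%E.
  apply: eq_eseriesr => n _.
  under eq_integral => x _ do rewrite (ge0_integral_cpoisson _ _ (mI' x) (I0' x)).
  rewrite integral_nneseries//; last 2 first.
  - by move=> m; apply: emeasurable_funM => //.
  - by move=> m x _; rewrite mule_ge0 ?lee_fin ?poisson_weight_ge0// integral_ge0.
  rewrite -nneseriesZl; last first.
    move=> m _; apply: integral_ge0 => x _.
    by rewrite mule_ge0 ?lee_fin ?poisson_weight_ge0// integral_ge0.
  apply: eq_eseriesr => m _.
  rewrite ge0_integralZl//; last 2 first.
  - by move=> x _; apply: integral_ge0.
  - by rewrite lee_fin poisson_weight_ge0.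
  by rewrite muleA -EFinM /I ge0_integral_conv_powerD.
rewrite nneseries_triangle; last first.
  move=> n m; rewrite mule_ge0 ?lee_fin ?mulr_ge0 ?poisson_weight_ge0//.
  exact: integral_ge0.
apply: eq_eseriesr => N _; rewrite -poisson_weightD// -sumEFin.
rewrite ge0_sume_distrl; last first.
  by move=> i _; rewrite lee_fin mulr_ge0 ?poisson_weight_ge0.
apply: eq_big_nat => i /andP[_ iN]; rewrite subnKC// -ltnS//.
Qed.

Lemma Rintegral_cpoissonD a b nu (f : TR -> R) : 0 <= a -> 0 <= b -> bmeas f ->
  \int[cpoisson a nu]_x \int[cpoisson b nu]_y f (x + y) =
  \int[cpoisson (a + b) nu]_z f z.
Proof.
move=> a0 b0 bf; rewrite -Rintegral_convolution//; congr fine.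
by apply: eq_measure_integral => A mA _; exact: convolution_cpoisson.
Qed.

Lemma integral_conv_power1 nu (f : TR -> \bar R) :
  measurable_fun setT f -> (forall x, 0 <= f x)%E ->
  (\int[conv_power nu 1]_x f x = \int[nu]_x f x)%E.
Proof.
move=> mf f0; rewrite /= ge0_integral_convolution//.
apply: eq_integral => x _; rewrite integral_dirac//.
  by rewrite diracT mul1e addr0.
apply: (measurableT_comp mf); exact: measurable_funD.
Qed.

Lemma poisson_weight0 c : poisson_weight c 0 = expR (- `|c|).
Proof. by rewrite /poisson_weight expr0 fact0 invr1 !mulr1. Qed.

Lemma poisson_weight1 c : poisson_weight c 1 = `|c| * expR (- `|c|).
Proof. by rewrite /poisson_weight expr1 (_ : 1`! = 1)%N// invr1 mulr1 mulrC. Qed.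

(** Only the terms with no jump and with one jump are kept. Applied to [C + f] and to [C - f], the
    one-sided bound yields a two-sided expansion. *)
Lemma cpoisson_ge c nu (f : TR -> R) : bmeas f -> (forall x, 0 <= f x) ->
  poisson_weight c 0 * f 0 + poisson_weight c 1 * \int[nu]_x f x <=
  \int[cpoisson c nu]_x f x.
Proof.
move=> bf f0; have mf : measurable_fun setT (EFin \o f).
  by case: bf => mf _; exact/measurable_EFinP.
rewrite -lee_fin EFinD !EFinM !EFin_Rintegral// ge0_integral_cpoisson//.
rewrite -(integral_conv_power1 nu mf)//.
have -> : (f 0)%:E = (\int[conv_power nu 0]_x (f x)%:E)%E.
  by rewrite integral_dirac// diracT mul1e.
apply: le_trans (nneseries_lim_ge 2 _).
  by rewrite big_nat_recr//= big_nat1.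
by move=> n _ _; rewrite mule_ge0 ?lee_fin ?poisson_weight_ge0// integral_ge0// => x _; rewrite lee_fin.
Qed.

(** With [p = expR (- s)], the error splits into the mass [1 - p - s * p] of two or more jumps, the
    defect [p - 1 + s] of the weight of no jump, and the defect [s - s * p] of that of one jump.
    Each is at most [s ^ 2], whence the constant 3. *)
Lemma cpoisson_expansion s nu (f : TR -> R) C : 0 <= s ->
  measurable_fun setT f -> (forall x, `|f x| <= C) ->
  `|\int[cpoisson s nu]_x f x - f 0 - s * (\int[nu]_x f x - f 0)| <=
  3 * C * s ^+ 2.
Proof.
move=> s0 mf fC; have bf : bmeas f by split=> //; exists C.
have bC (r : R) : bmeas (fun _ : TR => r) by exact: bmeas_cst.
have lo := @cpoisson_ge s nu (fun x => f x + C) (bmeasD bf (bC C)).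
have hi := @cpoisson_ge s nu (fun x => C - f x) (bmeasB (bC C) bf).
rewrite !RintegralD ?Rintegral_cst1 in lo => //; try exact: bmeas_integrable.
rewrite !RintegralB ?Rintegral_cst1 in hi => //; try exact: bmeas_integrable.
have fb x : - C <= f x <= C by rewrite -ler_norml.
have f0 := fb 0; rewrite poisson_weight0 poisson_weight1 ger0_norm// in hi lo.
move: hi lo; set p := expR (- s); set I := \int[nu]_x f x; set J := \int[cpoisson s nu]_x f x.
have IC : `|I| <= C by apply: Rintegral_norm_le => //; exact: bmeas_integrable.
have p1 : 1 - s <= p by exact: expR_ge1Dx.
have p2 : p * (1 + s) <= 1.
  rewrite -[leRHS](expRxMexpNx_1 s) [leRHS]mulrC ler_wpM2l ?expR_ge0//.
  exact: expR_ge1Dx.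
have p3 : p <= 1 by rewrite /p expRN invf_le1 ?expR_gt0// -expR0 ler_expR.
move=> hi lo.
have {}hi : (p + s * p) * C - p * f 0 - s * p * I <= C - J.
  by move: (hi ltac:(move=> x; have := fb x; lra)); lra.
have {}lo : (p + s * p) * C + p * f 0 + s * p * I <= J + C.
  by move: (lo ltac:(move=> x; have := fb x; lra)); lra.
move: IC; rewrite !ler_norml => IC.
have C0 : 0 <= C by lra.
have q1 : (1 - s) * (1 + s) <= p * (1 + s) by rewrite ler_wpM2r//; lra.
set r := p - 1 + s.
have r0 : 0 <= r <= s ^+ 2.
  rewrite /r; have : s * p <= s by rewrite ler_piMr. 
  have : s * (1 - s) <= s * p by rewrite ler_wpM2l.
  by move: p2; rewrite mulrDr mulr1 mulrBr mulr1 -expr2 [p * s]mulrC; lra.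
have t0 : 0 <= s - s * p <= s ^+ 2.
  have : s * p <= s by rewrite ler_piMr. 
  have : s * (1 - s) <= s * p by rewrite ler_wpM2l.
  by move: p2; rewrite mulrDr mulr1 mulrBr mulr1 -expr2 [p * s]mulrC; lra.
have : `|r * f 0| <= s ^+ 2 * C.
  by rewrite normrM ler_pM// ger0_norm//; case/andP: r0.
have : `|(s - s * p) * I| <= s ^+ 2 * C.
  rewrite normrM ler_pM//; last by rewrite ler_norml.
  by rewrite ger0_norm//; case/andP: t0.
rewrite !ler_norml /r.
nra.
Qed.

(** The exponential of a sum is a product, so it tilts each jump separately. The hypothesis says
    that [c] times [nu], tilted, is [c2] times [nu2]; the powers [c ^ n] and [c2 ^ n] keep track of
    the normalisations. *)
Lemma tilt_conv_power (c c2 : R) nu nu2 n (f : TR -> \bar R) :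
  0 <= c -> 0 <= c2 ->
  (forall g : TR -> \bar R, measurable_fun setT g -> (forall x, 0 <= g x)%E ->
    (c%:E * \int[nu]_x (g x * (expR x)%:E) = c2%:E * \int[nu2]_x g x)%E) ->
  measurable_fun setT f -> (forall x, 0 <= f x)%E ->
  ((c ^+ n)%:E * \int[conv_power nu n]_x (f x * (expR x)%:E) =
   (c2 ^+ n)%:E * \int[conv_power nu2 n]_x f x)%E.
Proof.
move=> c0 c20 tilt.
have me : measurable_fun setT (fun x : TR => (expR x)%:E : \bar R).
  by apply/measurable_EFinP; exact: measurable_expR.
elim: n f => [|n ih] f mf f0.
  rewrite !expr0 !mul1e !integral_dirac//; last exact: emeasurable_funM.
  by rewrite expR0 mule1.
have mfe : measurable_fun setT (fun x : TR => f x * (expR x)%:E)%E.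
  exact: emeasurable_funM.
have mfx x : measurable_fun setT (fun y : TR => f (x + y)).
  apply: (measurableT_comp mf); exact: measurable_funD.
have fe0 x : (0 <= f x * (expR x)%:E)%E by rewrite mule_ge0// lee_fin expR_ge0.
rewrite /= (ge0_integral_convolution _ _ mf f0) (ge0_integral_convolution _ _ mfe fe0).
have mfxe (x : R) : measurable_fun setT (fun y : TR => f (x + y)%R * (expR y)%:E)%E.
  exact: emeasurable_funM.
have fxe0 (x y : R) : (0 <= f (x + y)%R * (expR y)%:E)%E.
  by rewrite mule_ge0// lee_fin expR_ge0.
pose A (x : R) := (\int[conv_power nu2 n]_y f (x + y)%R)%E.
have mA : measurable_fun setT (A : TR -> \bar R).
  exact: (measurable_ge0_average _ mf f0).
have A0 x : (0 <= A x)%E by apply: integral_ge0.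
have -> : (\int[nu]_x \int[conv_power nu n]_y (f (x + y)%R * (expR (x + y))%:E) =
   \int[nu]_x ((\int[conv_power nu n]_y (f (x + y)%R * (expR y)%:E)) * (expR x)%:E))%E.
  apply: eq_integral => x _; rewrite -ge0_integralZr ?lee_fin ?expR_ge0//.
  by apply: eq_integral => y _; rewrite addrC expRD EFinM muleA.
rewrite !exprS [c * _]mulrC [c2 * _]mulrC !EFinM -!muleA -(tilt _ mA A0).
rewrite !muleA [((c ^+ n)%:E * _)%E]muleC [((c2 ^+ n)%:E * _)%E]muleC -!muleA.
congr (_ * _)%E.
rewrite -[RHS]ge0_integralZl; [|by []|exact: emeasurable_funM|by move=> x _; rewrite mule_ge0// lee_fin expR_ge0|
  by rewrite lee_fin exprn_ge0].
rewrite -[LHS]ge0_integralZl; [|by []| | |by rewrite lee_fin exprn_ge0].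
- by apply: eq_integral => x _; rewrite !muleA ih.
- apply: emeasurable_funM => //.
  (* Measurability in [x]: the integrand is the function [f * expR] taken at [x + y], times
     [expR (- x)], hence the integral is an average of translates times a measurable factor. *)
  rewrite (_ : (fun x => _) = fun x : TR =>
    \int[conv_power nu n]_y (f (x + y)%R * (expR (x + y))%:E * (expR (- x))%:E))%E.
    rewrite (_ : (fun x => _) = fun x : TR =>
    (\int[conv_power nu n]_y (f (x + y)%R * (expR (x + y))%:E)) * (expR (- x))%:E)%E.
    apply: emeasurable_funM; first exact: (measurable_ge0_average _ mfe fe0).
    apply/measurable_EFinP; apply: (measurableT_comp (@measurable_expR R)).
    exact: measurable_funN.
    apply/funext => x; rewrite ge0_integralZr ?lee_fin ?expR_ge0//.
    apply: (measurableT_comp mfe); exact: measurable_funD.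
  apply/funext => x; apply: eq_integral => y _.
  by rewrite -muleA -EFinM -expRD addrAC subrr add0r.
- by move=> x _; rewrite mule_ge0 ?lee_fin ?expR_ge0// integral_ge0.
Qed.

(** Term by term the factorials agree, the powers of [c] and [c2] are absorbed by the tilt, and the
    ratio of the exponential normalisations leaves the constant [expR (c2 - c)], which is the
    exponential moment of the law. *)
Lemma tilt_cpoisson (c c2 : R) nu nu2 (f : TR -> \bar R) :
  0 <= c -> 0 <= c2 ->
  (forall g : TR -> \bar R, measurable_fun setT g -> (forall x, 0 <= g x)%E ->
    (c%:E * \int[nu]_x (g x * (expR x)%:E) = c2%:E * \int[nu2]_x g x)%E) ->
  measurable_fun setT f -> (forall x, 0 <= f x)%E ->
  (\int[cpoisson c nu]_x (f x * (expR x)%:E) =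
   (expR (c2 - c))%:E * \int[cpoisson c2 nu2]_x f x)%E.
Proof.
move=> c0 c20 tilt mf f0.
have me : measurable_fun setT (fun x : TR => (expR x)%:E : \bar R).
  by apply/measurable_EFinP; exact: measurable_expR.
have fe0 x : (0 <= f x * (expR x)%:E)%E by rewrite mule_ge0// lee_fin expR_ge0.
have mfe := emeasurable_funM mf me.
rewrite (ge0_integral_cpoisson _ _ mf f0) (ge0_integral_cpoisson _ _ mfe fe0).
rewrite -nneseriesZl; last first.
  by move=> n _; rewrite mule_ge0 ?lee_fin ?poisson_weight_ge0// integral_ge0.
apply: eq_eseriesr => n _.
rewrite [RHS]muleA -[in RHS]EFinM /poisson_weight !ger0_norm// [in RHS]mulrA.
rewrite -expRD addrAC subrr add0r.
rewrite [c ^+ n / _]mulrC [c2 ^+ n / _]mulrC !mulrA !EFinM -!muleA.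
by rewrite (tilt_conv_power n _ _ tilt).
Qed.

Section shifted.
Variables (b c : R) (nu : probability TR R).

Definition subr_map : TR -> TR := fun x => x - b.

HB.instance Definition _ := @isMeasurableFun.Build _ _ _ _ subr_map
  (measurable_funB (@measurable_id _ _ _) (measurable_cst b)).

Definition shifted_cpoisson : probability TR R :=
  distribution (cpoisson c nu) subr_map.

Lemma ge0_integral_shifted_cpoisson (f : TR -> \bar R) : measurable_fun setT f ->
  (forall x, 0 <= f x)%E ->
  (\int[shifted_cpoisson]_x f x = \int[cpoisson c nu]_x f (x - b)%R)%E.
Proof.
move=> mf f0; rewrite /shifted_cpoisson.
by rewrite (@ge0_integral_distribution _ _ _ _ _ _ subr_map f mf f0).
Qed.

Lemma Rintegral_shifted_cpoisson (f : TR -> R) : bmeas f ->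
  \int[shifted_cpoisson]_x f x = \int[cpoisson c nu]_x f (x - b).
Proof. by move=> bf; rewrite Rintegral_distribution. Qed.

End shifted.

(** The semigroup property, iterated. It serves twice: the summands exchanged for those of a row add
    up to the limit law exactly, and taking [b / m] and [c / m] gives infinite divisibility. *)
Lemma Rintegral_sum_shifted_cpoisson m b c nu (f : TR -> R) x : 0 <= c ->
  bmeas f ->
  \int[prod_prob (fun _ : 'I_m => shifted_cpoisson b c nu)]_y
    f (x + sum_coord (fun _ => id) y) =
  \int[shifted_cpoisson (m%:R * b) (m%:R * c) nu]_z f (x + z).
Proof.
move=> c0 bf; elim: m x => [|m ih] x.
  rewrite Rintegral_prod_prob0 /sum_coord big_ord0.
  rewrite !mul0r Rintegral_shifted_cpoisson; last exact: bmeas_translate.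
  have [C fC] := bf.2; have mg : measurable_fun setT (fun z : TR => f (x + (z - 0))).
    by apply: (measurableT_comp bf.1); apply: measurable_funD => //; exact: measurable_funB.
  (* At [s = 0] the error bound vanishes, so [cpoisson 0 nu] integrates like the Dirac mass at 0. *)
  have := @cpoisson_expansion 0 nu _ C (lexx 0) mg (fun z => fC _).
  rewrite expr0n mulr0 mul0r subr0 normr_le0 subr_eq0 => /eqP ->.
  by rewrite subr0.
rewrite (@Rintegral_sum_coordS _ TR R m _ (fun _ => id) f x bf (fun i => @measurable_id _ TR setT)).
under eq_Rintegral do rewrite ih.
have mc0 : 0 <= m%:R * c by rewrite mulr_ge0.
rewrite Rintegral_shifted_cpoisson; last first.
  apply: (@bmeas_translate _ _ _ (fun y : R =>
    \int[shifted_cpoisson (m%:R * b) (m%:R * c) nu]_z f (y + z))) => //.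
  exact: bmeas_average.
under eq_Rintegral => u _.
  rewrite Rintegral_shifted_cpoisson; last exact: bmeas_translate.
  under eq_Rintegral => v _.
    rewrite (_ : x + (u - b) + (v - m%:R * b) = x + ((u + v) - m.+1%:R * b)); last first.
      by rewrite -natr1; ring.
    over.
  over.
rewrite [RHS]Rintegral_shifted_cpoisson; last exact: (bmeas_translate x bf).
rewrite (Rintegral_cpoissonD nu c0 mc0 (f := fun z => f (x + (z - m.+1%:R * b)))).
  have -> : c + m%:R * c = m.+1%:R * c by rewrite -natr1; ring.
  reflexivity.
by apply: (bmeas_translate x bf); exact: measurable_funB.
Qed.

Lemma shifted_cpoisson_infinitely_divisible b c nu : 0 <= c ->
  infinitely_divisible (shifted_cpoisson b c nu).
Proof.
move=> c0 m m0; exists (shifted_cpoisson (b / m%:R) (c / m%:R) nu) => A mA.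
have m0' : m%:R != 0 :> R by rewrite pnatr_eq0 -lt0n.
have bA : bmeas (\1_A : TR -> R).
  by split; [exact: measurable_indic|exists 1 => x; rewrite ger0_norm// indicE lern1 leq_b1].
have := @Rintegral_sum_shifted_cpoisson m (b / m%:R) (c / m%:R) nu \1_A 0
  (divr_ge0 c0 (ler0n _ _)) bA.
rewrite ![m%:R * _]mulrC !divfK//.
under [X in _ = X -> _]eq_Rintegral do rewrite add0r.
under [X in X = _ -> _]eq_Rintegral do rewrite add0r.
have mS : measurable [set y : m.-tuple TR | A (\sum_(i < m) tnth y i)].
  rewrite -[X in measurable X]setTI.
  apply: (@measurable_sum_coord _ TR R m (fun _ => id)) => //.
move=> E0; have {E0} := congr1 EFin E0.
rewrite [in X in _ = X](EFin_Rintegral _ bA) (integral_indic _ measurableT mA) setIT => <-.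
have bS : bmeas (\1_[set y : m.-tuple TR | A (\sum_(i < m) tnth y i)] : _ -> R).
  split; first exact: measurable_indic.
  by exists 1 => x; rewrite ger0_norm// indicE lern1 leq_b1.
by rewrite (EFin_Rintegral _ bS) (integral_indic _ measurableT mS) setIT.
Qed.


End compound_poisson.

Local Opaque shifted_cpoisson.

(** * Test functions and weak convergence *)

Section log_bounds.
Context (R : realType).
Implicit Types a b x : R.

Lemma ln1D_ge x : -1 < x -> x / (1 + x) <= ln (1 + x).
Proof.
move=> x1; have d0 : 0 < 1 + x by lra.
have := @le_ln1Dx R (- (x / (1 + x))).
have -> : 1 + - (x / (1 + x)) = (1 + x)^-1 by field; rewrite gt_eqF.
rewrite lnV ?posrE// lerN2; apply.
rewrite ltrN2 ltr_pdivrMr//; lra.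
Qed.

Lemma ln1D_le x : -1 < x -> ln (1 + x) <= x.
Proof. exact: le_ln1Dx. Qed.

Lemma ln1D_expansion x : - 2^-1 <= x -> `|ln (1 + x) - x| <= 2 * x ^+ 2.
Proof.
move=> x1; have d0 : 0 < 1 + x by lra.
have l1 := @ln1D_le x ltac:(lra); have l2 := @ln1D_ge x ltac:(lra).
rewrite ler0_norm ?subr_le0// opprB.
apply: (@le_trans _ _ (x - x / (1 + x))); first by rewrite lerD2l lerN2.
have -> : x - x / (1 + x) = x ^+ 2 / (1 + x) by field; rewrite gt_eqF.
rewrite ler_pdivrMr//; have := sqr_ge0 x; nra.
Qed.

Lemma normr_ln1D_le x : - 2^-1 <= x -> `|ln (1 + x)| <= 2 * `|x|.
Proof.
move=> x1; have d0 : 0 < 1 + x by lra.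
have l1 := @ln1D_le x ltac:(lra); have l2 := @ln1D_ge x ltac:(lra).
have [x0|x0] := leP 0 x.
  rewrite !ger0_norm//; first lra.
  by apply: le_trans l2; rewrite divr_ge0// ltW.
rewrite !ler0_norm ?(ltW x0)//; last lra.
suff : 2 * x <= x / (1 + x) by lra.
rewrite ler_pdivlMr//; nra.
Qed.

Lemma ln1D_ge0_le a : 0 <= a -> 0 <= ln (1 + a) <= a.
Proof.
move=> a0; rewrite ln_ge0 ?lerDl// ln1D_le//; lra.
Qed.

Lemma ln1D_lipschitz a b : 0 <= a -> 0 <= b ->
  `|ln (1 + a) - ln (1 + b)| <= `|a - b|.
Proof.
wlog ab : a b / a <= b.
  move=> H a0 b0; case: (leP a b) => [ab|/ltW ba]; first exact: H.
  by rewrite distrC [leRHS]distrC; exact: H.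
move=> a0 b0; rewrite ler0_norm; last first.
  by rewrite subr_le0 ler_ln ?posrE; lra.
rewrite ler0_norm; last by rewrite subr_le0.
rewrite !opprB -ln_div ?posrE; [|lra|lra].
have -> : (1 + b) / (1 + a) = 1 + (b - a) / (1 + a) by field; rewrite gt_eqF//; lra.
have q0 : 0 <= (b - a) / (1 + a) by rewrite divr_ge0//; lra.
apply: le_trans (ln1D_le _) _; first lra.
rewrite ler_pdivrMr; nra.
Qed.

End log_bounds.

Section test_functions.
Context (R : realType).
Implicit Types (C x t a b : R) (f g : R -> R).

(* f1 plays the role of the derivative of f *)
Definition test_pair C f f1 : Prop :=
  [/\ measurable_fun setT f, forall x, `|f x| <= C, forall x, `|f1 x| <= C,
      forall x y, `|f1 x - f1 y| <= C * `|x - y| &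
      forall x t, `|f (x + t) - f x - t * f1 x| <= C * t ^+ 2].

Definition test_fun f := exists C f1, test_pair C f f1.

(** The change of [f] when the likelihood ratio is multiplied by [1 + w], minus its linear part. Row
    densities [1 + w] have integral 1, so the linear part drops out of the expectation, and what is
    left vanishes quadratically at [w = 0]. *)
Definition log_increment f f1 x w := f (x + ln (1 + w)) - f x - w * f1 x.

Section bounds.
Variables (C : R) (f f1 : R -> R) (ff1 : test_pair C f f1).

Lemma test_pair_ge0 : 0 <= C.
Proof. by case: ff1 => _ fC _ _ _; exact: le_trans (fC 0). Qed.

Lemma test_pair_bmeas : bmeas f.
Proof. by case: ff1 => mf fC _ _ _; split; [|exists C]. Qed.

Let C0 := test_pair_ge0.
Let fC x : `|f x| <= C. Proof. by case: ff1. Qed.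
Let f1C x : `|f1 x| <= C. Proof. by case: ff1. Qed.
Let f1L x y : `|f1 x - f1 y| <= C * `|x - y|. Proof. by case: ff1. Qed.
Let fT x t : `|f (x + t) - f x - t * f1 x| <= C * t ^+ 2. Proof. by case: ff1. Qed.

Lemma test_pair_lipschitz x y : `|f x - f y| <= 2 * C * `|x - y|.
Proof.
have [xy|/ltW xy] := leP `|x - y| 1; last first.
  apply: le_trans (ler_normB _ _) _; have := fC x; have := fC y; have := C0; nra.
have := fT y (x - y); have -> : y + (x - y) = x by ring.
have -> : (x - y) ^+ 2 = `|x - y| ^+ 2 by rewrite real_normK// num_real.
move=> H; have := le_trans (ler_normD (f x - f y - (x - y) * f1 y) ((x - y) * f1 y)) (lerD H (lexx _)).
rewrite subrK => /le_trans; apply; rewrite normrM.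
have := f1C y; have := normr_ge0 (x - y).
have := C0; move: `|x - y| xy => u xy c0 u0 fc.
have : 0 <= C * (u * (1 - u)) by rewrite !mulr_ge0// subr_ge0.
have : 0 <= u * (C - `|f1 y|) by rewrite mulr_ge0// subr_ge0.
lra.
Qed.

Let psi := log_increment f f1.

Lemma log_increment_lipschitz x a b : 0 <= a -> 0 <= b ->
  `|psi x a - psi x b| <= 3 * C * `|a - b|.
Proof.
move=> a0 b0; rewrite /psi /log_increment.
have -> : f (x + ln (1 + a)) - f x - a * f1 x - (f (x + ln (1 + b)) - f x - b * f1 x)
  = (f (x + ln (1 + a)) - f (x + ln (1 + b))) - (a - b) * f1 x by ring.
apply: le_trans (ler_normB _ _) _.
have H1 := test_pair_lipschitz (x + ln (1 + a)) (x + ln (1 + b)).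
have H2 := ln1D_lipschitz a0 b0.
have E : x + ln (1 + a) - (x + ln (1 + b)) = ln (1 + a) - ln (1 + b) by ring.
rewrite E in H1.
rewrite normrM; have := f1C x; have := normr_ge0 (a - b).
have : 2 * C * `|ln (1 + a) - ln (1 + b)| <= 2 * C * `|a - b|.
  by rewrite ler_wpM2l// mulr_ge0.
move: H1; move: (`|f _ - _|) (`|ln _ - _|) (`|a - b|) (`|f1 x|) => u v w z.
move=> H1 H3 w0 z0; have : 0 <= w * (C - z) by rewrite mulr_ge0// subr_ge0.
lra.
Qed.

Lemma log_increment0 x : psi x 0 = 0.
Proof. by rewrite /psi /log_increment addr0 ln1 addr0 mul0r !subrr. Qed.

Lemma log_increment_le x a : 0 <= a -> `|psi x a| <= 3 * C * a.
Proof.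
move=> a0; have := log_increment_lipschitz x a0 (lexx 0).
by rewrite log_increment0 !subr0 [in leRHS]ger0_norm.
Qed.

(** Taylor at step [t = ln (1 + a) <= a], plus [a - t <= a ^ 2] for the mismatch of the linear
    terms. For large [a] the linear bound above is the useful one, since only the first moment of
    the signal is controlled. *)
Lemma log_increment_le_sqr x a : 0 <= a -> `|psi x a| <= 2 * C * a ^+ 2.
Proof.
move=> a0; rewrite /psi /log_increment; set t := ln (1 + a).
have /andP[t0 ta] := ln1D_ge0_le a0.
have tl : a - t <= a ^+ 2.
  have := @ln1D_ge R a ltac:(lra); rewrite -/t.
  rewrite ler_pdivrMr ?ltr_wpDr//; nra.
have -> : f (x + t) - f x - a * f1 x =
  (f (x + t) - f x - t * f1 x) + (t - a) * f1 x by ring.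
apply: le_trans (ler_normD _ _) _.
have H1 := fT x t; have H2 : t ^+ 2 <= a ^+ 2 by rewrite ler_sqr ?nnegrE.
rewrite normrM [`|t - a|]ler0_norm ?subr_le0// opprB.
have := f1C x; have := C0; have : 0 <= a - t by rewrite subr_ge0.
have := normr_ge0 (f1 x).
nra.
Qed.

(** Write [1 + a + b = (1 + a) * (1 + be)] with [be = b / (1 + a)]: the perturbation is a further
    step from [y = x + ln (1 + a)]. Its linear part [be * f1 y] differs from [b * f1 x] by the
    variation of [f1] between [x] and [y], at most [2 * C * Num.min 1 a], and by [be - b], of size
    at most [|b| * Num.min 1 a]; the rest is of order [b ^ 2]. *)
Lemma log_increment_perturb x a b : 0 <= a -> - 2^-1 <= a + b ->
  `|psi x (a + b) - psi x a| <=
  3 * C * (`|b| * Num.min 1 a) + 10 * C * b ^+ 2.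
Proof.
move=> a0 ab; rewrite /psi /log_increment.
have a1 : 0 < 1 + a by lra.
pose y := x + ln (1 + a).
have m0 : 0 <= Num.min 1 a by rewrite le_min ler01.
have b2 : b ^+ 2 = `|b| ^+ 2 by rewrite real_normK// num_real.
pose be := b / (1 + a).
have -> : f (x + ln (1 + (a + b))) - f x - (a + b) * f1 x -
    (f (x + ln (1 + a)) - f x - a * f1 x) =
    f (x + ln (1 + (a + b))) - f y - b * f1 x by rewrite /y; ring.
(* If [be < -1/2] then [|b| >= 1/2], and boundedness suffices: [2 * C + C * |b|] is at most
   [(8 + 2) * C * b ^ 2]. This case dictates the constant 10. *)
have [beh|beh] := leP (- 2^-1) be; last first.
  have bh : 1 <= 2 * `|b|.
    move: beh; rewrite /be ltr_pdivrMr// => beh.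
    have : b < 0 by nra.
    move=> b0; rewrite ltr0_norm//; nra.
  apply: le_trans (ler_normB _ _) _.
  rewrite normrM; have := f1C x; have := fC y; have := fC (x + ln (1 + (a + b))).
  have : 0 <= 3 * C * (`|b| * Num.min 1 a) by rewrite !mulr_ge0.
  have : `|f (x + ln (1 + (a + b))) - f y| <= 2 * C.
    by apply: le_trans (ler_normB _ _) _; have := fC y; have := fC (x + ln (1 + (a + b))); lra.
  rewrite b2; have := C0; have := normr_ge0 b.
  move=> z0 c0 h1 h2 _ _ h3.
  have : 0 <= `|b| * (C - `|f1 x|) by rewrite mulr_ge0// subr_ge0.
  have : 0 <= C * (2 * `|b| - 1) by rewrite mulr_ge0// subr_ge0.
  have : 0 <= C * `|b| * (2 * `|b| - 1) by rewrite !mulr_ge0// subr_ge0.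
  lra.
set t := ln (1 + be).
have E : ln (1 + (a + b)) = ln (1 + a) + t.
  rewrite /t -lnM ?posrE//; last lra.
  by congr ln; rewrite /be; field; rewrite gt_eqF.
have beb : `|be| <= `|b|.
  rewrite normrM normfV (gtr0_norm a1) ler_pdivrMr//.
  by rewrite ler_peMr//; lra.
have tb : `|t - be| <= 2 * b ^+ 2.
  apply: le_trans (ln1D_expansion beh) _; rewrite ler_wpM2l// b2.
  by rewrite -[be ^+ 2]real_normK ?num_real// ler_sqr ?nnegrE.
have t2 : t ^+ 2 <= 4 * b ^+ 2.
  have H : `|t| <= 2 * `|b|.
    by apply: le_trans (normr_ln1D_le beh) _; rewrite ler_wpM2l.
  rewrite b2 -[t ^+ 2]real_normK ?num_real//; have := normr_ge0 t; nra.
rewrite E addrA -/y.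
have -> : f (y + t) - f y - b * f1 x = (f (y + t) - f y - t * f1 y) +
   (t - be) * f1 y + be * (f1 y - f1 x) + (be - b) * f1 x by ring.
have d1 : `|f1 y - f1 x| <= 2 * C * Num.min 1 a.
  rewrite /Num.min; case: ifPn => h.
    by apply: le_trans (ler_normB _ _) _; have := f1C x; have := f1C y; lra.
  apply: le_trans (f1L y x) _; rewrite /y addrC addKr.
  have /andP[l0 la] := ln1D_ge0_le a0; rewrite ger0_norm//.
  have := C0; nra.
have d2 : `|be - b| <= `|b| * Num.min 1 a.
  have -> : be - b = - (b * (a / (1 + a))) by rewrite /be; field; rewrite gt_eqF.
  rewrite normrN normrM ler_wpM2l// ger0_norm; last by rewrite divr_ge0// ltW.
  rewrite /Num.min; case: ifPn => h; rewrite ler_pdivrMr//; nra.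
have h1 : `|(t - be) * f1 y| <= 2 * C * b ^+ 2.
  rewrite normrM; have := f1C y; have := normr_ge0 (f1 y); have := normr_ge0 (t - be).
  have := C0; nra.
have h2 : `|be * (f1 y - f1 x)| <= `|b| * (2 * C * Num.min 1 a).
  by rewrite normrM ler_pM.
have h3 : `|(be - b) * f1 x| <= `|b| * Num.min 1 a * C by rewrite normrM ler_pM.
have h0 := fT y t.
have t2C : C * t ^+ 2 <= 4 * C * b ^+ 2 by have := C0; nra.
have b20 : 0 <= C * b ^+ 2 by rewrite mulr_ge0// sqr_ge0.
apply: le_trans (ler_normD _ _) _.
apply: le_trans (lerD (ler_normD _ _) (lexx _)) _.
apply: le_trans (lerD (lerD (ler_normD _ _) (lexx _)) (lexx _)) _.
lra.
Qed.

(** Meant for the regime where the scale tends to 0: multiplied by the scale, this bounded part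
    disappears and only the subtracted linear term survives, as a drift. *)
Lemma log_increment_drift x a : `|psi x a + a * f1 x| <= 2 * C.
Proof.
rewrite /psi /log_increment subrK; apply: le_trans (ler_normB _ _) _.
have := fC x; have := fC (x + ln (1 + a)); lra.
Qed.

End bounds.

Lemma measurable_log_increment f f1 x : measurable_fun setT f ->
  measurable_fun setT (log_increment f f1 x).
Proof.
move=> mf; apply: measurable_funB; last by apply: measurable_funM.
apply: measurable_funB => //; apply: (measurableT_comp mf).
apply: measurable_funD => //; apply: (measurableT_comp (@measurable_ln R)).
exact: measurable_funD.
Qed.

Lemma test_funD f g : test_fun f -> test_fun g -> test_fun (fun x => f x + g x).
Proof.
move=> [C [f' fP]] [K [g' gP]]; exists (C + K), (fun x => f' x + g' x).
have C0 := test_pair_ge0 fP; have K0 := test_pair_ge0 gP.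
case: fP => mf fC f1C f1L fT; case: gP => mg gC g1C g1L gT.
split.
- exact: measurable_funD.
- by move=> x; apply: le_trans (ler_normD _ _) _; exact: lerD.
- by move=> x; apply: le_trans (ler_normD _ _) _; exact: lerD.
- move=> x y; rewrite opprD addrACA mulrDl.
  by apply: le_trans (ler_normD _ _) _; exact: lerD.
- move=> x t; rewrite mulrDl.
  have -> : f (x + t) + g (x + t) - (f x + g x) - t * (f' x + g' x) =
    (f (x + t) - f x - t * f' x) + (g (x + t) - g x - t * g' x) by ring.
  by apply: le_trans (ler_normD _ _) _; exact: lerD.
Qed.

Lemma test_funZ k f : test_fun f -> test_fun (fun x => k * f x).
Proof.
move=> [C [f' fP]]; exists (`|k| * C), (fun x => k * f' x).
have C0 := test_pair_ge0 fP.
case: fP => mf fC f1C f1L fT; split.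
- exact: measurable_funM.
- by move=> x; rewrite normrM ler_wpM2l.
- by move=> x; rewrite normrM ler_wpM2l.
- by move=> x y; rewrite -mulrBr normrM -mulrA ler_wpM2l.
- move=> x t.
  have -> : k * f (x + t) - k * f x - t * (k * f' x) =
    k * (f (x + t) - f x - t * f' x) by ring.
  by rewrite normrM -mulrA ler_wpM2l.
Qed.

Lemma test_fun_cst (r : R) : test_fun (fun=> r).
Proof.
exists `|r|, (fun=> 0); split => //.
- by move=> x; rewrite normr0.
- by move=> x y; rewrite subrr normr0 mulr_ge0.
- by move=> x t; rewrite mulr0 !subrr normr0 mulr_ge0 ?sqr_ge0.
Qed.

Lemma test_fun_sum (I : Type) (s : seq I) (F : I -> R -> R) :
  (forall i, test_fun (F i)) -> test_fun (fun x => \sum_(i <- s) F i x).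
Proof.
move=> tF; elim: s => [|i s ih].
  by under eq_fun do rewrite big_nil; exact: test_fun_cst.
by under eq_fun do rewrite big_cons; exact: test_funD.
Qed.

Lemma test_fun_affine f k b : test_fun f -> test_fun (fun x => f (k * (x - b))).
Proof.
move=> [C [f' fP]]; have C0 := test_pair_ge0 fP.
exists (C * (1 + `|k| + `|k| ^+ 2)), (fun x => k * f' (k * (x - b))).
have k0 := normr_ge0 k; have k2 := sqr_ge0 `|k|.
have Ck : 0 <= C * `|k| by rewrite mulr_ge0.
have Ck2 : 0 <= C * `|k| ^+ 2 by rewrite mulr_ge0.
case: fP => mf fC f1C f1L fT; split.
- apply: (measurableT_comp mf); apply: measurable_funM => //.
  exact: measurable_funB.
- by move=> x; apply: le_trans (fC _) _; lra.
- move=> x; rewrite normrM; apply: (@le_trans _ _ (`|k| * C)); last lra.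
  by rewrite ler_wpM2l.
- move=> x y; rewrite -mulrBr normrM.
  apply: (@le_trans _ _ (`|k| * (C * (`|k| * `|x - y|)))).
    rewrite ler_wpM2l//; apply: le_trans (f1L _ _) _.
    rewrite ler_wpM2l// -mulrBr normrM.
    by have -> : x - b - (y - b) = x - y by ring.
  have := normr_ge0 (x - y); nra.
- move=> x t.
  have -> : k * (x + t - b) = k * (x - b) + k * t by ring.
  rewrite mulrCA mulrA; apply: le_trans (fT _ _) _.
  rewrite exprMn -[k ^+ 2]real_normK ?num_real//; have := sqr_ge0 t; nra.
Qed.

(** The cubic Hermite step. Its derivative [6 * x * (1 - x)] vanishes at both ends, so the function
    is of class C^1 with a Lipschitz derivative, which is the regularity that [test_pair]
    records. *)
Definition smooth_step x : R :=
  let c := Num.max 0 (Num.min 1 x) in 3 * c ^+ 2 - 2 * c ^+ 3.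

Lemma smooth_step0 x : x <= 0 -> smooth_step x = 0.
Proof.
move=> x0; rewrite /smooth_step min_r ?max_l//; last lra.
by rewrite !expr0n !mulr0 subr0.
Qed.

Lemma smooth_step1 x : 1 <= x -> smooth_step x = 1.
Proof. by move=> x1; rewrite /smooth_step min_l// max_r// !expr1n; ring. Qed.

Lemma smooth_step_mid x : 0 <= x <= 1 -> smooth_step x = 3 * x ^+ 2 - 2 * x ^+ 3.
Proof. by move=> /andP[x0 x1]; rewrite /smooth_step min_r// max_r. Qed.

Lemma smooth_step_itv x : 0 <= smooth_step x <= 1.
Proof.
have [x0|x0] := leP x 0; first by rewrite smooth_step0// lexx ler01.
have [x1|x1] := leP 1 x; first by rewrite smooth_step1// lexx ler01.
rewrite smooth_step_mid; last lra.
apply/andP; split.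
  have -> : 3 * x ^+ 2 - 2 * x ^+ 3 = x ^+ 2 * (3 - 2 * x) by ring.
  by rewrite mulr_ge0 ?sqr_ge0//; lra.
rewrite -subr_ge0.
have -> : 1 - (3 * x ^+ 2 - 2 * x ^+ 3) = (1 - x) ^+ 2 * (1 + 2 * x) by ring.
by rewrite mulr_ge0 ?sqr_ge0//; lra.
Qed.

(** The constant 6 is the maximum of the absolute value of the second derivative [6 - 12 * x] on the
    unit interval. The inequalities are polynomial once the position of each point relative to 0 and
    1 is fixed. *)
Lemma test_fun_smooth_step : test_fun smooth_step.
Proof.
pose S1 (x : R) := if 0 <= x <= 1 then 6 * x * (1 - x) else 0.
exists 6, S1.
have S1m x : 0 <= x <= 1 -> S1 x = 6 * x * (1 - x) by rewrite /S1 => ->.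
have S10 x : x <= 0 -> S1 x = 0.
  move=> x0; rewrite /S1; case: ifPn => // /andP[x0' _].
  have -> : x = 0 by apply/eqP; rewrite eq_le x0.
  by rewrite mulr0 mul0r.
have S11 x : 1 <= x -> S1 x = 0.
  move=> x0; rewrite /S1; case: ifPn => // /andP[_ x0'].
  have -> : x = 1 by apply/eqP; rewrite eq_le x0 x0'.
  by rewrite subrr mulr0.
have S1n x : 0 <= S1 x <= 2.
  rewrite /S1; case: ifPn => [/andP[h0 h1]|_]; last lra.
  by apply/andP; split; nra.
split.
- apply: measurable_funB; apply: measurable_funM => //;
    apply: measurable_funX; apply: measurable_maxr => //;
    exact: measurable_minr.
- by move=> x; have := smooth_step_itv x; rewrite ler_norml; lra.
- by move=> x; have := S1n x; rewrite ler_norml; lra.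
- move=> x y; wlog xy : x y / x <= y.
    move=> H; case: (leP x y) => [|/ltW] h; first exact: H.
    by rewrite distrC [`|x - y|]distrC; exact: H.
  rewrite [`|x - y|]distrC [`|y - x|]ger0_norm ?subr_ge0//.
  rewrite ler_norml.
  have [x0|/ltW x0] := leP x 0; have [y0|/ltW y0] := leP y 0.
  + rewrite !S10//; lra.
  + rewrite (S10 x)//; have [y1|/ltW y1] := leP 1 y.
      rewrite S11//; lra.
    rewrite S1m ?y0//; apply/andP; split; nra.
  + have -> : x = y by apply/eqP; rewrite eq_le xy (le_trans y0).
    rewrite !subrr; lra.
  + have [x1|/ltW x1] := leP 1 x; have [y1|/ltW y1] := leP 1 y.
    * rewrite !S11//; lra.
    * have -> : x = y by apply/eqP; rewrite eq_le xy (le_trans y1).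
      rewrite !subrr; lra.
    * rewrite (S11 y)// S1m ?x0//; apply/andP; split; nra.
    * rewrite !S1m ?x0 ?y0//; apply/andP; split; nra.
- move=> x t; set y := x + t; have -> : t = y - x by rewrite /y; ring.
  move: y => y {t}; rewrite ler_norml.
  have sm := smooth_step_mid; have s0 := smooth_step0; have s1 := smooth_step1.
  have [x0|/ltW x0] := leP x 0; [|have [x1|/ltW x1] := leP 1 x].
  + rewrite (S10 _ x0) (s0 _ x0); have [y0|/ltW y0] := leP y 0; [|have [y1|/ltW y1] := leP 1 y].
    * rewrite (s0 _ y0); have := sqr_ge0 (y - x); lra.
    * rewrite (s1 _ y1); apply/andP; split; nra.
    * rewrite (sm y) ?y0//.
      have : y ^+ 2 <= (y - x) ^+ 2 by rewrite ler_sqr ?nnegrE; lra.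
      have : 0 <= y ^+ 2 * (3 - 2 * y) by rewrite mulr_ge0 ?sqr_ge0//; lra.
      have : 0 <= y ^+ 2 * y by rewrite mulr_ge0 ?sqr_ge0.
      rewrite !exprS; lra.
  + rewrite (S11 _ x1) (s1 _ x1); have [y0|/ltW y0] := leP y 0; [|have [y1|/ltW y1] := leP 1 y].
    * rewrite (s0 _ y0); apply/andP; split; nra.
    * rewrite (s1 _ y1); have := sqr_ge0 (y - x); lra.
    * rewrite (sm y) ?y0//.
      have : (1 - y) ^+ 2 <= (x - y) ^+ 2 by rewrite ler_sqr ?nnegrE; lra.
      have : 0 <= (1 - y) ^+ 2 * (1 + 2 * y) by rewrite mulr_ge0 ?sqr_ge0//; lra.
      have : 0 <= (1 - y) ^+ 2 * (1 - y) by rewrite mulr_ge0 ?sqr_ge0//; lra.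
      rewrite !exprS; lra.
  + rewrite S1m ?x0// (sm x) ?x0//.
    have [y0|/ltW y0] := leP y 0; [|have [y1|/ltW y1] := leP 1 y].
    * rewrite (s0 _ y0).
      have : x ^+ 2 <= (x - y) ^+ 2 by rewrite ler_sqr ?nnegrE; lra.
      have : 0 <= x * ((x - y) - x) by rewrite mulr_ge0; lra.
      have : 0 <= x * x * (1 - x) by rewrite !mulr_ge0; lra.
      have : 0 <= x * (1 - x) * (- y) by rewrite !mulr_ge0; lra.
      have : 0 <= x * x * (- y) by rewrite !mulr_ge0; lra.
      have : 0 <= x * x * x by rewrite !mulr_ge0; lra.
      have : 0 <= y ^+ 2 by exact: sqr_ge0.
      rewrite !exprS; move=> *; apply/andP; split; lra.
    * rewrite (s1 _ y1).
      have : (1 - x) ^+ 2 <= (y - x) ^+ 2 by rewrite ler_sqr ?nnegrE; lra.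
      (* Reflection at 1/2 exchanges the two flat ends and brings this case back to the shape of the
         preceding one. *)
      pose z := 1 - x; have zE : x = 1 - z by rewrite /z; ring.
      have z0 : 0 <= z by rewrite /z; lra.
      have z1 : z <= 1 by rewrite /z; lra.
      move: z zE z0 z1 => z ->  z0 z1.
      have : 0 <= z * ((y - (1 - z)) - z) by rewrite mulr_ge0; lra.
      have : 0 <= z * z * (1 - z) by rewrite !mulr_ge0; lra.
      have : 0 <= z * (1 - z) * (y - 1) by rewrite !mulr_ge0; lra.
      have : 0 <= z * z * (y - 1) by rewrite !mulr_ge0; lra.
      have : 0 <= z * z * z by rewrite !mulr_ge0; lra.
      have : 0 <= (y - 1) ^+ 2 by exact: sqr_ge0.
      rewrite !exprS; move=> *; apply/andP; split; lra.
    * rewrite (sm y) ?y0//.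
      have -> : 3 * y ^+ 2 - 2 * y ^+ 3 - (3 * x ^+ 2 - 2 * x ^+ 3) -
        (y - x) * (6 * x * (1 - x)) = (y - x) ^+ 2 * (3 - 4 * x - 2 * y) by ring.
      have h := sqr_ge0 (y - x).
      have : 0 <= (y - x) ^+ 2 * (6 - (3 - 4 * x - 2 * y)) by rewrite mulr_ge0//; lra.
      have : 0 <= (y - x) ^+ 2 * (6 + (3 - 4 * x - 2 * y)) by rewrite mulr_ge0//; lra.
      lra.
Qed.

(* A linear interpolation on a fine grid, with smooth steps instead of affine
   ones. *)
Lemma grid_approximation f (a0 d e : R) N : 0 < d ->
  (forall x j, (j < N)%N -> a0 + j%:R * d <= x <= a0 + j.+1%:R * d ->
    `|f x - f (a0 + j%:R * d)| <= e) ->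
  (forall x, x <= a0 -> `|f x - f a0| <= e + e) ->
  (forall x, a0 + N%:R * d <= x -> `|f x - f (a0 + N%:R * d)| <= e + e) ->
  exists2 g, test_fun g & forall x, `|f x - g x| <= e + e.
Proof.
move=> d0 osc lo hi.
pose a j := a0 + j%:R * d; have aS j : a j.+1 = a j + d by rewrite /a -natr1; ring.
pose T j x := (f (a j.+1) - f (a j)) * smooth_step (d^-1 * (x - a j)).
pose g n x := f a0 + \sum_(j < n) T j x.
have gS n x : g n.+1 x = g n x + T n x by rewrite /g big_ord_recr /= addrA.
exists (g N).
  apply: test_funD; first exact: test_fun_cst.
  apply: test_fun_sum => j; apply: test_funZ; apply: test_fun_affine.
  exact: test_fun_smooth_step.
have T0 j x : x <= a j -> T j x = 0.
  move=> xa; rewrite /T smooth_step0 ?mulr0//.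
  by rewrite mulr_ge0_le0 ?invr_ge0 ?(ltW d0)// subr_le0.
have T1 j x : a j.+1 <= x -> T j x = f (a j.+1) - f (a j).
  move=> xa; rewrite /T smooth_step1 ?mulr1// mulrC ler_pdivlMr// mul1r.
  by rewrite lerBrDl -aS.
(* To the right of the node [a n] the first [n] steps are complete and telescope to [f (a n)].
   Inside a cell one [e] pays for the oscillation of [f], the other for the unfinished step. *)
have key n : (n <= N)%N -> (forall x, a n <= x -> g n x = f (a n)) /\
    (forall x, x <= a n -> `|f x - g n x| <= e + e).
  elim: n => [|n ih] nN.
    split=> x; rewrite /g big_ord0 addr0 /a mul0r addr0//; exact: lo.
  have [ih1 ih2] := ih (ltnW nN).
  split=> x; rewrite gS => xa.
    rewrite ih1 ?T1//; first by rewrite addrC subrK.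
    by apply: le_trans xa; rewrite aS lerDl ltW.
  have [xn|/ltW xn] := leP x (a n); first by rewrite T0// addr0 ih2.
  rewrite ih1//.
  have /andP[s0 s1] := smooth_step_itv (d^-1 * (x - a n)).
  have o1 := osc x n nN; have o2 := osc (a n.+1) n nN.
  have {}o1 : `|f x - f (a n)| <= e by apply: o1; apply/andP; split.
  have {}o2 : `|f (a n.+1) - f (a n)| <= e.
    by apply: o2; rewrite lexx andbT -/(a n) -/(a n.+1) aS lerDl ltW.
  rewrite opprD addrA; apply: le_trans (ler_normB _ _) _.
  apply: lerD => //; rewrite /T normrM (ger0_norm s0).
  by apply: le_trans o2; rewrite ler_piMr.
move=> x; have [k1 k2] := key N (leqnn N).
have [xa|/ltW xa] := leP x (a N); first exact: k2.
by rewrite k1//; exact: hi.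
Qed.

End test_functions.

Section approximation.
Context (R : realType).

Lemma heine_segment (F : R -> R) (A B e : R) : continuous F -> 0 < e ->
  exists2 d, 0 < d & forall x y, A <= x <= B -> `|y - x| <= d -> `|F y - F x| <= e.
Proof.
move=> cF e0.
have cpt : compact `[A, B] by exact: segment_compact.
have := (compact_near_coveringP _).1 cpt R (at_right 0)
  (fun d x => forall y, `|y - x| <= d -> `|F y - F x| <= e) _.
case.
  move=> x _.
  have e2 : 0 < e / 2 by rewrite divr_gt0.
  have /cvgrPdist_le /(_ _ e2) [r /= r0 rF] := cF x.
  exists ([set z | `|z - x| < r / 2], [set d | d < r / 2]); first split => /=.
  - exists (r / 2); first by rewrite /= divr_gt0.
    by move=> z /=; rewrite distrC.
  - by apply: nbhs_right_lt; rewrite divr_gt0.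
  - move=> [z d] /= [zx dr] y yz.
    have xz : `|x - z| < r / 2 by rewrite distrC.
    have zy : `|z - y| <= d by rewrite distrC.
    have h1 : `|F x - F y| <= e / 2.
      by apply: rF => /=; have xy := ler_distD z x y; lra.
    have h2 : `|F x - F z| <= e / 2.
      by apply: rF => /=; lra.
    have := ler_distD (F x) (F y) (F z); rewrite [`|F y - F x|]distrC; lra.
move=> d /= d0 H; exists (d / 2); first by rewrite divr_gt0.
move=> x y xAB; apply: (H (d / 2)) => //=.
- rewrite sub0r normrN gtr0_norm ?divr_gt0//; lra.
- by rewrite divr_gt0.
Qed.

(** Near both ends [F] is almost constant, so the approximation takes place on a segment, where
    uniform continuity supplies the mesh of the grid. The hypotheses are what continuity on the
    extended line gives after restriction to the reals. *)
Lemma test_fun_approximation (F : R -> R) : continuous F ->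
  (forall e, 0 < e -> exists a l, forall x, x <= a -> `|F x - l| <= e) ->
  (forall e, 0 < e -> exists a l, forall x, a <= x -> `|F x - l| <= e) ->
  forall e, 0 < e -> exists2 g, test_fun g & forall x, `|F x - g x| <= e.
Proof.
move=> cF loF hiF e e0; have e2 : 0 < e / 2 by rewrite divr_gt0.
have [a [la aF]] := loF _ e2; have [b [lb bF]] := hiF _ e2.
have [d d0 dF] := @heine_segment F a (Num.max a b + 1) _ cF e2.
pose d' := Num.min d 1.
have d'0 : 0 < d' by rewrite /d' lt_min d0 ltr01.
pose N := (Num.truncn ((Num.max a b - a) / d')).+1.
have [|||g tg gF] := @grid_approximation R F a d' (e / 2) N d'0.
- move=> x j jN /andP[x1 x2]; apply: dF.
    have jd : 0 <= j%:R * d' by rewrite mulr_ge0// ltW.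
    apply/andP; split; first lra.
    have : j%:R <= (Num.max a b - a) / d'.
      have h : 0 <= (Num.max a b - a) / d'.
        by rewrite divr_ge0 ?(ltW d'0)// subr_ge0 le_max lexx.
      apply: (@le_trans _ _ (Num.truncn ((Num.max a b - a) / d'))%:R).
        by rewrite ler_nat -ltnS.
      by rewrite truncn_le.
    rewrite ler_pdivlMr// => h.
    have : d' <= 1 by rewrite ge_min lexx orbT.
    lra.
  rewrite ger0_norm; last lra.
  have : d' <= d by rewrite ge_min lexx.
  by move: x2; rewrite -natr1; lra.
- move=> x xa; have := aF _ xa; have := aF _ (lexx a).
  have := ler_distD la (F x) (F a); rewrite [`|la - _|]distrC; lra.
- have bN : b <= a + N%:R * d'.
    have : (Num.max a b - a) / d' < N%:R by exact: truncnS_gt.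
    rewrite ltr_pdivrMr// => h.
    have : b <= Num.max a b by rewrite le_max lexx orbT.
    lra.
  move=> x xN; have := bF _ bN; have := bF _ (le_trans bN xN).
  have := ler_distD lb (F x) (F (a + N%:R * d')).
  rewrite [`|lb - _|]distrC; lra.
by exists g => // x; have := gF x; rewrite -splitr.
Qed.

Local Notation TR := (measurableTypeR R).

Lemma Rintegral_cvg_test (nu : nat -> probability TR R) (zeta : probability TR R)
    (F : TR -> R) :
  (forall g : R -> R, test_fun g ->
    \int[nu n]_x g x @[n --> \oo] --> \int[zeta]_x g x) ->
  bmeas F ->
  (forall e, 0 < e -> exists2 g, test_fun g & forall x, `|F x - g x| <= e) ->
  \int[nu n]_x F x @[n --> \oo] --> \int[zeta]_x F x.
Proof.
move=> H bF FA; apply/cvgrPdist_le => e e0.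
have e3 : 0 < e / 3 by rewrite divr_gt0.
have [g tg gF] := FA _ e3.
have bg : bmeas (g : TR -> R) by case: tg => C [f1 /test_pair_bmeas].
have /cvgrPdist_le /(_ _ e3) := H _ tg.
apply: filterS => n nE.
have h1 := Rintegral_normB_le (nu n) bF bg gF.
have h2 := Rintegral_normB_le zeta bF bg gF.
have := ler_distD (\int[zeta]_x g x) (\int[zeta]_x F x) (\int[nu n]_x F x).
have := ler_distD (\int[nu n]_x g x) (\int[zeta]_x g x) (\int[nu n]_x F x).
rewrite [`|\int[nu n]_x g x - \int[nu n]_x F x|]distrC; lra.
Qed.

Lemma test_fun_continuous (f : R -> R) : test_fun f -> continuous f.
Proof.
move=> [C [f1 fP]] x; have C0 := test_pair_ge0 fP.
apply/cvgrPdist_le => e e0.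
have d0 : 0 < e / (2 * C + 1) by rewrite divr_gt0//; lra.
exists (e / (2 * C + 1)) => //= y /ltW.
rewrite ler_pdivlMr; last lra.
move=> h; apply: le_trans (test_pair_lipschitz fP x y) _.
have := normr_ge0 (x - y); lra.
Qed.

Lemma measurable_fun_ereal (f : \bar R -> R) :
  measurable_fun (setT : set TR) (fun x : TR => f x%:E) -> measurable_fun setT f.
Proof.
move=> mf; rewrite (_ : f = fun x => if x == +oo%E then f +oo%E else
    if x == -oo%E then f -oo%E else f (fine x)%:E); last first.
  by apply/funext => -[x| |].
apply: measurable_fun_ifT => //; first exact: measurable_fun_eqe.
apply: measurable_fun_ifT => //; first exact: measurable_fun_eqe.
exact: (measurableT_comp mf).
Qed.

Lemma continuous_ereal_EFin (f : \bar R -> R) : continuous f ->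
  continuous (fun x : R => f x%:E).
Proof.
move=> cf x; apply: (@continuous_comp _ _ _ EFin f); last exact: cf.
by move=> P /nbhs_EFin.
Qed.

Lemma continuous_ereal_bmeas (f : \bar R -> R) : continuous f ->
  (exists C, forall x, `|f x| <= C) -> bmeas f.
Proof.
move=> cf fC; split=> //; apply: measurable_fun_ereal.
by apply: continuous_measurable_fun; exact: continuous_ereal_EFin.
Qed.

Lemma continuous_ereal_pinfty (f : \bar R -> R) : continuous f ->
  forall e, 0 < e -> exists a, forall x : R, a <= x -> `|f x%:E - f +oo%E| <= e.
Proof.
move=> cf e e0; have /cvgrPdist_le /(_ _ e0) := cf +oo%E.
move=> [a [ar aP]]; exists (a + 1) => x ax; rewrite distrC; apply: aP.
by rewrite /= lte_fin; lra.
Qed.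

Lemma continuous_ereal_ninfty (f : \bar R -> R) : continuous f ->
  forall e, 0 < e -> exists a, forall x : R, x <= a -> `|f x%:E - f -oo%E| <= e.
Proof.
move=> cf e e0; have /cvgrPdist_le /(_ _ e0) := cf -oo%E.
move=> [a [ar aP]]; exists (a - 1) => x ax; rewrite distrC; apply: aP.
by rewrite /= lte_fin; lra.
Qed.

End approximation.

Section weak_convergence_criteria.
Context (R : realType).
Local Notation TR := (measurableTypeR R).

Lemma measurable_fun_EFin : measurable_fun (setT : set TR) (@EFin R).
Proof. by apply/measurable_EFinP; exact: measurable_id. Qed.

Definition extended_real : TR -> \bar R := EFin.

HB.instance Definition _ := @isMeasurableFun.Build _ _ TR (\bar R) extended_real
  measurable_fun_EFin.

Variables (nu : nat -> probability (\bar R) R) (nuR : nat -> probability TR R).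
Variable (zeta : probability TR R).
Hypothesis nuR_cvg : forall g : R -> R, test_fun g ->
  \int[nuR n]_x g x @[n --> \oo] --> \int[zeta]_x g x.

(** A continuous function on the compact extended line is, on the reals, a uniform limit of test
    functions; convergence against these therefore suffices and no separate tightness argument is
    made. *)
Lemma weak_cvg_real :
  (\forall n \near \oo, forall f : \bar R -> R, bmeas f ->
    \int[nu n]_x f x = \int[nuR n]_x f x%:E) ->
  weak_cvg nu (distribution zeta extended_real).
Proof.
move=> nuE f cf fC; have bf := continuous_ereal_bmeas cf fC.
rewrite Rintegral_distribution//.
have bF : bmeas (fun x : TR => f x%:E) by apply: (@bmeas_comp _ _ _ _ _ f).
apply: cvg_trans (Rintegral_cvg_test nuR_cvg bF _).
  by apply: near_eq_cvg; apply: filterS nuE => n ->.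
apply: test_fun_approximation.
- exact: continuous_ereal_EFin.
- move=> e e0; have [a aP] := continuous_ereal_ninfty cf e0.
  by exists a, (f -oo%E).
- move=> e e0; have [a aP] := continuous_ereal_pinfty cf e0.
  by exists a, (f +oo%E).
Qed.

(* Outside a neighbourhood of +oo the density e^x of Q with respect to P is
   bounded, so the limit of the laws under Q is determined there by the limit
   under P; the mass that is missing sits at +oo. *)
Lemma weak_cvg_tilt (xi2 : probability (\bar R) R) :
  (forall (f : \bar R -> R) a, bmeas f -> (forall x, (a%:E <= x)%E -> f x = 0) ->
    \forall n \near \oo,
    \int[nu n]_x f x = \int[nuR n]_x (f x%:E * expR x)) ->
  (forall (f : \bar R -> R) a, bmeas f -> (forall x, (a%:E <= x)%E -> f x = 0) ->
    \int[xi2]_x f x = \int[zeta]_x (f x%:E * expR x)) ->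
  weak_cvg nu xi2.
Proof.
move=> nuE xiE f cf fC; have bf := continuous_ereal_bmeas cf fC.
apply/cvgrPdist_le => e e0; have e3 : 0 < e / 3 by rewrite divr_gt0.
have [a aP] := continuous_ereal_pinfty cf e3; set l := f +oo%E in aP.
(* A cut-off equal to 1 left of [a] and to 0 right of [a + 1]. Where it differs from 1, [f] is
   already close to its limit [l], so [f] stays within [e / 3] of [l + (f - l) * chi]. *)
pose chi (x : \bar R) : R :=
  if x == +oo%E then 0 else if x == -oo%E then 1 else 1 - smooth_step (fine x - a).
have chiE (x : R) : chi x%:E = 1 - smooth_step (x - a) by [].
have bstep : bmeas (fun x : TR => smooth_step (x - a)).
  have [C [f1 tP]] := test_fun_affine 1 a (test_fun_smooth_step R).
  by have := test_pair_bmeas tP; under eq_fun do rewrite mul1r.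
have bchi : bmeas chi.
  split.
    apply: measurable_fun_ereal; under eq_fun do rewrite chiE.
    by apply: measurable_funB => //; case: bstep.
  exists 1 => -[x| |]; rewrite ?chiE /chi/= ?normr0 ?normr1//.
  by have := smooth_step_itv (x - a); rewrite ler_norml; lra.
have bfl : bmeas (fun x => f x - l) by apply: bmeasB => //; exact: bmeas_cst.
pose fa x := (f x - l) * chi x.
have bfa : bmeas fa by exact: bmeasM.
have fa0 x : ((a + 1)%:E <= x)%E -> fa x = 0.
  case: x => [x| |]//= xa; rewrite /fa ?mulr0//.
  rewrite chiE smooth_step1 ?subrr ?mulr0//.
  by move: xa; rewrite lee_fin; lra.
have near_l x : `|f x - (l + fa x)| <= e / 3.
  have -> : f x - (l + fa x) = (f x - l) * (1 - chi x) by rewrite /fa; ring.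
  case: x => [x| |].
  - have -> : 1 - chi x%:E = smooth_step (x - a) by rewrite chiE; ring.
    rewrite normrM.
    have /andP[s0 s1] := smooth_step_itv (x - a); rewrite [X in _ * X]ger0_norm//.
    have [xa|/ltW xa] := leP x a.
      by rewrite smooth_step0 ?mulr0 ?(ltW e3)// subr_le0.
    by apply: le_trans (aP x xa); rewrite ler_piMr.
  - by rewrite /l subrr mul0r normr0 ltW.
  - by rewrite /chi/= subrr mulr0 normr0 ltW.
have bl : bmeas (fun _ : \bar R => l) by exact: bmeas_cst.
have approx (m : probability (\bar R) R) :
    `|\int[m]_x f x - (l + \int[m]_x fa x)| <= e / 3.
  have := Rintegral_normB_le m bf (bmeasD bl bfa) near_l.
  rewrite (RintegralD measurableT (bmeas_integrable m bl) (bmeas_integrable m bfa)).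
  by rewrite Rintegral_cst1.
(* The tilted function tends to 0 at -oo because of the exponential and vanishes for large [x]
   because of the cut-off, so the approximation by test functions applies to it. *)
pose F (x : TR) := fa x%:E * expR x.
have cF : continuous (F : R -> R).
  move=> x; apply: cvgM; last exact: continuous_expR.
  apply: cvgM; first by apply: cvgB; [exact: continuous_ereal_EFin|exact: cvg_cst].
  apply: cvgB; first exact: cvg_cst.
  have := test_fun_continuous (test_fun_affine 1 a (test_fun_smooth_step R)).
  by under eq_fun do rewrite mul1r; apply.
have [_ [K faK]] := bfa.
have K0 : 0 <= K by apply: le_trans (faK 0%E).
have FK (x : R) : `|F x| <= K * expR x.
  by rewrite /F normrM (ger0_norm (expR_ge0 x)) ler_wpM2r// expR_ge0.
have F0 (x : R) : a + 1 <= x -> F x = 0.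
  by move=> xa; rewrite /F fa0 ?mul0r// lee_fin.
have bF : bmeas F.
  split; first exact: continuous_measurable_fun.
  exists (K * expR (a + 1)) => x; have [xa|/ltW xa] := leP (a + 1) x.
    by rewrite F0// normr0 mulr_ge0// expR_ge0.
  by apply: le_trans (FK x) _; rewrite ler_wpM2l// ler_expR.
have key : \int[nuR n]_x F x @[n --> \oo] --> \int[zeta]_x F x.
  apply: Rintegral_cvg_test => //; apply: test_fun_approximation => //.
  - move=> d d0; exists (ln (d / (K + 1))), 0 => x xd; rewrite subr0.
    have K1 : 0 < K + 1 by lra.
    have dK : 0 < d / (K + 1) by rewrite divr_gt0.
    have : expR x <= d / (K + 1) by rewrite -[leRHS]lnK ?posrE// ler_expR.
    rewrite ler_pdivlMr// => h; apply: le_trans (FK x) _.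
    have := expR_ge0 x; lra.
  - move=> d d0; exists (a + 1), 0 => x xa.
    by rewrite F0// subrr normr0 ltW.
move/cvgrPdist_le : key => /(_ _ e3); apply: filterS2 (nuE _ _ bfa fa0) => n E1.
rewrite -E1 -(xiE _ _ bfa fa0) => H.
have h1 := approx (nu n); have h2 := approx xi2.
have := ler_distD (l + \int[xi2]_x fa x) (\int[xi2]_x f x) (\int[nu n]_x f x).
have := ler_distD (l + \int[nu n]_x fa x) (l + \int[xi2]_x fa x) (\int[nu n]_x f x).
have -> : l + \int[xi2]_x fa x - (l + \int[nu n]_x fa x) =
  \int[xi2]_x fa x - \int[nu n]_x fa x by ring.
rewrite [`|l + \int[nu n]_x fa x - \int[nu n]_x f x|]distrC; lra.
Qed.

End weak_convergence_criteria.

(** * One row of the array *)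

Section uniform.
Context (R : realType).
Local Notation TR := (measurableTypeR R).
Local Notation lambda := (@lebesgue_measure R).
Local Notation U := (unif01 R).

Lemma integral_unif01 (f : TR -> \bar R) : measurable_fun setT f ->
  (\int[U]_u f u = \int[lambda]_(u in `]0%R, 1%R[) f u)%E.
Proof.
move=> mf; have ge0 (g : TR -> \bar R) : measurable_fun setT g ->
    (forall x, 0 <= g x)%E -> (\int[U]_u g u = \int[lambda]_(u in `]0%R, 1%R[) g u)%E.
  move=> mg g0; rewrite /unif01 integral_uniform// subr0 invr1 mul1e.
  rewrite -integral_itv_bndo_bndc; last exact: measurable_funTS.
  by rewrite -integral_itv_obnd_cbnd//; exact: measurable_funTS.
rewrite integralE [RHS]integralE; congr (_ - _)%E; apply: ge0 => //.
- exact: measurable_funepos.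
- exact: measurable_funeneg.
Qed.

Lemma integrable_unif01 (f : TR -> \bar R) : measurable_fun setT f ->
  lambda.-integrable `]0%R, 1%R[ f <-> U.-integrable setT f.
Proof.
move=> mf; have E := integral_unif01 (measurableT_comp (@abse_measurable R setT) mf).
split=> /integrableP[_ fi]; apply/integrableP; split => //.
- by move: fi; rewrite -E.
- exact: measurable_funTS.
- by move: fi; rewrite E.
Qed.

(** The image of Lebesgue measure under division by [k], divided by [k], gives half-open intervals
    their length, and Lebesgue measure is unique with this property. *)
Lemma lebesgue_measure_scale (k : R) (A : set TR) : 0 < k -> measurable A ->
  lambda [set u | A (u / k)] = (k%:E * lambda A)%E.
Proof.
move=> k0 mA; have k0' : 0 <= k^-1 by rewrite invr_ge0 ltW.
pose phi (u : TR) : TR := u / k.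
have mphi : measurable_fun setT phi by exact: measurable_funM.
pose pf : {measure set TR -> \bar R} :=
  measure_function_pushforward__canonical__measure_function_Measure lambda mphi.
pose mu : {measure set TR -> \bar R} := mscale (NngNum k0') pf.
have -> : lambda A = mu A.
  apply: lebesgue_measure_unique => // X [[a b] _ <-] /=.
  rewrite /mu /mscale/= /pushforward.
  have -> : phi @^-1` `]a, b]%classic = `](a * k), (b * k)]%classic.
    apply/seteqP; split => u /=; rewrite !in_itv/= /phi;
    by rewrite ltr_pdivlMr// ler_pdivrMr.
  rewrite !lebesgue_measure_itv/= !lte_fin ltr_pM2r//; case: ifPn => _; last by rewrite mule0.
  rewrite -!EFinD -EFinM -mulrBl; congr EFin; field; rewrite gt_eqF//.
rewrite -[mu A]/((k^-1)%:E * lambda [set u | A (u / k)%R])%E muleA -EFinM divff ?mul1e// gt_eqF//.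
Qed.

Lemma integral_scale (k : R) (f : TR -> \bar R) : 0 < k -> measurable_fun setT f ->
  (forall x, 0 <= f x)%E ->
  (\int[lambda]_u f (u / k)%R = k%:E * \int[lambda]_u f u)%E.
Proof.
move=> k0 mf f0.
pose phi (u : TR) : TR := u / k.
have mphi : measurable_fun setT phi by exact: measurable_funM.
have k0' := ltW k0.
rewrite -(ge0_integral_mscale _ _ (NngNum k0'))//.
transitivity (\int[lambda]_(u in phi @^-1` setT) (f \o phi) u)%E.
  by rewrite preimage_setT.
rewrite -(ge0_integral_pushforward mphi)//.
apply: eq_measure_integral => A mA _.
by rewrite /pushforward/= /mscale/= -lebesgue_measure_scale.
Qed.

(* h is supported in (0, 1), so that u |-> h (u / kappa) lives on
   (0, kappa), inside (0, 1) *)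
Lemma ge0_integral_unif01_scale (k : R) (f : TR -> \bar R) : 0 < k <= 1 ->
  measurable_fun setT f -> (forall x, 0 <= f x)%E ->
  (forall u, u \notin `]0, 1[ -> f u = 0%E) ->
  (\int[U]_u f (u / k)%R = k%:E * \int[U]_u f u)%E.
Proof.
move=> /andP[k0 k1] mf f0 fout.
have mfk : measurable_fun setT (fun u : TR => f (u / k)).
  by apply: (measurableT_comp mf); exact: measurable_funM.
have ext (g : TR -> \bar R) : (forall u, u \notin `]0, 1[ -> g u = 0%E) ->
    (\int[lambda]_(u in `]0%R, 1%R[) g u = \int[lambda]_u g u)%E.
  move=> gout; rewrite integral_mkcond; apply: eq_integral => u _.
  rewrite patchE; case: ifPn => //; rewrite notin_setE/= => H.
  by rewrite gout//; apply/negP.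
rewrite !integral_unif01// !ext// ?integral_scale// => u u01.
apply: fout; apply: contra u01; rewrite !in_itv/= => /andP[u0 u1].
have u0' : 0 < u by rewrite -(pmulr_lgt0 _ (_ : 0 < k^-1)) ?invr_gt0// mulrC.
rewrite u0'/=; move: u1; rewrite ltr_pdivrMr// mul1r => /lt_le_trans; exact.
Qed.

Lemma Rintegral_unif01_scale (k : R) (f : TR -> R) : 0 < k <= 1 ->
  U.-integrable setT (EFin \o f) ->
  (forall u, u \notin `]0, 1[ -> f u = 0) ->
  U.-integrable setT (fun u => (f (u / k))%:E) /\
  \int[U]_u f (u / k) = k * \int[U]_u f u.
Proof.
move=> k01 fi fout; have mf := measurable_int _ fi.
have k0 : 0 <= k by case/andP: k01 => /ltW.
have mfk : measurable_fun setT (fun u : TR => (f (u / k))%:E).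
  by apply: (measurableT_comp mf); exact: measurable_funM.
have intk : U.-integrable setT (fun u => (f (u / k))%:E).
  apply/integrableP; split => //.
  rewrite (@ge0_integral_unif01_scale k (fun u => `|(f u)%:E|%E))//.
  - case/integrableP: fi => _ fi; apply: lte_mul_pinfty => //.
  - exact: (measurableT_comp (@abse_measurable R setT) mf).
  - by move=> u u01; rewrite fout// abse0.
split => //; rewrite -[RHS]/(fine (k * _)%:E) EFinM fineK; last exact: integrable_fin_num.
congr fine.
rewrite [LHS]integralE [in RHS]integralE.
rewrite muleBr; last 2 first.
- by [].
- by apply: integrable_add_def.
have out0 : forall u, u \notin `]0, 1[ -> (EFin \o f) u = 0%E by move=> u /fout /= ->.
congr (_ - _)%E.
- rewrite -(@ge0_integral_unif01_scale k (EFin \o f)^\+%E k01)//.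
  + by apply: eq_integral => u _; rewrite !funeposE.
  + exact: measurable_funepos.
  + by move=> u /out0; rewrite funeposE => ->; rewrite maxxx.
- rewrite -(@ge0_integral_unif01_scale k (EFin \o f)^\-%E k01)//.
  + by apply: eq_integral => u _; rewrite !funenegE.
  + exact: measurable_funeneg.
  + by move=> u /out0; rewrite funenegE => ->; rewrite oppe0 maxxx.
Qed.

End uniform.

(* q = 1 + A + B is the density of Q, where A >= 0 is the rescaled signal and
   B collects the perturbation and the constant - 1/m. *)
Section row.
Context (R : realType).
Local Notation TR := (measurableTypeR R).
Local Notation U := (unif01 R).

Definition signal_part (m : nat) (kappa : R) (h : R -> R) (u : R) : R :=
  h (u / kappa) / (m%:R * kappa).

Definition zero_ext (rho : R -> R) : R -> R := rho \_ `]0, 1[.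

Definition ind01 : R -> R := \1_`]0, 1[%classic.

(** The constant [- 1 / m] is confined to the unit interval along with [rho]; the density then
    equals 1 outside, and positivity can be asked at every real point rather than almost
    everywhere. *)
Definition small_part (m : nat) (rho : R -> R) (u : R) : R :=
  m%:R^-1 * (zero_ext rho u - ind01 u).

Variables (m : nat) (kappa : R) (h rho : R -> R).
Hypotheses (m_gt0 : (0 < m)%N) (kappa01 : 0 < kappa <= 1).
Hypothesis h_density : density01 h.
Hypothesis rho_int :
  (@lebesgue_measure R).-integrable `]0, 1[ (EFin \o rho).
Hypothesis rho_int0 :
  (\int[@lebesgue_measure R]_(u in `]0%R, 1%R[) (rho u)%:E = 0)%E.

Local Notation A := (signal_part m kappa h).
Local Notation B := (small_part m rho).

Let m0 : 0 < m%:R :> R. Proof. by rewrite ltr0n. Qed.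
Let kappa0 : 0 < kappa. Proof. by case/andP: kappa01. Qed.
Let mh : measurable_fun setT (h : TR -> R). Proof. by case: h_density. Qed.
Let h0 u : 0 <= h u. Proof. by case: h_density. Qed.
Let hout u : u \notin `]0, 1[ -> h u = 0. Proof. by case: h_density => _ _ + _; exact. Qed.

Lemma density01_integrable : U.-integrable setT (EFin \o h).
Proof.
apply/integrableP; split; first exact/measurable_EFinP.
under eq_integral do rewrite gee0_abs ?lee_fin//.
rewrite integral_unif01; last exact/measurable_EFinP.
by case: h_density => _ _ _ ->; rewrite ltry.
Qed.

Lemma density01_Rintegral : \int[U]_u h u = 1.
Proof.
rewrite /Rintegral integral_unif01; last exact/measurable_EFinP.
by case: h_density => _ _ _ ->.
Qed.

Lemma signal_part_ge0 u : 0 <= A u.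
Proof. by rewrite divr_ge0// mulr_ge0// ltW. Qed.

Lemma signal_part_integrable : U.-integrable setT (EFin \o A).
Proof.
have [ih _] := Rintegral_unif01_scale kappa01 density01_integrable hout.
rewrite (_ : A = fun u => (m%:R * kappa)^-1 * h (u / kappa)).
  exact: (integrable_EFinZ _ ih).
by apply/funext => u /=; rewrite /signal_part mulrC.
Qed.

Lemma signal_part_Rintegral : \int[U]_u A u = m%:R^-1.
Proof.
have [ih E] := Rintegral_unif01_scale kappa01 density01_integrable hout.
rewrite (RintegralZr _ measurableT ih) E density01_Rintegral.
by field; rewrite !gt_eqF.
Qed.

Let mrho : measurable_fun setT (zero_ext rho : TR -> R).
Proof.
have := measurable_int _ rho_int; rewrite (measurable_restrictT _ _)//.
by rewrite restrict_EFin => /measurable_EFinP.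
Qed.

Let m1 : measurable_fun setT (ind01 : TR -> R).
Proof. exact: measurable_indic. Qed.

Lemma measurable_small_part : measurable_fun setT (B : TR -> R).
Proof. by apply: measurable_funM => //; exact: measurable_funB. Qed.

Let irho : U.-integrable setT (EFin \o zero_ext rho).
Proof.
apply/integrable_unif01; first exact/measurable_EFinP.
apply: eq_integrable rho_int => // u; rewrite inE /= => u01.
by rewrite /zero_ext patchE mem_set.
Qed.

Let b1 : bmeas (ind01 : TR -> R).
Proof. by split=> //; exists 1 => x; rewrite /ind01 ger0_norm// indicE lern1 leq_b1. Qed.

Lemma small_part_integrable : U.-integrable setT (EFin \o B).
Proof.
apply: integrable_EFinZ; apply: integrable_EFinB => //.
exact: (bmeas_integrable U b1).
Qed.

Lemma small_part_Rintegral : \int[U]_u B u = - m%:R^-1.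
Proof.
have i2 := bmeas_integrable U b1.
have i3 : U.-integrable setT (EFin \o (fun u => zero_ext rho u -
   ind01 u)).
  exact: integrable_EFinB.
rewrite (RintegralZl _ measurableT i3) (RintegralB measurableT irho i2).
have -> : \int[U]_u zero_ext rho u = 0.
  rewrite /Rintegral integral_unif01; last exact/measurable_EFinP.
  rewrite -[RHS]/(fine 0%E) -rho_int0; congr fine; apply: eq_integral => u u01.
  by rewrite /zero_ext patchE u01.
have -> : \int[U]_u ind01 u = 1.
  rewrite /Rintegral integral_unif01; last exact/measurable_EFinP.
  rewrite /ind01 integral_indic// setIid.
  have E := @lebesgue_measure_itv R `]0%R, 1%R[; rewrite /= lte01 sube0 in E.
  by rewrite -[RHS]/(fine 1%E); congr fine; exact: E.
by rewrite sub0r mulrN mulr1.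
Qed.

Lemma small_part_sqr_le u : B u ^+ 2 <=
  2 * m%:R^-1 ^+ 2 * (zero_ext rho u ^+ 2 + 1).
Proof.
rewrite /small_part exprMn.
have -> : 2 * m%:R^-1 ^+ 2 * (zero_ext rho u ^+ 2 + 1) =
  m%:R^-1 ^+ 2 * (2 * (zero_ext rho u ^+ 2 + 1)) by ring.
rewrite ler_wpM2l ?sqr_ge0//.
move: (zero_ext rho u) => r; rewrite /ind01 indicE; case: (_ \in _) => /=.
  by have := sqr_ge0 (r + 1); rewrite sqrrD sqrrB; lra.
rewrite subr0; have := sqr_ge0 r; lra.
Qed.

Variables (C : R) (f f1 : R -> R).
Hypothesis ff1 : test_pair C f f1.
Hypothesis AB_ge : forall u, - 2^-1 <= A u + B u.
Hypothesis B2_int : U.-integrable setT (fun u => (B u ^+ 2)%:E).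

Local Notation psi := (log_increment f f1).

Let mf : measurable_fun setT f. Proof. by case: ff1. Qed.
Let C0 : 0 <= C. Proof. exact: test_pair_ge0 ff1. Qed.
Let mA : measurable_fun setT (A : TR -> R).
Proof. by have /measurable_EFinP := measurable_int _ signal_part_integrable. Qed.
Let mB := measurable_small_part.

(** [A + B] has integral 0, so the increment may be replaced by [psi x (A + B)]; [B] is then removed
    by [log_increment_perturb], and rescaling [psi x (A)] to the unit interval produces the factor
    [kappa]. The parameter [c] weights the cross term and stays free. *)
Lemma row_bound x c : 0 < c ->
  `|\int[U]_u (f (x + ln (1 + (A u + B u))) - f x) -
    kappa * \int[U]_u psi x (h u / (m%:R * kappa))| <=
  3 * C * (c / 2 * \int[U]_u B u ^+ 2 + (2 * c)^-1 * m%:R^-1) +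
  10 * C * \int[U]_u B u ^+ 2.
Proof.
move=> c0; have iA := signal_part_integrable; have iB := small_part_integrable.
have mpsi := measurable_log_increment f1 x mf.
have mk0 : 0 < m%:R * kappa by rewrite mulr_gt0.
have [iAk psiA] : U.-integrable setT (fun u => (psi x (A u))%:E) /\
    \int[U]_u psi x (A u) = kappa * \int[U]_u psi x (h u / (m%:R * kappa)).
  apply: (@Rintegral_unif01_scale R kappa (fun v => psi x (h v / (m%:R * kappa)))) => //.
    apply: (@integrable_dominated _ TR R U _ (fun v : TR => 3 * C * (m%:R * kappa)^-1 * h v)).
    - apply: (measurableT_comp mpsi); exact: measurable_funM.
    - by apply: integrable_EFinZ; exact: density01_integrable.
    - move=> v; have hv : 0 <= h v / (m%:R * kappa) by rewrite divr_ge0// ltW.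
      by apply: le_trans (log_increment_le ff1 x hv) _; rewrite [h v / _]mulrC mulrA.
  by move=> u /hout ->; rewrite mul0r log_increment0.
have iAB : U.-integrable setT (EFin \o (fun u => A u + B u)).
  exact: integrable_EFinD.
have AB0 : \int[U]_u (A u + B u) = 0.
  rewrite (RintegralD measurableT iA iB) signal_part_Rintegral small_part_Rintegral.
  by rewrite subrr.
have bfq : bmeas (fun u : TR => f (x + ln (1 + (A u + B u))) - f x).
  apply: bmeasB; last exact: bmeas_cst.
  apply: (bmeas_translate x (test_pair_bmeas ff1)).
  apply: (measurableT_comp (@measurable_ln R)).
  by apply: measurable_funD => //; exact: measurable_funD.
have iABf : U.-integrable setT (EFin \o (fun u => (A u + B u) * f1 x)).
  under [X in EFin \o X]eq_fun do rewrite mulrC.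
  exact: integrable_EFinZ.
have psiAB : \int[U]_u (f (x + ln (1 + (A u + B u))) - f x) =
    \int[U]_u psi x (A u + B u).
  rewrite (RintegralB measurableT (bmeas_integrable U bfq) iABf).
  by rewrite (RintegralZr _ measurableT iAB) AB0 mul0r subr0.
have ipsi : U.-integrable setT (EFin \o (fun u => psi x (A u + B u))).
  exact: (integrable_EFinB (bmeas_integrable U bfq) iABf).
rewrite psiAB -psiA -(RintegralB measurableT ipsi iAk).
have iB2 : U.-integrable setT (EFin \o (fun u => (3 * C * (c / 2) + 10 * C) * B u ^+ 2)).
  exact: (integrable_EFinZ _ B2_int).
have iA2 : U.-integrable setT (EFin \o (fun u => (3 * C * (2 * c)^-1) * A u)).
  exact: (integrable_EFinZ _ iA).
have -> : 3 * C * (c / 2 * \int[U]_u B u ^+ 2 + (2 * c)^-1 / m%:R) +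
    10 * C * \int[U]_u B u ^+ 2 =
    \int[U]_u ((3 * C * (c / 2) + 10 * C) * B u ^+ 2 + 3 * C * (2 * c)^-1 * A u).
  rewrite (RintegralD measurableT iB2 iA2) (RintegralZl _ measurableT B2_int).
  by rewrite (RintegralZl _ measurableT iA) signal_part_Rintegral; ring.
apply: le_Rintegral_norm.
- by apply: measurable_funB; apply: (measurableT_comp mpsi) => //; exact: measurable_funD.
- exact: (integrable_EFinD iB2 iA2).
move=> u; have A0 := signal_part_ge0 u.
apply: le_trans (log_increment_perturb ff1 x A0 (AB_ge u)) _.
have min0 : 0 <= Num.min 1 (A u) by rewrite le_min ler01.
(* Here the truncation pays off: its square is integrable although that of [A] may not be, and its
   integral is at most [1 / m]. *)
have min2 : Num.min 1 (A u) ^+ 2 <= A u.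
  by rewrite /Num.min; case: ifPn => h1; nra.
(* AM-GM *)
have key : `|B u| * Num.min 1 (A u) <= c / 2 * B u ^+ 2 + (2 * c)^-1 * A u.
  have : 0 <= (2 * c)^-1 * (c * `|B u| - Num.min 1 (A u)) ^+ 2.
    by rewrite mulr_ge0 ?sqr_ge0// invr_ge0 mulr_ge0// ltW.
  have -> : (2 * c)^-1 * (c * `|B u| - Num.min 1 (A u)) ^+ 2 =
    c / 2 * `|B u| ^+ 2 - `|B u| * Num.min 1 (A u) + (2 * c)^-1 * Num.min 1 (A u) ^+ 2.
    by field; rewrite gt_eqF.
  rewrite real_normK ?num_real//.
  have : (2 * c)^-1 * Num.min 1 (A u) ^+ 2 <= (2 * c)^-1 * A u.
    by rewrite ler_wpM2l// invr_ge0 mulr_ge0// ltW.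
  lra.
have : 3 * C * (`|B u| * Num.min 1 (A u)) <=
  3 * C * (c / 2 * B u ^+ 2 + (2 * c)^-1 * A u) by rewrite ler_wpM2l// mulr_ge0.
lra.
Qed.

End row.

Section compound_poisson_row.
Context (R : realType).
Local Notation TR := (measurableTypeR R).

(** The generator of the Levy process with drift [- b] and jumps of law [nu] at rate [c], with [f1]
    in place of the derivative. *)
Definition generator (b c : R) (nu : probability TR R) (f f1 : R -> R) (x : R) : R :=
  c * (\int[nu]_y f (x + y) - f x) - b * f1 x.

(** The three constants come, in order, from the expansion of the compound Poisson law around
    [y = x - s * b], from the Taylor expansion of [f] between [x] and [y], and from moving the jump
    term from [y] back to [x], which uses the Lipschitz bound twice. *)
Lemma cpoisson_row_bound b c nu C f f1 x s : test_pair C f f1 ->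
  0 <= c -> 0 <= s <= 1 ->
  `|\int[shifted_cpoisson (s * b) (s * c) nu]_z (f (x + z) - f x) -
    s * generator b c nu f f1 x| <=
  C * (3 * c ^+ 2 + b ^+ 2 + 4 * c * `|b|) * s ^+ 2.
Proof.
move=> ff1 c0 /andP[s0 s1]; have C0 := test_pair_ge0 ff1.
have bf := test_pair_bmeas ff1; case: (ff1) => mf fC f1C f1L fT.
have bfx (y : R) : bmeas (fun z : TR => f (y + z)) by exact: (bmeas_translate y bf).
have bcst (r : R) : bmeas (fun _ : TR => r) by exact: bmeas_cst.
have sc0 : 0 <= s * c by rewrite mulr_ge0.
set P := shifted_cpoisson _ _ _.
rewrite (RintegralB measurableT (bmeas_integrable P (bfx x)) (bmeas_integrable P (bcst (f x)))).
rewrite Rintegral_cst1 (Rintegral_shifted_cpoisson _ _ _ (bfx x)).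
set y := x - s * b.
have -> : \int[cpoisson (s * c) nu]_z f (x + (z - s * b)) =
    \int[cpoisson (s * c) nu]_z f (y + z).
  by apply: eq_Rintegral => z _; congr f; rewrite /y; ring.
have e1 := cpoisson_expansion nu sc0 (bfx y).1 (fun z => fC (y + z)).
rewrite addr0 in e1.
have e2 : `|f y - f x + s * b * f1 x| <= C * (s * b) ^+ 2.
  have := fT x (- (s * b)); rewrite -/y sqrrN.
  by have -> : f y - f x - - (s * b) * f1 x = f y - f x + s * b * f1 x by ring.
have lip z : `|f (y + z) - f (x + z)| <= 2 * C * (s * `|b|).
  apply: le_trans (test_pair_lipschitz ff1 _ _) _.
  have -> : y + z - (x + z) = - (s * b) by rewrite /y; ring.
  by rewrite normrN normrM (ger0_norm s0).
have e3 := Rintegral_normB_le nu (bfx y) (bfx x) lip.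
have e4 : `|f y - f x| <= 2 * C * (s * `|b|) by have := lip 0; rewrite !addr0.
rewrite /generator; set J := \int[cpoisson _ _]_z _ in e1 *.
set I1 := \int[nu]_z f (y + z) in e1 e3; set I2 := \int[nu]_z f (x + z) in e3 *.
have -> : J - f x - s * (c * (I2 - f x) - b * f1 x) =
  (J - f y - s * c * (I1 - f y)) + (f y - f x + s * b * f1 x) +
  s * c * ((I1 - I2) - (f y - f x)) by ring.
apply: le_trans (ler_normD _ _) _.
apply: le_trans (lerD (ler_normD _ _) (lexx _)) _.
rewrite [X in _ + X <= _]normrM (ger0_norm sc0).
have e5 : s * c * `|I1 - I2 - (f y - f x)| <= s * c * (4 * C * (s * `|b|)).
  by rewrite ler_wpM2l//; apply: le_trans (ler_normB _ _) _; lra.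
rewrite !exprMn in e1 e2; rewrite -[b ^+ 2]real_normK ?num_real// in e2 *.
lra.
Qed.

End compound_poisson_row.

(** * The density of a contaminated observation *)

Section contaminated_density.
Context (R : realType).
Local Notation TR := (measurableTypeR R).
Local Notation U := (unif01 R).
Local Notation lambda := (@lebesgue_measure R).

Variables (m : nat) (kappa : R) (h rho : R -> R).
Hypotheses (m_gt0 : (0 < m)%N) (kappa01 : 0 < kappa <= 1).
Hypothesis h_density : density01 h.
Hypothesis rho_int : lambda.-integrable `]0, 1[ (EFin \o rho).
Hypothesis signal_ge0 : forall u : R, u \in `]0, 1[ ->
  0 <= signal_density kappa h rho u.

Definition row_density (u : R) : R :=
  1 + (signal_part m kappa h u + small_part m rho u).

Let m0 : 0 < m%:R :> R. Proof. by rewrite ltr0n. Qed.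

Lemma row_density_in u : u \in `]0, 1[ ->
  row_density u = (1 - m%:R^-1) + m%:R^-1 * signal_density kappa h rho u.
Proof.
move=> u01; have u01' : u \in (`]0%R, 1%R[%classic : set R) by rewrite inE.
rewrite /row_density /signal_part /small_part /zero_ext /ind01 patchE u01'.
rewrite indicE u01' /signal_density /=.
by field; rewrite !gt_eqF//; case/andP: kappa01.
Qed.

Lemma row_density_out u : u \notin `]0, 1[ -> row_density u = 1.
Proof.
move=> u01; have u01' : u \notin (`]0%R, 1%R[%classic : set R).
  by rewrite notin_setE; apply/negP.
rewrite /row_density /signal_part /small_part /zero_ext /ind01 patchE (negbTE u01').
rewrite indicE (negbTE u01').
have [k0 k1] := andP kappa01.
have -> : h (u / kappa) = 0.
  case: h_density => _ _ + _; apply; apply: contra u01; rewrite !in_itv/=.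
  move=> /andP[v0 v1].
  have u0' : 0 < u by rewrite -(pmulr_lgt0 _ (_ : 0 < kappa^-1)) ?invr_gt0// mulrC.
  rewrite u0'/=; move: v1; rewrite ltr_pdivrMr// mul1r => /lt_le_trans; exact.
by rewrite /= subrr mulr0 mul0r !addr0.
Qed.

Lemma row_density_ge u : 1 - m%:R^-1 <= row_density u.
Proof.
case: (boolP (u \in `]0, 1[)) => u01.
  by rewrite row_density_in// lerDl mulr_ge0 ?invr_ge0 ?(ltW m0)// signal_ge0.
by rewrite row_density_out// gerBl invr_ge0 ltW.
Qed.

Lemma measurable_row_density : measurable_fun setT (row_density : TR -> R).
Proof.
apply: measurable_funD => //; apply: measurable_funD.
  by have /measurable_EFinP := measurable_int _ (signal_part_integrable m kappa01 h_density).
exact: measurable_small_part.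
Qed.

Variable mu : probability TR R.
Hypothesis mu_density : forall A : set TR, measurable A ->
  mu A = (\int[lambda]_(u in A `&` `]0%R, 1%R[)
    (signal_density kappa h rho u)%:E)%E.

Lemma contaminated_has_density :
  has_density U (mixture (invn_itv01 R m) U mu) row_density.
Proof.
have q1 := measurable_row_density.
have invm1 : m%:R^-1 <= 1 :> R by rewrite invf_le1// ler1n.
have q0 u : 0 <= row_density u.
  by apply: le_trans (row_density_ge u); rewrite subr_ge0.
split => // A mA.
transitivity ((1 - m%:R^-1)%:E * U A + m%:R^-1%:E * mu A)%E; first exact: mixtureE.
rewrite mu_density//.
have mI : measurable (`]0%R, 1%R[%classic : set TR) by [].
have mAI : measurable (A `&` `]0%R, 1%R[%classic : set TR) by exact: measurableI.
have toL (g : TR -> R) : measurable_fun setT g ->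
   (\int[U]_(u in A) (g u)%:E = \int[lambda]_(u in A `&` `]0%R, 1%R[) (g u)%:E)%E.
  move=> mg; rewrite integral_mkcond integral_unif01; last first.
    rewrite restrict_EFin; apply/measurable_EFinP.
    apply/(measurable_restrictT _ mA); exact: measurable_funTS.
  by rewrite setIC integral_mkcondr.
rewrite (toL _ q1).
have -> : U A = (\int[lambda]_(u in A `&` `]0%R, 1%R[) (cst 1%:E u))%E.
  rewrite -(toL (fun=> 1))//; rewrite integral_cst// mul1e//.
have ms : measurable_fun (A `&` `]0%R, 1%R[%classic : set TR)
    (fun u => (signal_density kappa h rho u)%:E).
  apply: (@measurable_funS _ _ _ _ (`]0%R, 1%R[%classic : set TR)) => //.
  apply/measurable_EFinP; apply: measurable_funD.
    apply: measurable_funM => //; apply: measurable_funTS.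
    case: h_density => mh _ _ _.
    by apply: (measurableT_comp mh); exact: measurable_funM.
  by have /measurable_EFinP := measurable_int _ rho_int.
rewrite -!ge0_integralZl//; last 2 first.
- by move=> u [_ /=] u01; rewrite lee_fin signal_ge0.
- by rewrite lee_fin subr_ge0.
have mc : measurable_fun (A `&` `]0%R, 1%R[%classic : set TR)
    (fun u => ((1 - m%:R^-1)%:E * cst 1%E u : \bar R)%E) by exact: emeasurable_funM.
have msZ : measurable_fun (A `&` `]0%R, 1%R[%classic : set TR)
    (fun u => (m%:R^-1%:E * (signal_density kappa h rho u)%:E)%E).
  exact: emeasurable_funM.
rewrite -(ge0_integralD _ mAI _ mc _ msZ); last 2 first.
- by move=> u _; rewrite mule1 lee_fin subr_ge0.
- by move=> u [_ /=] u01; rewrite -EFinM lee_fin mulr_ge0 ?invr_ge0 ?(ltW m0)// signal_ge0.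
apply: eq_integral => u; rewrite inE => -[_ /= u01].
by rewrite [in RHS]row_density_in// [in RHS]EFinD [in RHS]EFinM mule1.
Qed.

End contaminated_density.

Definition law_of d (T : measurableType d) (R : realType) (P : probability T R)
    (X : T -> R) (mX : measurable_fun setT (X : T -> measurableTypeR R)) :
    probability (measurableTypeR R) R :=
  distribution P (HB.pack_for {mfun T >-> measurableTypeR R} X
    (isMeasurableFun.Build _ _ _ _ _ mX)).

Lemma Rintegral_law_of d (T : measurableType d) (R : realType)
    (P : probability T R) (X : T -> R)
    (mX : measurable_fun setT (X : T -> measurableTypeR R))
    (f : measurableTypeR R -> R) :
  bmeas f -> \int[law_of P mX]_x f x = \int[P]_y f (X y).
Proof. by move=> bf; rewrite Rintegral_distribution. Qed.

(** * From convergence of generators to convergence of the log-likelihood ratio *)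

Section abstract_convergence.
Context (R : realType).
Local Notation TR := (measurableTypeR R).
Local Notation U := (unif01 R).
Local Notation lambda := (@lebesgue_measure R).

Section one_array_row.
Variables (m : nat) (kappa : R) (h rho : 'I_m -> R -> R).
Hypotheses (m_gt0 : (0 < m)%N) (kappa01 : 0 < kappa <= 1).
Hypothesis h_density : forall i, density01 (h i).
Hypothesis rho_int : forall i, lambda.-integrable `]0, 1[ (EFin \o rho i).
Hypothesis rho_int0 : forall i,
  (\int[lambda]_(u in `]0%R, 1%R[) (rho i u)%:E = 0)%E.
Hypothesis signal_ge0 : forall i (u : R), u \in `]0, 1[ ->
  0 <= signal_density kappa (h i) (rho i) u.

Let m0 : 0 < m%:R :> R. Proof. by rewrite ltr0n. Qed.

(** Square integrability of each [rho i] is not assumed: it follows from the finiteness of the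
    weighted sum. The bound is then [small_part_sqr_le] summed over the row. *)
Lemma small_part_sqr_integrable e :
  (\sum_(i < m) ((m%:R^-1) ^+ 2)%:E *
     \int[lambda]_(u in `]0%R, 1%R[) ((rho i u) ^+ 2)%:E <= e%:E)%E ->
  (forall i, U.-integrable setT (fun u => (small_part m (rho i) u ^+ 2)%:E)) /\
  \sum_(i < m) \int[U]_u small_part m (rho i) u ^+ 2 <= 2 * e + 2 / m%:R.
Proof.
move=> He.
have mB i := measurable_small_part m (rho_int i).
have mz i : measurable_fun setT (zero_ext (rho i) : TR -> R).
  have := measurable_int _ (rho_int i); rewrite (measurable_restrictT _ _)//.
  by rewrite restrict_EFin => /measurable_EFinP.
have mz2 i : measurable_fun setT (fun u : TR => zero_ext (rho i) u ^+ 2).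
  exact: measurable_funX.
have J0 i : (0 <= \int[lambda]_(u in `]0%R, 1%R[) ((rho i u) ^+ 2)%:E)%E.
  by apply: integral_ge0 => u _; rewrite lee_fin sqr_ge0.
have JE i : (\int[lambda]_(u in `]0%R, 1%R[) ((rho i u) ^+ 2)%:E =
    \int[U]_u (zero_ext (rho i) u ^+ 2)%:E)%E.
  rewrite integral_unif01; last exact/measurable_EFinP.
  by apply: eq_integral => u u01; rewrite /zero_ext patchE u01.
have Jfin i : (\int[U]_u (zero_ext (rho i) u ^+ 2)%:E < +oo)%E.
  (* One infinite integral, with its positive weight, would make the whole sum of nonnegative terms
     infinite. *)
  rewrite -JE ltey; apply: contraL He => /eqP Jy.
  rewrite -ltNge (bigD1 i)//= Jy gt0_muley ?lte_fin ?exprn_gt0 ?invr_gt0//.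
  rewrite addye ?ltry// gt_eqF// (@lt_le_trans _ _ 0%E)//.
  by apply: sume_ge0 => j _; rewrite mule_ge0// lee_fin exprn_ge0// invr_ge0 ltW.
have iz2 i : U.-integrable setT (EFin \o (fun u => zero_ext (rho i) u ^+ 2)).
  apply/integrableP; split; first exact/measurable_EFinP.
  by under eq_integral do rewrite /= ger0_norm ?sqr_ge0//.
have i1 : U.-integrable setT (EFin \o (fun=> 1 : R)).
  by apply: bmeas_integrable; exact: bmeas_cst.
have iG i : U.-integrable setT (EFin \o (fun u => 2 * m%:R^-1 ^+ 2 *
    (zero_ext (rho i) u ^+ 2 + 1))).
  by apply: integrable_EFinZ; apply: integrable_EFinD (iz2 i) i1.
have B2G i u : `|small_part m (rho i) u ^+ 2| <= 2 * m%:R^-1 ^+ 2 *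
    (zero_ext (rho i) u ^+ 2 + 1).
  by rewrite ger0_norm ?sqr_ge0//; exact: small_part_sqr_le.
have mB2 i : measurable_fun setT (fun u : TR => small_part m (rho i) u ^+ 2).
  exact: measurable_funX.
split=> [i|]; first exact: (integrable_dominated (mB2 i) (iG i) (B2G i)).
have le1 i : \int[U]_u small_part m (rho i) u ^+ 2 <=
    2 * (m%:R^-1 ^+ 2 * \int[U]_u zero_ext (rho i) u ^+ 2) + 2 * m%:R^-1 ^+ 2.
  have := le_Rintegral_norm (mB2 i) (iG i) (B2G i); rewrite ler_norml => /andP[_].
  rewrite (RintegralZl _ measurableT (integrable_EFinD (iz2 i) i1)).
  rewrite (RintegralD measurableT (iz2 i) i1) Rintegral_cst1; lra.
apply: le_trans (ler_sum _ (fun i _ => le1 i)) _.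
rewrite big_split/= -mulr_sumr sumr_const card_ord.
have -> : 2 * m%:R^-1 ^+ 2 *+ m = 2 / m%:R :> R.
  by rewrite -[LHS]mulr_natl; field; rewrite gt_eqF.
rewrite lerD2r ler_wpM2l// -lee_fin; apply: le_trans He.
rewrite -sumEFin; apply: lee_sum => i _; rewrite EFinM JE fineK//.
exact: (integrable_fin_num measurableT (iz2 i)).
Qed.

Hypothesis m_gt1 : (1 < m)%N.

(** From two observations on, the noise keeps weight at least 1/2; this keeps [1 + A + B] away from
    the singularity of the logarithm. *)
Lemma row_density_half i u : 2^-1 <= row_density m kappa (h i) (rho i) u.
Proof.
apply: le_trans (row_density_ge m_gt0 kappa01 (h_density i) (signal_ge0 i) u).
have : m%:R^-1 <= 2^-1 :> R by rewrite lef_pV2 ?posrE// ler_nat.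
lra.
Qed.

Variables (b c : R) (nu : probability TR R) (C : R) (f f1 : R -> R) (d e : R).
Hypotheses (c_ge0 : 0 <= c) (ff1 : test_pair C f f1) (d_gt0 : 0 < d).
Hypothesis rho_le :
  (\sum_(i < m) ((m%:R^-1) ^+ 2)%:E *
     \int[lambda]_(u in `]0%R, 1%R[) ((rho i u) ^+ 2)%:E <= e%:E)%E.
Variable del : R.
Hypothesis generator_approx : forall i x,
  `|m%:R * kappa * \int[U]_u log_increment f f1 x (h i u / (m%:R * kappa)) -
    generator b c nu f f1 x| <= del.

(** Each of the [m] summands is exchanged for a compound Poisson variable with parameters [b / m]
    and [c / m]. The terms of the bound are the second moments of the perturbations, the other half
    of the AM-GM inequality, the error of the generator, and [m] expansion errors of order
    [1 / m ^ 2]. *)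
Lemma sum_ln_approx :
  `|\int[prod_prob (fun _ : 'I_m => U)]_y
      f (sum_ln (fun i u => row_density m kappa (h i) (rho i) u) y) -
    \int[shifted_cpoisson b c nu]_z f z| <=
  (3 * C * (d / 2) + 10 * C) * (2 * e + 2 / m%:R) + 3 * C * (2 * d)^-1 + del +
  C * (3 * c ^+ 2 + b ^+ 2 + 4 * c * `|b|) / m%:R.
Proof.
have C0 := test_pair_ge0 ff1; have bf := test_pair_bmeas ff1.
have [B2i B2le] := small_part_sqr_integrable rho_le.
set K := C * (3 * c ^+ 2 + b ^+ 2 + 4 * c * `|b|).
pose q i u := row_density m kappa (h i) (rho i) u.
pose b2 i := \int[U]_u small_part m (rho i) u ^+ 2.
pose err (i : 'I_m) := 3 * C * (d / 2 * b2 i + (2 * d)^-1 * m%:R^-1) + 10 * C * b2 i +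
  del / m%:R + K * m%:R^-1 ^+ 2.
have mlnq i : measurable_fun setT (fun u : TR => ln (q i u)).
  apply: (measurableT_comp (@measurable_ln R)).
  exact: measurable_row_density.
have m01 : 0 <= (m%:R^-1 : R) <= 1.
  apply/andP; split; first by rewrite invr_ge0 ltW.
  by rewrite invf_le1// ler1n.
have Esc : \int[shifted_cpoisson b c nu]_z f z =
    \int[prod_prob (fun _ : 'I_m => shifted_cpoisson (m%:R^-1 * b) (m%:R^-1 * c) nu)]_y
      f (0 + sum_coord (fun _ => id) y).
  have mc0 : 0 <= m%:R^-1 * c by rewrite mulr_ge0//; case/andP: m01.
  have mK (r : R) : m%:R * (m%:R^-1 * r) = r by rewrite mulrA divff ?mul1r// gt_eqF.
  rewrite (Rintegral_sum_shifted_cpoisson m (m%:R^-1 * b) nu 0 mc0 bf) !mK.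
  by apply: eq_Rintegral => z _; rewrite add0r.
have Ely : \int[prod_prob (fun _ : 'I_m => U)]_y f (sum_ln q y) =
    \int[prod_prob (fun _ : 'I_m => U)]_y f (0 + sum_coord (fun i u => ln (q i u)) y).
  by apply: eq_Rintegral => y _; rewrite add0r.
rewrite Ely Esc.
have mid (i : 'I_m) : measurable_fun setT (id : TR -> TR) by exact: measurable_id.
apply: le_trans (@lindeberg_replacement _ _ TR TR R f m _ _ _ _ err bf mlnq mid _ 0) _.
  move=> i x.
  set sc := shifted_cpoisson _ _ _.
  have AB u : - 2^-1 <= signal_part m kappa (h i) u + small_part m (rho i) u.
    have := row_density_half i u; rewrite /row_density; lra.
  have rb := row_bound m_gt0 kappa01 (h_density i) (rho_int i) (rho_int0 i) ff1 AB (B2i i) x d_gt0.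
  have cb := @cpoisson_row_bound R b c nu C f f1 x m%:R^-1 ff1 c_ge0 m01.
  have ga := generator_approx i x.
  have bfx : bmeas (fun z : TR => f (x + z)) by exact: (bmeas_translate x bf).
  have bfq : bmeas (fun u : TR => f (x + ln (q i u))) by exact: (bmeas_translate x bf).
  have bcst : bmeas (fun _ : TR => f x) by exact: bmeas_cst.
  rewrite (RintegralB measurableT (bmeas_integrable sc bfx) (bmeas_integrable sc bcst))
    Rintegral_cst1 in cb.
  rewrite (RintegralB measurableT (bmeas_integrable U bfq) (bmeas_integrable U bcst))
    Rintegral_cst1 in rb.
  set I1 := \int[U]_a _; set I2 := \int[sc]_b _.
  rewrite -/I1 -/(b2 i) in rb; rewrite -/I2 -/K in cb.
  set J := \int[U]_u _ in rb ga; set G := generator _ _ _ _ _ _ in cb ga.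
  have ga' : `|kappa * J - m%:R^-1 * G| <= del / m%:R.
    have -> : kappa * J - m%:R^-1 * G = (m%:R * kappa * J - G) / m%:R.
      by field; rewrite gt_eqF.
    by rewrite normrM [`|m%:R^-1|]ger0_norm ?ler_wpM2r//; case/andP: m01.
  have -> : I1 - I2 = (I1 - f x - kappa * J) + (kappa * J - m%:R^-1 * G) -
    (I2 - f x - m%:R^-1 * G) by ring.
  apply: le_trans (ler_normB _ _) _.
  apply: le_trans (lerD (ler_normD _ _) (lexx _)) _.
  rewrite /err; lra.
have -> : \sum_(i < m) err i = (3 * C * (d / 2) + 10 * C) * \sum_(i < m) b2 i +
    (3 * C * (2 * d)^-1 * m%:R^-1 + del / m%:R + K * m%:R^-1 ^+ 2) *+ m.
  rewrite mulr_sumr -[in X in _ = _ + X](card_ord m) -sumr_const -big_split/=.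
  by apply: eq_bigr => i _; rewrite card_ord /err; ring.
have -> : (3 * C * (2 * d)^-1 * m%:R^-1 + del / m%:R + K * m%:R^-1 ^+ 2) *+ m =
    3 * C * (2 * d)^-1 + del + K / m%:R.
  by rewrite -[LHS]mulr_natl; field; rewrite !gt_eqF.
have : (3 * C * (d / 2) + 10 * C) * \sum_(i < m) b2 i <=
  (3 * C * (d / 2) + 10 * C) * (2 * e + 2 / m%:R).
  by rewrite ler_wpM2l// addr_ge0 ?mulr_ge0// ltW.
lra.
Qed.

End one_array_row.

Variables (k : nat -> nat) (k_gt0 : forall n, (0 < k n)%N).
Hypothesis k_cvg : k n @[n --> \oo] --> \oo.
Variables (kappa : nat -> R) (kappa01 : forall n, 0 < kappa n <= 1).
Variables h rho : forall n, 'I_(k n) -> R -> R.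
Hypothesis h_density : forall n (i : 'I_(k n)), density01 (h i).
Hypothesis rho_int : forall n (i : 'I_(k n)),
  lambda.-integrable `]0, 1[ (EFin \o rho i).
Hypothesis rho_int0 : forall n (i : 'I_(k n)),
  (\int[lambda]_(u in `]0%R, 1%R[) (rho i u)%:E = 0)%E.
Hypothesis rho_small :
  (\sum_(i < k n) (((k n)%:R^-1) ^+ 2)%:E *
    \int[lambda]_(u in `]0%R, 1%R[) ((rho i u) ^+ 2)%:E)%E @[n --> \oo] --> 0%E.
Hypothesis signal_ge0 : forall n (i : 'I_(k n)) (u : R), u \in `]0, 1[ ->
  0 <= signal_density (kappa n) (h i) (rho i) u.

Definition array_density n (i : 'I_(k n)) (u : R) : R :=
  row_density (k n) (kappa n) (h i) (rho i) u.

Variables (b c : R) (nu : probability TR R).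
Hypothesis c_ge0 : 0 <= c.
Hypothesis generator_cvg : forall C f f1, test_pair C f f1 ->
  forall del, 0 < del -> \forall n \near \oo, forall (i : 'I_(k n)) x,
  `|(k n)%:R * kappa n *
      \int[U]_u log_increment f f1 x (h i u / ((k n)%:R * kappa n)) -
    generator b c nu f f1 x| <= del.

Lemma sum_ln_cvg
    (mS : forall n, measurable_fun setT (sum_ln (@array_density n) : _ -> TR))
    (f : R -> R) : test_fun f ->
  \int[law_of (prod_prob (fun _ : 'I_(k n) => U)) (mS n)]_x f x @[n --> \oo] -->
  \int[shifted_cpoisson b c nu]_x f x.
Proof.
move=> [C [f1 ff1]]; have C0 := test_pair_ge0 ff1; have bf := test_pair_bmeas ff1.
apply/cvgrPdist_le => eps eps0.
(* Chosen so that [3 * C / (2 * d)] is at most [eps / 4], independently of [n]; the second moments,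
   which carry the factor [d], are made small afterwards. *)
pose d := 6 * C / eps + 1.
have d0 : 0 < d by rewrite ltr_wpDl// divr_ge0 ?mulr_ge0// ltW.
have dC : 3 * C * (2 * d)^-1 <= eps / 4.
  rewrite ler_pdivrMr ?mulr_gt0//.
  have -> : eps / 4 * (2 * d) = 3 * C + eps / 2 by rewrite /d; field; rewrite gt_eqF.
  by rewrite lerDl divr_ge0// ltW.
pose L := 3 * C * (d / 2) + 10 * C + 1.
have L0 : 1 <= L by rewrite lerDr addr_ge0 ?mulr_ge0// ltW.
have L0' : 0 < L by lra.
pose K := C * (3 * c ^+ 2 + b ^+ 2 + 4 * c * `|b|).
have K0 : 0 <= K.
  apply: mulr_ge0 => //; have h1 := sqr_ge0 c; have h2 := sqr_ge0 b.
  by have h3 : 0 <= 4 * c * `|b| by [rewrite !mulr_ge0]; lra.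
pose e := eps / (16 * L).
have e0 : 0 < e by rewrite divr_gt0// mulr_gt0.
(* The summand 1 gives [1 < k n]; the other two bound [2 * L / k n] by [eps / 8] and [K / k n] by
   [eps / 4]. *)
pose N0 := (Num.truncn (1 + 16 * L / eps + 4 * K / eps)).+1.
have N0P : 1 + 16 * L / eps + 4 * K / eps < N0%:R by exact: truncnS_gt.
have q1 : 0 <= 16 * L / eps by rewrite divr_ge0 ?mulr_ge0// ltW.
have q2 : 0 <= 4 * K / eps by apply: divr_ge0; [exact: mulr_ge0|exact: ltW].
have rho_ev : \forall n \near \oo, ((\sum_(i < k n) (((k n)%:R^-1) ^+ 2)%:E *
    \int[lambda]_(u in `]0%R, 1%R[) ((rho i u) ^+ 2)%:E) <= e%:E)%E.
  have e_nbhs : nbhs (0%E : \bar R) [set x | (x < e%:E)%E].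
    by apply: open_ereal_lt'; rewrite lte_fin.
  have H : \forall n \near \oo, ((\sum_(i < k n) (((k n)%:R^-1) ^+ 2)%:E *
    \int[lambda]_(u in `]0%R, 1%R[) ((rho i u) ^+ 2)%:E) < e%:E)%E.
    exact: (rho_small e_nbhs).
  by near=> n; apply: ltW; near: n.
have k_ev : \forall n \near \oo, (N0 <= k n)%N by exact: (k_cvg (nbhs_infty_ge N0)).
have del0 : 0 < eps / 4 by rewrite divr_gt0.
near=> n.
have kn : (N0 <= k n)%N by near: n.
have knR : N0%:R <= (k n)%:R :> R by rewrite ler_nat.
have kn1 : (1 < k n)%N.
  rewrite -(ltr_nat R); lra.
have kn0 : 0 < (k n)%:R :> R by rewrite ltr0n.
have rho_n : ((\sum_(i < k n) (((k n)%:R^-1) ^+ 2)%:E *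
    \int[lambda]_(u in `]0%R, 1%R[) ((rho i u) ^+ 2)%:E) <= e%:E)%E by near: n.
have gen_n : forall (i : 'I_(k n)) x, `|(k n)%:R * kappa n *
      \int[U]_u log_increment f f1 x (h i u / ((k n)%:R * kappa n)) -
    generator b c nu f f1 x| <= eps / 4.
  by near: n; exact: generator_cvg ff1 _ del0.
have main := sum_ln_approx (k_gt0 n) (kappa01 n) (@h_density n) (@rho_int n)
  (@rho_int0 n) (@signal_ge0 n) kn1 c_ge0 ff1 d0 rho_n gen_n.
rewrite distrC (Rintegral_law_of _ _ bf).
apply: le_trans main _; rewrite -/K.
have h1 : K / (k n)%:R <= eps / 4.
  rewrite ler_pdivrMr// [leRHS]mulrC -ler_pdivrMr ?divr_gt0//.
  have -> : K / (eps / 4) = 4 * K / eps by field; rewrite gt_eqF.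
  lra.
have h2 : L * (2 * e + 2 / (k n)%:R) <= eps / 4.
  have -> : L * (2 * e + 2 / (k n)%:R) = eps / 8 + 2 * L / (k n)%:R.
    by rewrite /e; field; rewrite !gt_eqF.
  have : 2 * L / (k n)%:R <= eps / 8.
    rewrite ler_pdivrMr// [leRHS]mulrC -ler_pdivrMr ?divr_gt0//.
    have -> : 2 * L / (eps / 8) = 16 * L / eps by field; rewrite gt_eqF.
    lra.
  lra.
have h3 : 0 <= 2 * e + 2 / (k n)%:R.
  by apply: addr_ge0; [apply: mulr_ge0 => //; exact: ltW|apply: divr_ge0].
have : (3 * C * (d / 2) + 10 * C) * (2 * e + 2 / (k n)%:R) <=
    L * (2 * e + 2 / (k n)%:R).
  by rewrite ler_wpM2r// /L lerDl.
lra.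
Unshelve. all: by end_near.
Qed.

End abstract_convergence.

(** * Tail masses and the limit measure *)

Section step_approximation.
Context (R : realType).
Implicit Types (w C : R) (psi : R -> R) (t : nat -> R).

(** The class for which tail masses determine the integral of [psi (h)]: the ratio [psi w / w] is
    bounded, small near 0, and Lipschitz away from 0. A single constant [C] makes the later limits
    uniform over the class, hence uniform in the base point [x]. *)
Definition mild C psi : Prop :=
  [/\ measurable_fun setT psi, forall w, 0 <= w -> `|psi w| <= C * w,
      forall w, 0 <= w -> `|psi w| <= C * w ^+ 2 &
      forall w v, 0 <= w -> 0 <= v -> `|psi w - psi v| <= C * `|w - v|].

Section fixed.
Variables (C : R) (psi : R -> R) (t : nat -> R) (a del : R).
Hypothesis psiP : mild C psi.
Hypotheses (a_gt0 : 0 < a) (del_gt0 : 0 < del).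
Hypothesis tP : forall j, a + j%:R * del < t j < a + j.+1%:R * del.

Local Notation Phi w := (psi w / w).

Let C0 : 0 <= C.
Proof.
case: psiP => _ /(_ 1 ler01) + _ _; rewrite mulr1; exact: le_trans.
Qed.

Lemma mild_ratio_le w : 0 <= w -> `|Phi w| <= C.
Proof.
rewrite le_eqVlt => /predU1P[<-|w0]; first by rewrite invr0 mulr0 normr0.
rewrite normrM normfV (gtr0_norm w0) ler_pdivrMr//.
by case: psiP => _ + _ _; apply; exact: ltW.
Qed.

Lemma mild_ratio_le_id w : 0 <= w -> `|Phi w| <= C * w.
Proof.
rewrite le_eqVlt => /predU1P[<-|w0]; first by rewrite invr0 !mulr0 normr0.
rewrite normrM normfV (gtr0_norm w0) ler_pdivrMr// -mulrA -expr2.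
by case: psiP => _ _ + _; apply; exact: ltW.
Qed.

Lemma mild_ratio_lipschitz w v : 0 < v -> v <= w ->
  `|Phi w - Phi v| <= 2 * C * (w - v) / v.
Proof.
move=> v0 vw; have w0 : 0 < w by exact: lt_le_trans vw.
have -> : Phi w - Phi v = (psi w - psi v) / w - Phi v * ((w - v) / w).
  by field; rewrite !gt_eqF.
have d0 : 0 <= w - v by rewrite subr_ge0.
have h1 : `|(psi w - psi v) / w| <= C * (w - v) / v.
  rewrite normrM normfV (gtr0_norm w0).
  apply: (@le_trans _ _ (C * (w - v) / w)).
    rewrite ler_pM2r ?invr_gt0//; case: psiP => _ _ _ /(_ w v (ltW w0) (ltW v0)).
    by rewrite (ger0_norm d0).
  by rewrite ler_wpM2l ?mulr_ge0// lef_pV2.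
have h2 : `|Phi v * ((w - v) / w)| <= C * ((w - v) / v).
  rewrite normrM ler_pM ?mild_ratio_le ?(ltW v0)//.
  rewrite normrM normfV (gtr0_norm w0) (ger0_norm d0).
  by rewrite ler_wpM2l// lef_pV2.
apply: le_trans (ler_normB _ _) _.
have -> : 2 * C * (w - v) / v = C * (w - v) / v + C * ((w - v) / v) by ring.
exact: lerD.
Qed.

Let t_gt0 j : 0 < t j.
Proof.
have /andP[tj _] := tP j; apply: lt_trans tj; rewrite ltr_wpDr// mulr_ge0//.
exact: ltW.
Qed.

Let t_incr j : t j < t j.+1.
Proof. by have /andP[_ h1] := tP j; have /andP[h2 _] := tP j.+1; exact: lt_trans h2. Qed.

(* Abel summation: the step function with value Phi (t j) on ]t j, t j.+1] *)
Definition step_weight j : R := Phi (t j) - (if j is i.+1 then Phi (t i) else 0).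

Definition step_fun n w : R := \sum_(j < n.+1) step_weight j * (t j < w)%R%:R.

Lemma step_weight_le j : `|step_weight j| <= 2 * C.
Proof.
rewrite /step_weight; have h1 := mild_ratio_le (ltW (t_gt0 j)).
case: j h1 => [|j] h1; first by rewrite subr0; have := C0; lra.
have := mild_ratio_le (ltW (t_gt0 j)); have := ler_normB (Phi (t j.+1)) (Phi (t j)).
lra.
Qed.

(** The first term bounds the ratio below the first threshold, which is less than [a + del]. The
    second bounds its oscillation between consecutive thresholds: a length of at most [2 * del]
    times a Lipschitz constant of at most [2 * C / a]. *)
Definition step_error : R := C * (a + del) + 4 * C * del / a.

Lemma step_fun_approx n w : 0 <= w ->
  `|Phi w - step_fun n w| <= step_error + 2 * C * (t n < w)%R%:R.
Proof.
move=> w0; have e1 : 0 <= C * (a + del) by rewrite mulr_ge0// addr_ge0// ltW.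
have e2 : 0 <= 4 * C * del / a by rewrite divr_ge0 ?(ltW a_gt0)// !mulr_ge0// ltW.
suff [H1 H2] : (t n < w -> step_fun n w = Phi (t n)) /\
    (w <= t n -> `|Phi w - step_fun n w| <= step_error).
  have [wt|tw] := leP w (t n); first by rewrite mulr0 addr0; exact: H2.
  rewrite H1// mulr1; apply: le_trans (ler_normB _ _) _.
  have := mild_ratio_le w0; have := mild_ratio_le (ltW (t_gt0 n)).
  rewrite /step_error; lra.
elim: n => [|n [ih1 ih2]].
  rewrite /step_fun big_ord_recl big_ord0 addr0 /step_weight subr0.
  split=> [->|wt]; first by rewrite mulr1.
  rewrite ltNge wt mulr0 subr0; apply: le_trans (mild_ratio_le_id w0) _.
  have /andP[_ tu] := tP 0; rewrite mul1r in tu.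
  have : C * w <= C * (a + del) by rewrite ler_wpM2l// (le_trans wt)// ltW.
  rewrite /step_error; lra.
have SS : step_fun n.+1 w = step_fun n w + step_weight n.+1 * (t n.+1 < w)%R%:R.
  by rewrite /step_fun big_ord_recr.
rewrite SS; split=> wt.
  rewrite wt mulr1 ih1; last exact: lt_trans wt.
  by rewrite /step_weight addrC subrK.
rewrite (ltNge (t n.+1)) wt mulr0 addr0.
have [wn|wn] := leP w (t n); first exact: ih2.
rewrite (ih1 wn); apply: le_trans (mild_ratio_lipschitz (t_gt0 n) (ltW wn)) _.
have /andP[tl _] := tP n; have /andP[_ tu] := tP n.+1.
have at_ : a <= t n by apply: le_trans (ltW tl); rewrite lerDl mulr_ge0// ltW.
have wtd : w - t n <= 2 * del.
  by move: tu tl; rewrite -!natr1; lra.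
rewrite /step_error.
suff : 2 * C * (w - t n) / t n <= 4 * C * del / a by lra.
rewrite ler_pM ?invr_ge0 ?(ltW (t_gt0 n)) ?lef_pV2 ?posrE//.
- by rewrite !mulr_ge0// subr_ge0 ltW.
- have : 2 * C * (w - t n) <= 2 * C * (2 * del) by rewrite ler_wpM2l// mulr_ge0.
  lra.
Qed.

Section one_measure.
Context d (T : measurableType d).
Variables (P : probability T R) (g w : T -> R).
Hypotheses (g_ge0 : forall u, 0 <= g u) (w_ge0 : forall u, 0 <= w u).
Hypothesis mw : measurable_fun setT w.
Hypothesis g_int : P.-integrable setT (EFin \o g).
Hypothesis g_int1 : \int[P]_u g u = 1.

(** The pair [g], [w] covers both sides of the comparison: [h], [h] under the uniform law, and the
    constant 1 with [excess] under the limit law. *)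
Definition tail_mass (x : R) : R := \int[P]_u (g u * (x < w u)%R%:R).

Let mg : measurable_fun setT g.
Proof. by have /measurable_EFinP := measurable_int _ g_int. Qed.

Let mb x : measurable_fun setT (fun u => (x < w u)%R%:R : R).
Proof.
rewrite (_ : (fun u => _) = fun u => if x < w u then 1 else 0 : R).
  by apply: measurable_fun_ifT => //; exact: measurable_fun_ltr.
by apply/funext => u; case: (x < w u).
Qed.

Let b01 (x : bool) : 0 <= (x%:R : R) <= 1.
Proof. by case: x; rewrite ?lexx ?ler01. Qed.

Lemma tail_mass_integrable x :
  P.-integrable setT (EFin \o (fun u => g u * (x < w u)%R%:R)).
Proof.
apply: integrable_dominated g_int _; first exact: measurable_funM.
move=> u; have /andP[h0 h1] := b01 (x < w u)%R.
by rewrite ger0_norm ?mulr_ge0// ler_piMr.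
Qed.

Lemma step_fun_integral n :
  P.-integrable setT (EFin \o (fun u => g u * step_fun n (w u))) /\
  \int[P]_u (g u * step_fun n (w u)) =
    \sum_(j < n.+1) step_weight j * tail_mass (t j).
Proof.
have E k : (fun u => g u * (step_weight k * (t k < w u)%R%:R)) =
    (fun u => step_weight k * (g u * (t k < w u)%R%:R)).
  by apply/funext => u; rewrite mulrCA.
have I k : P.-integrable setT (EFin \o (fun u => g u * (step_weight k * (t k < w u)%R%:R))).
  by rewrite E; apply: integrable_EFinZ; exact: tail_mass_integrable.
have V k : \int[P]_u (g u * (step_weight k * (t k < w u)%R%:R)) =
    step_weight k * tail_mass (t k).
  by rewrite E (RintegralZl _ measurableT (tail_mass_integrable (t k))).
elim: n => [|n [ih1 ih2]].
  have -> : (fun u => g u * step_fun 0 (w u)) =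
      (fun u => g u * (step_weight 0 * (t 0 < w u)%R%:R)).
    by apply/funext => u; rewrite /step_fun big_ord_recl big_ord0 addr0.
  by split; [exact: I|rewrite V big_ord_recl big_ord0 addr0].
have -> : (fun u => g u * step_fun n.+1 (w u)) = (fun u => g u * step_fun n (w u) +
    g u * (step_weight n.+1 * (t n.+1 < w u)%R%:R)).
  by apply/funext => u; rewrite /step_fun big_ord_recr/= mulrDr.
split; first exact: integrable_EFinD.
by rewrite (RintegralD measurableT ih1 (I _)) ih2 V [RHS]big_ord_recr.
Qed.

Lemma mild_ratio_integral_approx n :
  `|\int[P]_u (g u * (psi (w u) / w u)) -
    \sum_(j < n.+1) step_weight j * tail_mass (t j)| <=
  step_error + 2 * C * tail_mass (t n).
Proof.
have [iS <-] := step_fun_integral n.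
have mpsi : measurable_fun setT (fun u => psi (w u) / w u).
  case: psiP => mpsi _ _ _; apply: measurable_funM.
    exact: (measurableT_comp mpsi).
  have -> : (fun u => (w u)^-1) = (fun u => (w u) `^ (-1)).
    by apply/funext => u; rewrite powR_inv1.
  exact: (measurableT_comp (measurable_powR _) mw).
have mgP : measurable_fun setT (fun u => g u * (psi (w u) / w u)).
  exact: measurable_funM.
have iP : P.-integrable setT (EFin \o (fun u => g u * (psi (w u) / w u))).
  apply: integrable_dominated mgP (integrable_EFinZ C g_int) _ => u.
  by rewrite normrM (ger0_norm (g_ge0 u)) mulrC ler_wpM2r// mild_ratio_le.
rewrite -(RintegralB measurableT iP iS).
have iT := tail_mass_integrable (t n).
have -> : step_error + 2 * C * tail_mass (t n) =
    \int[P]_u (step_error * g u + 2 * C * (g u * (t n < w u)%R%:R)).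
  rewrite (RintegralD measurableT (integrable_EFinZ _ g_int) (integrable_EFinZ _ iT)).
  rewrite (RintegralZl _ measurableT g_int) (RintegralZl _ measurableT iT).
  by rewrite g_int1 mulr1.
apply: le_Rintegral_norm.
- apply: measurable_funB => //.
  by have /measurable_EFinP := measurable_int _ iS.
- exact: integrable_EFinD (integrable_EFinZ _ g_int) (integrable_EFinZ _ iT).
move=> u; rewrite -mulrBr normrM (ger0_norm (g_ge0 u)).
have := step_fun_approx n (w_ge0 u) => /(ler_wpM2l (g_ge0 u)) /le_trans; apply.
rewrite mulrDr; lra.
Qed.

End one_measure.
End fixed.

(** Both integrals are replaced by the same linear combination of tail masses, with weights at most
    [2 * C]. Of [psi] only the constant [C] enters the bound. *)
Lemma mild_ratio_compare C psi t a del d d' (T : measurableType d)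
    (T' : measurableType d') (P : probability T R) (P' : probability T' R)
    (g w : T -> R) (g' w' : T' -> R) n e :
  mild C psi -> 0 < a -> 0 < del ->
  (forall j, a + j%:R * del < t j < a + j.+1%:R * del) ->
  (forall u, 0 <= g u) -> (forall u, 0 <= w u) -> measurable_fun setT w ->
  P.-integrable setT (EFin \o g) -> \int[P]_u g u = 1 ->
  (forall u, 0 <= g' u) -> (forall u, 0 <= w' u) -> measurable_fun setT w' ->
  P'.-integrable setT (EFin \o g') -> \int[P']_u g' u = 1 ->
  (forall j, (j <= n)%N -> `|tail_mass P g w (t j) - tail_mass P' g' w' (t j)| <= e) ->
  `|\int[P]_u (g u * (psi (w u) / w u)) - \int[P']_u (g' u * (psi (w' u) / w' u))| <=
  2 * (C * (a + del) + 4 * C * del / a) +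
  2 * C * (2 * tail_mass P' g' w' (t n) + e) + n.+1%:R * (2 * C * e).
Proof.
move=> psiP a0 d0 tP g0 w0 mw ig g1 g0' w0' mw' ig' g1' te.
have h1 := mild_ratio_integral_approx psiP a0 d0 tP g0 w0 mw ig g1 n.
have h2 := mild_ratio_integral_approx psiP a0 d0 tP g0' w0' mw' ig' g1' n.
set S := \sum_(j < _) _ in h1; set S' := \sum_(j < _) _ in h2.
have C0 : 0 <= C by case: psiP => _ /(_ 1 ler01) + _ _; rewrite mulr1; exact: le_trans.
have SS : `|S - S'| <= n.+1%:R * (2 * C * e).
  rewrite /S /S' -sumrB; apply: le_trans (ler_norm_sum _ _ _) _.
  rewrite mulr_natl -[in leRHS](card_ord n.+1) -sumr_const; apply: ler_sum => j _.
  rewrite -mulrBr normrM ler_pM//; first exact: step_weight_le psiP a0 d0 tP _.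
  by apply: te; rewrite -ltnS.
have tn := te n (leqnn n); rewrite /step_error in h1 h2.
have tn' : tail_mass P g w (t n) <= tail_mass P' g' w' (t n) + e.
  by move: tn; rewrite ler_norml; lra.
have tn2 : 2 * C * tail_mass P g w (t n) <= 2 * C * (tail_mass P' g' w' (t n) + e).
  by rewrite ler_wpM2l// mulr_ge0.
set I := \int[P]_u _ in h1 *; set I' := \int[P']_u _ in h2 *.
have -> : I - I' = (I - S) + (S - S') - (I' - S') by ring.
apply: le_trans (ler_normB _ _) _.
apply: le_trans (lerD (ler_normD _ _) (lexx _)) _.
lra.
Qed.

End step_approximation.

Section density_probability.
Context d (T : measurableType d) (R : realType).
Variables (P : probability T R) (q : T -> R).
Hypotheses (mq : measurable_fun setT q) (q_ge0 : forall u, 0 <= q u).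
Hypothesis q_int : (\int[P]_u (q u)%:E = 1)%E.

(** The proofs are arguments of the definition so that the measure and probability structures can be
    attached to it. *)
Definition density_prob of measurable_fun setT q & (forall u, 0 <= q u) &
    (\int[P]_u (q u)%:E = 1)%E : set T -> \bar R :=
  fun A => (\int[P]_(u in A) (q u)%:E)%E.

Local Notation dp := (density_prob mq q_ge0 q_int).

Let dp0 : dp set0 = 0%E. Proof. exact: integral_set0. Qed.

Let dp_ge0 A : (0 <= dp A)%E.
Proof. by apply: integral_ge0 => u _; rewrite lee_fin. Qed.

Let dp_sigma_additive : semi_sigma_additive dp.
Proof.
move=> F mF tF mUF; rewrite /density_prob; apply: cvg_toP.
  apply: ereal_nondecreasing_is_cvgn => m n mn.
  by apply: lee_sum_nneg_natr => // k _ _; exact: dp_ge0.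
rewrite (@ge0_integral_bigcup _ _ _ P F (fun u => (q u)%:E) mF)//.
- by apply: measurable_funTS; exact/measurable_EFinP.
- by move=> u _; rewrite lee_fin.
Qed.

HB.instance Definition _ := isMeasure.Build _ _ _ dp
  dp0 dp_ge0 dp_sigma_additive.

HB.instance Definition _ := @Measure_isProbability.Build _ _ R dp q_int.

End density_probability.

Lemma density_probability d (T : measurableType d) (R : realType)
    (P : probability T R) (q : T -> R) :
  measurable_fun setT q -> (forall u, 0 <= q u) ->
  (\int[P]_u (q u)%:E = 1)%E -> exists Q : probability T R, has_density P Q q.
Proof. by move=> mq q0 q1; exists (density_prob mq q0 q1). Qed.

Lemma near_all_leq (A : nat -> nat -> Prop) (n : nat) :
  (forall j, (j <= n)%N -> \forall m \near \oo, A j m) ->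
  \forall m \near \oo, forall j, (j <= n)%N -> A j m.
Proof.
elim: n => [|n ih] An.
  by have := An 0 (leqnn 0); apply: filterS => m Am j; rewrite leqn0 => /eqP ->.
have h1 := ih (fun j jn => An j (leqW jn)); have h2 := An n.+1 (leqnn _).
apply: filterS2 h1 h2 => m h1 h2 j; rewrite leq_eqVlt => /predU1P[->//|].
exact: h1.
Qed.

Lemma probability_tail_cvg0 (R : realType) (P : probability (measurableTypeR R) R) e :
  0 < e -> exists x : R, 0 < x /\ forall y, x <= y -> fine (P `]y, +oo[%classic) <= e.
Proof.
move=> e0; pose F n := `]n%:R : R, +oo[%classic.
have mF n : measurable (F n : set (measurableTypeR R)) by exact: measurable_itv.
have F0 : \bigcap_n F n = set0.
  rewrite -subset0 => y Fy; have := Fy (Num.trunc `|y|).+1 I.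
  rewrite /F/= in_itv/= andbT => h; have := truncnS_gt `|y|.
  have := ler_norm y; lra.
have : P \o F @ \oo --> P (\bigcap_n F n).
  apply: (@nonincreasing_cvg_mu _ _ _ P F).
  - by apply: le_lt_trans (probability_le1 P (mF 0)) _; rewrite ltry.
  - exact: mF.
  - by rewrite F0.
  - move=> m n mn; apply/subsetPset => y; rewrite /F/= !in_itv/= !andbT.
    by apply: le_lt_trans; rewrite ler_nat.
rewrite F0 measure0 => /fine_cvgP[_] /cvgrPdist_le /(_ e e0) [N _ NP].
exists N.+1%:R; split=> // y Ny.
have := NP N.+1 (leqnSn N); rewrite sub0r normrN /=; apply: le_trans.
apply: le_trans (ler_norm _).
apply: fine_le; rewrite ?fin_num_measure//.
apply: le_measure; rewrite ?inE; [exact: measurable_itv|exact: mF|].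
by move=> z; rewrite /F/= !in_itv/= !andbT; exact: le_lt_trans.
Qed.

Section limit_measure.
Context (R : realType).
Local Notation TR := (measurableTypeR R).
Local Notation U := (unif01 R).
Local Notation lambda := (@lebesgue_measure R).

Section dense.
Variable D : set R.
Hypotheses (D_pos : D `<=` `]0, +oo[) (D_dense : `]0, +oo[ `<=` closure D).

Lemma dense_between (a b : R) : 0 <= a -> a < b -> exists2 x, D x & a < x < b.
Proof.
move=> a0 ab; have m0 : 0 < (a + b) / 2 by lra.
have /D_dense : `]0, +oo[%classic ((a + b) / 2) by rewrite /= in_itv/= m0.
case/(_ `]a, b[%classic) => [|x [Dx]].
  by apply: near_in_itvoo; rewrite in_itv/=; lra.
by rewrite /= in_itv/= => abx; exists x.
Qed.

(** A regular grid may miss the dense set, on which alone tail masses are known to converge; one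
    threshold in each open cell is enough for the step approximation. *)
Lemma dense_thresholds (a del : R) : 0 < a -> 0 < del ->
  exists x t : nat -> R, forall j, [/\ D (x j), t j = expR (x j) - 1 &
    a + j%:R * del < t j < a + j.+1%:R * del].
Proof.
move=> a0 d0; have P j : exists x, D x /\
    a + j%:R * del < expR x - 1 < a + j.+1%:R * del.
  have p0 : 0 < a + j%:R * del by rewrite ltr_wpDr// mulr_ge0// ltW.
  have pq : a + j%:R * del < a + j.+1%:R * del by rewrite ltrD2l ltr_pM2r// ltr_nat.
  have [||x Dx /andP[x1 x2]] :=
      @dense_between (ln (1 + (a + j%:R * del))) (ln (1 + (a + j.+1%:R * del))).
  - by rewrite ln_ge0// lerDl ltW.
  - by rewrite ltr_ln ?posrE; lra.
  exists x; split=> //; move: x1 x2.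
  rewrite -[in X in _ -> X -> _](ltr_expR x) -[in X in X -> _ -> _](ltr_expR _ x).
  rewrite !lnK ?posrE; lra.
have [x xP] := choice P.
by exists x, (fun j => expR (x j) - 1) => j; have [] := xP j.
Qed.

End dense.

Section density_tail.
Variables (h : R -> R).
Hypothesis h_density : density01 h.

Let mh : measurable_fun setT (h : TR -> R). Proof. by case: h_density. Qed.
Let h0 u : 0 <= h u. Proof. by case: h_density. Qed.

Lemma density01_tail t :
  \int[lambda]_(u in `]0, 1[) (h u * \1_[set v | t < h v] u) =
  tail_mass U h h t.
Proof.
have E : (fun u => h u * \1_[set v | t < h v] u) = (fun u => h u * (t < h u)%R%:R).
  apply/funext => u; rewrite indicE; congr (_ * (nat_of_bool _)%:R).
  by apply/idP/idP; rewrite inE.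
rewrite E /tail_mass /Rintegral integral_unif01//; apply/measurable_EFinP.
have /measurable_EFinP := measurable_int _ (@tail_mass_integrable R _ TR U h h h0 mh
  (density01_integrable h_density) t).
exact.
Qed.

Lemma tail_mass_density01_le1 t : tail_mass U h h t <= 1.
Proof.
rewrite -(density01_Rintegral h_density).
have iT := @tail_mass_integrable R _ TR U h h h0 mh (density01_integrable h_density) t.
apply: (le_Rintegral measurableT iT (density01_integrable h_density)) => u _.
by rewrite ler_piMr//; case: (t < h u).
Qed.

(** Pointwise, [h - t] is at most [h] on the set where [h] exceeds [t] and at most 0 elsewhere. This
    prevents the limit measure from losing mass at 0. *)
Lemma tail_mass_density01_ge t : 0 <= t -> 1 - t <= tail_mass U h h t.
Proof.
move=> t0; have ih := density01_integrable h_density.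
have iT := @tail_mass_integrable R _ TR U h h h0 mh ih t.
have ic : U.-integrable setT (EFin \o cst t) by exact/bmeas_integrable/bmeas_cst.
rewrite -(density01_Rintegral h_density) -[X in _ - X](Rintegral_cst1 U t).
rewrite -(RintegralB measurableT ih ic).
apply: (le_Rintegral measurableT (integrable_EFinB ih ic) iT) => u _.
by have [ht|ht] := ltP t (h u); rewrite ?mulr1 ?mulr0 ?gerBl// subr_le0.
Qed.

End density_tail.

Section total_mass.
Variable D : set R.
Hypotheses (D_pos : D `<=` `]0, +oo[) (D_dense : `]0, +oo[ `<=` closure D).
Variable M : {measure set (\bar R) -> \bar R}.
Hypotheses (M_pos : M [set y : \bar R | (y <= 0)%E] = 0%E) (M_infty : M [set +oo%E] = 0%E).
Hypothesis M_fin : forall x, D x -> (M `]x%:E, +oo%E[%classic < +oo)%E.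
Hypothesis tails : forall x, D x -> 2 - expR x <= fine (M `]x%:E, +oo%E[%classic) <= 1.

(** Points of [D] between [1 / (n + 2)] and [1 / (n + 1)] decrease to 0; the tails from there
    increase to the mass of the whole half-line and are squeezed between [2 - expR x] and 1. *)
Lemma total_mass1 : M setT = 1%E.
Proof.
have -> : M setT = M `]0%E, +oo%E[%classic.
  rewrite (_ : setT = `]0%E, +oo%E[%classic `|` [set y : \bar R | (y <= 0)%E] `|` [set +oo%E]).
    have mn : measurable [set y : \bar R | (y <= 0)%E].
      by have := @emeasurable_itv R `]-oo, 0%E]; rewrite set_itvE.
    rewrite (measureU0 (measurableU _ _ (emeasurable_itv _) mn) (emeasurable_set1 _) M_infty).
    by rewrite (measureU0 (emeasurable_itv _) mn M_pos).
  apply/seteqP; split=> // y _; have [y0|y0] := leP y 0%E; first by left; right.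
  by have [->|yoo] := eqVneq y +oo%E; [right|left; left; rewrite /= in_itv/= y0 ltey].
have P n : exists x, D x /\ n.+2%:R^-1 < x < n.+1%:R^-1.
  have [||x Dx xn] := @dense_between D D_dense n.+2%:R^-1 n.+1%:R^-1.
  - by rewrite invr_ge0.
  - by rewrite ltf_pV2 ?posrE// ltr_nat.
  by exists x.
have [x xP] := choice P.
pose F n := `](x n)%:E, +oo%E[%classic.
have FU : \bigcup_n F n = `]0%E, +oo%E[%classic.
  apply/seteqP; split=> y.
    move=> [n _]; rewrite /F/= !in_itv/= => /andP[xy ->]; rewrite andbT.
    apply: lt_trans xy; rewrite lte_fin; have [_ /andP[+ _]] := xP n.
    by apply: lt_trans; rewrite invr_gt0.
  rewrite /= in_itv/= => /andP[]; case: y => // y; rewrite lte_fin => y0 _.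
  have y1 := truncnS_gt y^-1; exists (Num.trunc y^-1) => //.
  rewrite /F/= in_itv/= ltry andbT lte_fin.
  have [_ /andP[_]] := xP (Num.trunc y^-1); move/lt_le_trans; apply.
  by rewrite -[leRHS]invrK lef_pV2 ?posrE ?invr_gt0// ltW.
have x_dec : nonincreasing_seq x.
  apply/nonincreasing_seqP => n.
  have [_ /andP[_ h1]] := xP n.+1; have [_ /andP[h2 _]] := xP n.
  exact: ltW (lt_trans h1 h2).
have Fcvg : M \o F @ \oo --> M (\bigcup_n F n).
  apply: nondecreasing_cvg_mu => [n||].
  - exact: emeasurable_itv.
  - by rewrite FU; exact: emeasurable_itv.
  - move=> m n mn; apply/subsetPset => y; rewrite /F/= !in_itv/= => /andP[xy ->].
    rewrite andbT; apply: le_lt_trans xy; rewrite lee_fin; apply: x_dec mn.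
rewrite FU in Fcvg.
suff Fcvg1 : M \o F @ \oo --> 1%E by apply: (cvg_unique _ Fcvg Fcvg1); exact: ereal_hausdorff.
have Ffin n : M (F n) = (fine (M (F n)))%:E.
  rewrite fineK// ge0_fin_numE ?measure_ge0//; apply: M_fin; by have [] := xP n.
rewrite (_ : M \o F = EFin \o (fun n => fine (M (F n)))); last first.
  by apply/funext => n; exact: Ffin.
apply/cvg_EFin; first by near=> n.
have x0 : x n @[n --> \oo] --> (0 : R).
  apply: (@squeeze_cvgr _ _ _ R (fun=> 0) (fun n => n.+1%:R^-1) x).
  - near=> n; have [_ /andP[h1 h2]] := xP n; rewrite (ltW h2) andbT.
    by rewrite ltW// (lt_trans _ h1)// invr_gt0.
  - exact: cvg_cst.
  - exact: cvg_harmonic.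
apply: (@squeeze_cvgr _ _ _ R (fun n => 2 - expR (x n)) (fun=> 1)).
- by near=> n; apply: tails; have [] := xP n.
- have e0 : expR (x n) @[n --> \oo] --> (1 : R).
    by rewrite -expR0; apply: (continuous_cvg _ (@continuous_expR R _) x0).
  rewrite [X in _ --> X](_ : _ = 2 - 1 :> R); last by ring.
  exact: cvgB (cvg_cst _) e0.
- exact: cvg_cst.
Unshelve. all: by end_near. Qed.

End total_mass.
End limit_measure.

Section excess.
Context (R : realType).
Local Notation TR := (measurableTypeR R).
Implicit Types y : R.

(* (excess y)^-1 is the density 1 / (e^y - 1) extended by 0 to y <= 0, since
   0^-1 = 0. *)
Definition excess y : R := Num.max 0 (expR y - 1).

Lemma excess_ge0 y : 0 <= excess y.
Proof. by rewrite /excess le_max lexx. Qed.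

Lemma excess_pos y : 0 < y -> excess y = expR y - 1.
Proof. by move=> y0; rewrite /excess max_r// subr_ge0 ltW// expR_gt1. Qed.

Lemma excess_npos y : y <= 0 -> excess y = 0.
Proof. by move=> y0; rewrite /excess max_l// subr_le0 -expR0 ler_expR. Qed.

Lemma excess_gt0 y : (0 < excess y) = (0 < y).
Proof.
have [y0|y0] := ltP 0 y; first by rewrite excess_pos// subr_gt0 expR_gt1.
by rewrite excess_npos// ltxx.
Qed.

Lemma measurable_excess : measurable_fun setT (excess : TR -> R).
Proof.
apply: measurable_maxr; first exact: measurable_cst.
exact: measurable_funB (@measurable_expR R) (measurable_cst _).
Qed.

Lemma measurable_excessV : measurable_fun setT (fun y : TR => (excess y)^-1).
Proof.
have -> : (fun y => (excess y)^-1) = (fun y => (excess y) `^ (-1)).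
  by apply/funext => y; rewrite powR_inv1// excess_ge0.
exact: (measurableT_comp (measurable_powR _) measurable_excess).
Qed.

Lemma tail_mass_excess (P : probability TR R) x : 0 < x ->
  tail_mass P (fun=> 1) excess (expR x - 1) = fine (P `]x, +oo[%classic).
Proof.
move=> x0; rewrite /tail_mass /Rintegral.
rewrite -(setIT `]x, +oo[%classic) -(integral_indic _ measurableT); last exact: measurable_itv.
congr (fine _); apply: eq_integral => y _; rewrite mul1r indicE; congr (_%:R%:E).
congr nat_of_bool; apply/idP/idP; rewrite inE/= in_itv/= andbT.
  have [y0|y0] := ltP 0 y; first by rewrite excess_pos// ltrD2r ltr_expR.
  by rewrite excess_npos// subr_lt0 -expR0 ltr_expR ltNge (ltW x0).
by move=> xy; rewrite excess_pos ?(lt_trans x0)// ltrD2r ltr_expR.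
Qed.

End excess.

Section mild_limit.
Context (R : realType).
Local Notation TR := (measurableTypeR R).
Local Notation U := (unif01 R).
Variable D : set R.
Hypotheses (D_pos : D `<=` `]0, +oo[) (D_dense : `]0, +oo[ `<=` closure D).
Variables (k : nat -> nat) (h : forall n, 'I_(k n) -> R -> R).
Hypothesis h_density : forall n (i : 'I_(k n)), density01 (h i).
Variable P : probability TR R.
Hypothesis tail_cvg : forall x (e : R), D x -> 0 < e -> \forall n \near \oo,
  forall i : 'I_(k n),
    `|tail_mass U (h i) (h i) (expR x - 1) - fine (P `]x, +oo[%classic)| <= e.

(** The order of choices: a fine mesh, then enough thresholds for the remaining tail of [P] to be
    small, and last the row, so that the finitely many tail masses are close to their limits. No
    choice depends on [i] or [psi]. *)
Lemma mild_ratio_cvg (C e : R) : 0 < e -> \forall n \near \oo,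
  forall (i : 'I_(k n)) psi, mild C psi ->
    `|\int[U]_u (psi (h i u)) - \int[P]_y (psi (excess y) / excess y)| <= e.
Proof.
move=> e0; have [C0|C0] := ltP C 0.
  near=> n => i psi [_ /(_ 1 ler01)]; rewrite mulr1 => /(le_trans (normr_ge0 _)).
  by rewrite leNgt C0.
(* The mesh is the square of [a], so [4 * C * del / a] becomes [4 * C * a]. The step error, the tail
   and the threshold errors then contribute at most [e / 4] each. *)
pose a := Num.min 1 (e / (48 * (C + 1))).
have a0 : 0 < a by rewrite lt_min ltr01/= divr_gt0// mulr_gt0//; lra.
have a1 : a <= 1 by rewrite ge_min lexx.
have aC : C * a <= e / 48.
  apply: (@le_trans _ _ ((C + 1) * (e / (48 * (C + 1))))).
    by rewrite ler_pM// ?(ltW a0)//; [lra|rewrite ge_min lexx orbT].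
  by rewrite le_eqVlt; apply/orP; left; apply/eqP; field; lra.
have d0 : 0 < a * a by exact: mulr_gt0.
have [x [t xt]] := dense_thresholds D_dense a0 d0.
have e1 : 0 < e / (16 * (C + 1)) by rewrite divr_gt0// mulr_gt0//; lra.
have [y [y0 yP]] := probability_tail_cvg0 P e1.
have [n xn] : exists n, y <= x n.
  have y1 : 0 <= expR y / (a * a) by rewrite divr_ge0 ?expR_ge0 ?ltW.
  have := truncnS_gt (expR y / (a * a)); set m := (Num.trunc _).+1 => ym.
  exists m; have [_ tE /andP[tl _]] := xt m.
  rewrite -ler_expR; move: tl; rewrite tE.
  by move: ym; rewrite ltr_pdivrMr//; lra.
pose e' := e / (8 * (C + 1) * n.+2%:R).
have e'0 : 0 < e' by rewrite divr_gt0// !mulr_gt0//; lra.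
have x0 j : 0 < x j by have [/D_pos] := xt j; rewrite /= in_itv/= andbT.
have Dx j : D (x j) by have [] := xt j.
have := @near_all_leq _ n (fun j _ => tail_cvg (Dx j) e'0).
apply: filterS => m tm i psi psiP.
have hd := h_density i; have [mh h0 _ _] := hd.
have i1 : P.-integrable setT (EFin \o (fun=> 1 : R)).
  exact/bmeas_integrable/bmeas_cst.
have tP j : a + j%:R * (a * a) < t j < a + j.+1%:R * (a * a) by have [] := xt j.
have := @mild_ratio_compare R C psi t a (a * a) _ _ TR TR U P (h i) (h i)
  (fun=> 1) (@excess R) n e' psiP a0 d0 tP h0 h0 mh (density01_integrable hd)
  (density01_Rintegral hd) (fun=> ler01) (@excess_ge0 R) (@measurable_excess R) i1
  (Rintegral_cst1 P 1).
have tE j : t j = expR (x j) - 1 by have [] := xt j.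
have tmm j : (j <= n)%N ->
    `|tail_mass U (h i) (h i) (t j) - tail_mass P (fun=> 1) (@excess R) (t j)| <= e'.
  by move=> jn; rewrite tE tail_mass_excess//; exact: tm.
move/(_ tmm); rewrite tE tail_mass_excess//.
have -> : (fun u => h i u * (psi (h i u) / h i u)) = (fun u => psi (h i u)).
  apply/funext => u; have [hu|hu] := eqVneq (h i u) 0.
    rewrite hu mul0r; case: psiP => _ /(_ 0 (lexx _)) + _ _.
    by rewrite mulr0 normr_le0 => /eqP ->.
  by rewrite mulrCA mulfV// mulr1.
under [X in _ - X]eq_Rintegral do rewrite mul1r.
move=> /le_trans; apply.
have C1 : 0 < C + 1 by lra.
have tl : C * fine (P `]x n, +oo[%classic) <= e / 16.
  apply: (@le_trans _ _ ((C + 1) * (e / (16 * (C + 1))))).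
    rewrite ler_pM// ?fine_ge0 ?measure_ge0//; [lra|exact: yP].
  by rewrite le_eqVlt; apply/orP; left; apply/eqP; field; lra.
have n2 : 0 < (n.+2%:R : R) by [].
have el : n.+2%:R * (C * e') <= e / 8.
  apply: (@le_trans _ _ (n.+2%:R * ((C + 1) * e'))).
    by rewrite ler_wpM2l// ler_wpM2r// ?(ltW e'0)//; lra.
  by rewrite le_eqVlt /e'; apply/orP; left; apply/eqP; field; rewrite ?gt_eqF//; lra.
have -> : 4 * C * (a * a) / a = 4 * (C * a) by field; rewrite gt_eqF.
have aa : C * (a * a) <= C * a by rewrite mulrA -[leRHS]mulr1 ler_wpM2l// mulr_ge0// ltW.
rewrite -[n.+2%:R]natr1 in el.
lra.
Unshelve. all: by end_near. Qed.

(** A mild function with values at most 1 on [w >= 0] that equals 1 beyond [t]: a substitute for the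
    indicator of [w > t], used to bound the mass of the Levy measure. *)
Lemma mild_truncation (t : R) : 0 < t ->
  mild (2 / t + (t ^+ 2)^-1) (fun w => (Num.min 1 (w / t)) ^+ 2).
Proof.
move=> t0; have t20 : 0 < t ^+ 2 by exact: exprn_gt0.
have q0 w : 0 <= w -> 0 <= Num.min 1 (w / t).
  by move=> w0; rewrite le_min ler01 divr_ge0// ltW.
have q1 w : Num.min 1 (w / t) <= 1 by rewrite ge_min lexx.
have qw w : Num.min 1 (w / t) <= w / t by rewrite ge_min lexx orbT.
have i0 : 0 < t^-1 by rewrite invr_gt0.
have i20 : 0 < (t ^+ 2)^-1 by rewrite invr_gt0.
split.
- apply: measurable_funX; apply: measurable_minr; first exact: measurable_cst.
  exact: measurable_funM.
- move=> w w0; rewrite ger0_norm ?sqr_ge0//; apply: (@le_trans _ _ (w / t)).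
    by apply: le_trans (qw w); rewrite expr2 ler_piMr// q0.
  have := mulr_ge0 w0 (ltW i0); have := mulr_ge0 w0 (ltW i20); nra.
- move=> w w0; rewrite ger0_norm ?sqr_ge0//; apply: (@le_trans _ _ ((w / t) ^+ 2)).
    by rewrite lerXn2r// nnegrE ?q0// divr_ge0// ltW.
  rewrite expr_div_n mulrC ler_wpM2r ?sqr_ge0// lerDr mulr_ge0//; exact: ltW.
- move=> w v w0 v0; rewrite subr_sqr normrM.
  have h1 : `|Num.min 1 (w / t) - Num.min 1 (v / t)| <= `|w - v| / t.
    have -> : `|w - v| / t = `|w / t - v / t|.
      by rewrite -mulrBl normrM normfV (gtr0_norm t0).
    have n1 := ler_norm (w / t - v / t); have := ler_norm (- (w / t - v / t)).
    rewrite normrN; set N := `|w / t - v / t| in n1 *; rewrite ler_norml /Num.min.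
    by case: ltP => h1; case: ltP => h2; lra.
  have h2 : `|Num.min 1 (w / t) + Num.min 1 (v / t)| <= 2.
    rewrite ger0_norm ?addr_ge0 ?q0//; have := q1 w; have := q1 v; lra.
  have := ler_pM (normr_ge0 _) (normr_ge0 _) h1 h2.
  have := mulr_ge0 (normr_ge0 (w - v)) (ltW i20); nra.
Qed.

Hypothesis k_gt0 : forall n, (0 < k n)%N.

(** The mass that the Levy measure puts on [excess y > t] is at most the limit of integrals of a
    truncation of [h] under the uniform law, each at most 1. One index per row is enough, and
    monotone convergence lets [t] tend to 0. *)
Lemma intensity_le1 : (\int[P]_y ((excess y)^-1)%:E <= 1)%E.
Proof.
pose f n (y : TR) : \bar R := ((excess y)^-1 * (n.+1%:R^-1 < excess y)%R%:R)%:E.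
have mb n : measurable_fun setT (fun y : TR => (n.+1%:R^-1 < excess y)%R%:R : R).
  rewrite (_ : (fun y => _) = fun y => if n.+1%:R^-1 < excess y then 1 else 0 : R).
    apply: measurable_fun_ifT => //; apply: measurable_fun_ltr => //.
    exact: measurable_excess.
  by apply/funext => y; case: (_ < _).
have mf n : measurable_fun setT (f n).
  by apply/measurable_EFinP; apply: measurable_funM => //; exact: measurable_excessV.
have V0 y : 0 <= (excess y)^-1 :> R by rewrite invr_ge0 excess_ge0.
have f0 n y : (0 <= f n y)%E by rewrite lee_fin mulr_ge0.
have flim y : limn (f^~ y) = ((excess y)^-1)%:E.
  apply: cvg_lim => //; apply: cvg_near_cst.
  have [y0|y0] := ltP 0 y; last by near=> n; rewrite /f excess_npos// invr0 mul0r.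
  have y1 := truncnS_gt (excess y)^-1.
  exists (Num.trunc (excess y)^-1) => // n /= Nn; rewrite /f.
  suff -> : n.+1%:R^-1 < excess y by rewrite mulr1.
  rewrite -[ltRHS]invrK ltf_pV2 ?posrE ?invr_gt0 ?excess_gt0//.
  by apply: lt_le_trans y1 _; rewrite ler_nat.
have nd y : setT y -> {homo f^~ y : n m / (n <= m)%N >-> (n <= m)%E}.
  move=> _ n m nm; rewrite lee_fin ler_wpM2l//.
  have [ny|] := ltP n.+1%:R^-1 (excess y); last by rewrite ler0n.
  by rewrite (le_lt_trans _ ny)// lef_pV2 ?posrE// ler_nat ltnS.
have := @cvg_monotone_convergence _ _ _ P setT measurableT f mf (fun n y _ => f0 n y) nd.
under [X in _ --> X]eq_integral do rewrite flim.
move=> fcvg; rewrite -(cvg_lim _ fcvg)//; apply: lime_le; first exact: cvgP fcvg.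
near=> n; set t : R := n.+1%:R^-1.
have t0 : 0 < t by rewrite invr_gt0.
pose psi w : R := (Num.min 1 (w / t)) ^+ 2.
have psiP := mild_truncation t0.
have bpsi : bmeas (fun y : TR => psi (excess y) / excess y).
  split; last by exists (2 / t + (t ^+ 2)^-1) => y; exact: (mild_ratio_le psiP (excess_ge0 y)).
  apply: measurable_funM; last exact: measurable_excessV.
  by case: psiP => mp _ _ _; exact: (measurableT_comp mp (@measurable_excess R)).
apply: (@le_trans _ _ (\int[P]_y (psi (excess y) / excess y)%:E)%E).
  apply: ge0_le_integral => //.
  - by apply/measurable_EFinP; case: bpsi.
  - move=> y _; rewrite lee_fin mulrC ler_wpM2r//.
    have [ty|_] := ltP t (excess y); last by rewrite sqr_ge0.
    by rewrite /psi min_l ?expr1n// ler_pdivlMr// mul1r ltW.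
rewrite -(EFin_Rintegral P bpsi) lee_fin; apply/ler_addgt0Pr => e e0.
have [m _ /(_ m (leqnn m)) /=] := mild_ratio_cvg (2 / t + (t ^+ 2)^-1) e0.
move=> /(_ (Ordinal (k_gt0 m)) psi psiP); set i := Ordinal _ => H.
have [mh h0 _ _] := h_density i.
have bph : bmeas (fun u : TR => psi (h i u)).
  split; first by case: psiP => mp _ _ _; exact: (measurableT_comp mp mh).
  exists 1 => u; rewrite ger0_norm ?sqr_ge0// /psi expr_le1// ?ge_min ?lexx//.
  by rewrite le_min ler01 divr_ge0// ltW.
have : \int[U]_u psi (h i u) <= 1.
  rewrite -(Rintegral_cst1 U 1).
  apply: (le_Rintegral measurableT (bmeas_integrable U bph)).
    exact/bmeas_integrable/bmeas_cst.
  move=> u _; rewrite /psi expr_le1// ?ge_min ?lexx//.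
  by rewrite le_min ler01 divr_ge0// ltW.
by move: H; rewrite ler_norml; lra.
Unshelve. all: by end_near. Qed.

End mild_limit.

(** * Characteristic functions and Levy measures *)

Section elementary_bounds.
Context (R : realType).
Implicit Types x y t : R.

Lemma MVT0 (f df : R -> R) x : (forall y, is_derive y 1 f (df y)) ->
  exists2 y, `|y| <= `|x| & f x - f 0 = df y * x.
Proof.
move=> fdf; have cf : continuous f.
  by move=> y; apply: differentiable_continuous; apply/derivable1_diffP.
have cs a b : {within `[a, b], continuous f} by exact: continuous_subspaceT.
have [x0|x0] := leP 0 x.
  have [y + fy] := MVT_segment x0 (fun y _ => fdf y) (cs 0 x).
  rewrite in_itv/= => /andP[y0 yx]; exists y; last by rewrite fy subr0.
  by rewrite !ger0_norm.
have [y + fy] := MVT_segment (ltW x0) (fun y _ => fdf y) (cs x 0).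
rewrite in_itv/= => /andP[yx y0]; exists y.
  by rewrite !ler0_norm ?(ltW x0)// lerN2.
by rewrite -opprB fy sub0r mulrN opprK.
Qed.

Lemma normr_sin_le x : `|sin x| <= `|x|.
Proof.
have [y _] := @MVT0 sin cos x (fun y => is_derive_sin y).
by rewrite sin0 subr0 => ->; rewrite normrM ler_piMl// cos_max.
Qed.

Lemma normr_cosB1_le x : `|cos x - 1| <= x ^+ 2.
Proof.
have [y yx] := @MVT0 cos (fun x => - sin x) x (fun y => is_derive_cos y).
rewrite cos0 => ->; rewrite normrM normrN -[leRHS]ger0_norm ?sqr_ge0// expr2 normrM.
by rewrite ler_wpM2r// (le_trans (normr_sin_le _)).
Qed.

(** Far from sharp, but quadratic order is enough: in the characteristic function the argument is of
    order [1 / m] and the error is multiplied by [m]. *)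
Lemma normr_sinB_le x : `|sin x - x| <= x ^+ 2.
Proof.
have ds y : is_derive y 1 (fun x => sin x - x) (cos y - 1) by apply: is_deriveB.
have [y yx] := MVT0 x ds.
rewrite sin0 !subr0 => ->; rewrite normrM -[leRHS]ger0_norm ?sqr_ge0// expr2 normrM.
rewrite ler_wpM2r// (le_trans _ yx)//.
have [z _] := @MVT0 cos (fun x => - sin x) y (fun y => is_derive_cos y).
by rewrite cos0 => ->; rewrite normrM normrN ler_piMl// sin_max.
Qed.

Lemma expR_le1Dx2 x : x <= 0 -> expR x <= 1 + x + x ^+ 2.
Proof.
move=> x0; have : expR x * (1 - x) <= 1.
  rewrite -[leRHS](expRxMexpNx_1 x) ler_wpM2l ?expR_ge0//.
  exact: expR_ge1Dx.
have := expR_gt0 x.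
have : 1 <= (1 + x + x ^+ 2) * (1 - x) by nra.
nra.
Qed.

End elementary_bounds.

Section characteristic_function.
Context (R : realType).
Local Notation TR := (measurableTypeR R).
Local Open Scope complex_scope.
Implicit Types (P nu : probability TR R).

Lemma cexpE (a b : R) : cexp (a +i* b) = (expR a * cos b) +i* (expR a * sin b).
Proof. by rewrite /cexp/=; simpc. Qed.

Lemma cexpD (z w : R[i]) : cexp (z + w) = cexp z * cexp w.
Proof.
case: z => a b; case: w => c d.
transitivity (cexp ((a + c) +i* (b + d))) => //.
rewrite !cexpE expRD cosD sinD; apply/eqP; rewrite eq_complex/=.
by apply/andP; split; apply/eqP; ring.
Qed.

Lemma bmeas_cos (t : R) : bmeas (fun x : TR => cos (t * x)).
Proof.
split; last by exists 1 => x; exact: cos_max.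
apply: (@measurableT_comp _ _ _ TR TR TR cos); last exact: measurable_funM.
by apply: continuous_measurable_fun; exact: continuous_cos.
Qed.

Lemma bmeas_sin (t : R) : bmeas (fun x : TR => sin (t * x)).
Proof.
split; last by exists 1 => x; exact: sin_max.
apply: (@measurableT_comp _ _ _ TR TR TR sin); last exact: measurable_funM.
by apply: continuous_measurable_fun; exact: continuous_sin.
Qed.

Lemma char_funE P t : char_fun P t =
  (\int[P]_x cos (t * x)) +i* (\int[P]_x sin (t * x)).
Proof.
rewrite /char_fun /Cintegral; congr (_ +i* _); apply: eq_Rintegral => x _;
by rewrite /cexp/= !(mul0r, mulr0, mul1r, mulr1, subr0, addr0, add0r, expR0, sub0r, oppr0).
Qed.

(** The integrand below is the squared distance of the point on the unit circle to its mean
    [u + i v]; its integral, a variance, equals [1 - u ^ 2 - v ^ 2]. *)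
Lemma char_fun_norm_le1 P t : normc (char_fun P t) <= 1.
Proof.
rewrite char_funE /normc; set u := Rintegral _ _ _; set v := Rintegral _ _ _.
rewrite -[leRHS]sqrtr1 ler_sqrt//.
have bc := bmeas_cos t; have bs := bmeas_sin t.
have : 0 <= \int[P]_x (1 - u * cos (t * x) - v * sin (t * x)
   - (u * cos (t * x) + v * sin (t * x) - (u ^+ 2 + v ^+ 2))).
  apply: Rintegral_ge0 => x _.
  have := cos2Dsin2 (t * x); set c := cos _; set s := sin _ => cs.
  have : 0 <= (c - u) ^+ 2 + (s - v) ^+ 2 by rewrite addr_ge0// sqr_ge0.
  by move: cs; rewrite !expr2; lra.
have bcst (r : R) : bmeas (fun _ : TR => r) by exact: bmeas_cst.
have buc : bmeas (fun x : TR => u * cos (t * x)) by exact: bmeasM.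
have bvs : bmeas (fun x : TR => v * sin (t * x)) by exact: bmeasM.
have b1 := bmeasB (bcst 1) buc.
have b2 := bmeasB b1 bvs.
have b3 := bmeasD buc bvs.
have b4 := bmeasB b3 (bcst (u ^+ 2 + v ^+ 2)).
do 5 (rewrite ?RintegralB ?RintegralD//; try exact: bmeas_integrable).
rewrite !RintegralZl//; try exact: bmeas_integrable.
rewrite !Rintegral_cst1 -/u -/v !expr2; lra.
Qed.

Lemma Rintegral_lincomb P (f g : TR -> R) (a b : R) : bmeas f -> bmeas g ->
  \int[P]_x (a * f x + b * g x) = a * \int[P]_x f x + b * \int[P]_x g x.
Proof.
move=> bf bg; have bcst (r : R) : bmeas (fun _ : TR => r) by exact: bmeas_cst.
rewrite (RintegralD measurableT (bmeas_integrable P (bmeasM (bcst a) bf))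
  (bmeas_integrable P (bmeasM (bcst b) bg))).
by rewrite (RintegralZl _ measurableT (bmeas_integrable P bf))
  (RintegralZl _ measurableT (bmeas_integrable P bg)).
Qed.

Lemma char_cpoissonD nu t a b : 0 <= a -> 0 <= b ->
  char_fun (cpoisson (a + b) nu) t =
  char_fun (cpoisson a nu) t * char_fun (cpoisson b nu) t.
Proof.
move=> a0 b0; rewrite !char_funE.
have bc := bmeas_cos t; have bs := bmeas_sin t.
rewrite -(Rintegral_cpoissonD nu a0 b0 bc) -(Rintegral_cpoissonD nu a0 b0 bs).
set P := cpoisson a nu; set Q := cpoisson b nu.
set uP := \int[P]_x cos _; set vP := \int[P]_x sin _.
set uQ := \int[Q]_x cos _; set vQ := \int[Q]_x sin _.
have EC : \int[P]_x \int[Q]_y cos (t * (x + y)) = uP * uQ - vP * vQ.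
  transitivity (\int[P]_x (uQ * cos (t * x) + (- vQ) * sin (t * x))).
    apply: eq_Rintegral => x _.
    transitivity (\int[Q]_y (cos (t * x) * cos (t * y) + (- sin (t * x)) * sin (t * y))).
      by apply: eq_Rintegral => y _; rewrite mulrDr cosD mulNr.
    by rewrite (Rintegral_lincomb Q _ _ bc bs) -/uQ -/vQ; ring.
  by rewrite (Rintegral_lincomb P _ _ bc bs) -/uP -/vP; ring.
have ES : \int[P]_x \int[Q]_y sin (t * (x + y)) = uP * vQ + vP * uQ.
  transitivity (\int[P]_x (vQ * cos (t * x) + uQ * sin (t * x))).
    apply: eq_Rintegral => x _.
    transitivity (\int[Q]_y (sin (t * x) * cos (t * y) + cos (t * x) * sin (t * y))).
      by apply: eq_Rintegral => y _; rewrite mulrDr sinD.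
    by rewrite (Rintegral_lincomb Q _ _ bc bs) -/uQ -/vQ; ring.
  by rewrite (Rintegral_lincomb P _ _ bc bs) -/uP -/vP; ring.
by rewrite EC ES.
Qed.

Lemma Rintegral_cpoisson0 nu (f : TR -> R) : bmeas f ->
  \int[cpoisson 0 nu]_x f x = f 0.
Proof.
move=> [mf [C fC]]; have H := cpoisson_expansion nu (lexx 0) mf fC.
apply/eqP; rewrite -subr_eq0 -normr_le0.
by move: H; rewrite expr0n mulr0 mul0r subr0.
Qed.

Lemma char_fun_cpoisson0 nu t : char_fun (cpoisson 0 nu) t = 1.
Proof.
rewrite char_funE (Rintegral_cpoisson0 nu (bmeas_cos t)).
by rewrite (Rintegral_cpoisson0 nu (bmeas_sin t)) mulr0 cos0 sin0.
Qed.

Lemma char_cpoissonX nu t a m : 0 <= a ->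
  char_fun (cpoisson (m%:R * a) nu) t = char_fun (cpoisson a nu) t ^+ m.
Proof.
move=> a0; elim: m => [|m ih]; first by rewrite mul0r char_fun_cpoisson0.
by rewrite -natr1 mulrDl mul1r char_cpoissonD ?mulr_ge0// ih exprSr.
Qed.

Lemma normc_le (x y : R) : normc (x +i* y) <= `|x| + `|y|.
Proof.
rewrite /normc -[leRHS]ger0_norm// -sqrtr_sqr ler_sqrt ?sqr_ge0//.
rewrite -[x ^+ 2]real_normK ?num_real// -[y ^+ 2]real_normK ?num_real//.
rewrite sqrrD; have : 0 <= `|x| * `|y| by rewrite mulr_ge0.
lra.
Qed.

Lemma normc_ge0 (z : R[i]) : 0 <= normc z.
Proof. by case: z => a b; rewrite /normc sqrtr_ge0. Qed.

Lemma normc_sub_le (z w : R[i]) : normc (z - w) <= normc z + normc w.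
Proof.
rewrite -[normc w]normcN; exact: (@le_normcD R z (- w)).
Qed.

Lemma normcX_sub (z w : R[i]) m : normc z <= 1 -> normc w <= 1 ->
  normc (z ^+ m - w ^+ m) <= m%:R * normc (z - w).
Proof.
move=> z1 w1; elim: m => [|m ih]; first by rewrite !expr0 subrr normc0 mul0r.
have -> : z ^+ m.+1 - w ^+ m.+1 = z * (z ^+ m - w ^+ m) + (z - w) * w ^+ m.
  by rewrite !exprS; ring.
rewrite (le_trans (le_normcD _ _))// !normcM -natr1 mulrDl mul1r lerD//.
  by rewrite (le_trans _ ih)// ler_piMl// normc_ge0.
rewrite ler_piMr// ?normc_ge0//; elim: m {ih} => [|m ih]; first by rewrite normc1.
by rewrite exprS normcM mulr_ile1// normc_ge0.
Qed.

Lemma cexp_norm_le1 (a b : R) : a <= 0 -> normc (cexp (a +i* b)) <= 1.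
Proof.
move=> a0; rewrite cexpE /normc !exprMn -mulrDr cos2Dsin2 mulr1.
by rewrite sqrtr_sqr ger0_norm ?expR_ge0// expR_le1.
Qed.

Lemma cexpX (z : R[i]) m : cexp (m%:R * z) = cexp z ^+ m.
Proof.
elim: m => [|m ih].
  by rewrite mul0r expr0 -[0]/((0 : R) +i* 0) cexpE expR0 cos0 sin0 mulr1 mulr0.
by rewrite -natr1 mulrDl mul1r cexpD ih exprSr.
Qed.

Lemma cexp_expansion (a b : R) : -1 <= a <= 0 ->
  normc (cexp (a +i* b) - ((1 + a) +i* b)) <= 2 * (a ^+ 2 + b ^+ 2 + `|a| * `|b|).
Proof.
move=> /andP[a1 a0]; rewrite cexpE.
set e := expR a; have e1 : e <= 1 by rewrite /e -expR0 ler_expR.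
have ea : `|e - 1 - a| <= a ^+ 2.
  rewrite ler_norml; have := expR_ge1Dx a; have := expR_le1Dx2 a0.
  have := sqr_ge0 a; rewrite -/e; lra.
have e0 : 0 <= e by exact: expR_ge0.
have eb : `|e - 1| <= `|a|.
  rewrite ler0_norm ?subr_le0// ler0_norm//; have := expR_ge1Dx a; rewrite -/e; lra.
apply: le_trans (normc_le (e * cos b - (1 + a)) (e * sin b - b)) _.
have -> : e * cos b - (1 + a) = e * (cos b - 1) + (e - 1 - a) by ring.
have -> : e * sin b - b = e * (sin b - b) + (e - 1) * b by ring.
have h1 : `|e * (cos b - 1) + (e - 1 - a)| <= b ^+ 2 + a ^+ 2.
  rewrite (le_trans (ler_normD _ _))// lerD// normrM -[leRHS]mul1r ler_pM//.
    by rewrite ger0_norm.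
  exact: normr_cosB1_le.
have h2 : `|e * (sin b - b) + (e - 1) * b| <= b ^+ 2 + `|a| * `|b|.
  rewrite (le_trans (ler_normD _ _))// lerD// normrM; last by rewrite ler_pM.
  rewrite -[leRHS]mul1r ler_pM//; first by rewrite ger0_norm.
  exact: normr_sinB_le.
have := sqr_ge0 a; have : 0 <= `|a| * `|b| by rewrite mulr_ge0.
lra.
Qed.

(* Both sides are m-th powers of complex numbers of modulus at most 1 which
   differ by O(1/m^2). *)
Lemma char_cpoisson c nu t : 0 <= c ->
  char_fun (cpoisson c nu) t =
  cexp ((c * (\int[nu]_x cos (t * x) - 1)) +i* (c * \int[nu]_x sin (t * x))).
Proof.
move=> c0; set p := \int[nu]_x cos _; set q := \int[nu]_x sin _.
have p1 : `|p| <= 1.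
  by apply: Rintegral_norm_le (bmeas_integrable nu (bmeas_cos t)) _ => x; exact: cos_max.
have q1 : `|q| <= 1.
  by apply: Rintegral_norm_le (bmeas_integrable nu (bmeas_sin t)) _ => x; exact: sin_max.
move: (p1); rewrite ler_norml => /andP[pl pu].
apply/eqP; rewrite -subr_eq0; apply/eqP; apply: eq0_normc.
apply/eqP; rewrite eq_le normc_ge0 andbT.
set z : R[i] := _ - _.
(* The condition [2 * c <= m] puts the real part of the exponent in [[-1, 0]]. The constant 30
   leaves room above the errors [6 * s ^ 2] and [20 * s ^ 2] of the two expansions. *)
have key m : (0 < m)%N -> 2 * c <= m%:R -> normc z <= 30 * c ^+ 2 / m%:R.
  move=> m0 cm; have m0' : 0 < m%:R :> R by rewrite ltr0n.
  pose s := c / m%:R; have s0 : 0 <= s by rewrite divr_ge0// ltW.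
  have s1 : 2 * s <= 1 by rewrite /s mulrA ler_pdivrMr// mul1r.
  have cE : c = m%:R * s by rewrite /s mulrC divfK// gt_eqF.
  have -> : z = char_fun (cpoisson s nu) t ^+ m -
      cexp ((s * (p - 1)) +i* (s * q)) ^+ m.
    rewrite -char_cpoissonX// -cexpX -cE /z; congr (_ - cexp _).
    apply/eqP; rewrite eq_complex/= cE.
    have -> : (m%:R : R[i]) = (m%:R : R) +i* 0 by rewrite -[RHS]/((m%:R : R)%:C) rmorph_nat.
    by rewrite /= !mul0r subr0 addr0 !mulrA !eqxx.
  apply: le_trans (normcX_sub m (char_fun_norm_le1 _ _) (cexp_norm_le1 _ _)) _.
    by rewrite mulr_ge0_le0// subr_le0.
  set w := (s * (p - 1)) +i* (s * q).
  pose w1 := (1 + s * (p - 1)) +i* (s * q).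
  have D1 : normc (char_fun (cpoisson s nu) t - w1) <= 6 * s ^+ 2.
    rewrite char_funE; apply: le_trans (normc_le _ _) _.
    have := cpoisson_expansion nu s0 (bmeas_cos t).1 (fun x => cos_max _).
    have := cpoisson_expansion nu s0 (bmeas_sin t).1 (fun x => sin_max _).
    rewrite !mulr0 sin0 cos0 !subr0 -/p -/q -addrA -opprD mulr1; lra.
  have D2 : normc (cexp w - w1) <= 20 * s ^+ 2.
    apply: le_trans (cexp_expansion _ _) _.
      by apply/andP; split; nra.
    have a2 : `|s * (p - 1)| <= 2 * s.
      by rewrite ler_norml; apply/andP; split; nra.
    have b2 : `|s * q| <= s by rewrite normrM ger0_norm// ler_piMr.
    have -> : (s * (p - 1)) ^+ 2 = `|s * (p - 1)| ^+ 2.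
      by rewrite real_normK// num_real.
    have -> : (s * q) ^+ 2 = `|s * q| ^+ 2 by rewrite real_normK// num_real.
    move: (normr_ge0 (s * (p - 1))) (normr_ge0 (s * q)) a2 b2.
    move: `|_| `|_| => a b; nra.
  have -> : 30 * c ^+ 2 / m%:R = m%:R * (30 * s ^+ 2).
    by rewrite /s; field; rewrite gt_eqF.
  apply: ler_wpM2l; first exact: ltW.
  have -> : char_fun (cpoisson s nu) t - cexp w =
      (char_fun (cpoisson s nu) t - w1) - (cexp w - w1) by ring.
  apply: le_trans (normc_sub_le _ _) _.
  have := sqr_ge0 s; lra.
rewrite leNgt; apply/negP => z0.
pose m := (Num.truncn (30 * c ^+ 2 / normc z + 2 * c)).+1.
have mlt : 30 * c ^+ 2 / normc z + 2 * c < m%:R by exact: truncnS_gt.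
have z1 : 0 <= 30 * c ^+ 2 / normc z by rewrite divr_ge0 ?mulr_ge0 ?sqr_ge0// ltW.
have := key m isT; rewrite ler_pdivlMr ?ltr0n//.
have : 30 * c ^+ 2 < normc z * (m%:R - 2 * c).
  by rewrite [ltRHS]mulrC -ltr_pdivrMr// ltrBrDr.
move=> H1 H2; have {}H2 : normc z * m%:R <= 30 * c ^+ 2.
  by apply: H2; lra.
nra.
Qed.

Lemma Rintegral_proportional (eta : {measure set TR -> \bar R}) c nu
    (f : TR -> R) : 0 <= c ->
  (forall A, measurable A -> eta A = (c%:E * nu A)%E) -> bmeas f ->
  \int[eta]_x f x = c * \int[nu]_x f x.
Proof.
move=> c0 etaE bf.
have etaT : eta setT = c%:E.
  by have /= E := probability_setT nu; rewrite etaE// E mule1.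
have ie (g : TR -> R) : bmeas g -> eta.-integrable setT (EFin \o g).
  move=> [mg [K gK]]; apply: measurable_bounded_integrable => //.
    by rewrite etaT ltry.
  exists K; split; first exact: num_real.
  by move=> x Kx y _ /=; rewrite (le_trans (gK y))// ltW.
have ge0E (g : TR -> R) : bmeas g -> (forall x, 0 <= g x) ->
    \int[eta]_x g x = c * \int[nu]_x g x.
  move=> bg g0; rewrite -[RHS]/(fine (c * \int[nu]_x g x)%:E) EFinM EFin_Rintegral//.
  congr fine; transitivity (\int[mscale (NngNum c0) nu]_x (g x)%:E)%E.
    by apply: eq_measure_integral => A mA _; exact: etaE.
  rewrite ge0_integral_mscale//; first by apply/measurable_EFinP; case: bg.
  by move=> x _; rewrite lee_fin.
have [mf [C fC]] := bf; have bC : bmeas (fun _ : TR => C) by exact: bmeas_cst.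
have := ge0E (fun x => f x + C) (bmeasD bf bC).
rewrite (RintegralD measurableT (ie _ bf) (ie _ bC)).
rewrite (RintegralD measurableT (bmeas_integrable nu bf) (bmeas_integrable nu bC)).
rewrite Rintegral_cst1 Rintegral_cst// etaT/= mulrDr [C * c]mulrC => H.
apply: (addIr (c * C)); apply: H => x.
by rewrite -lerBlDr sub0r; have := fC x; rewrite ler_norml => /andP[].
Qed.

Lemma bmeas_continuous (f : TR -> R) C : continuous (f : R -> R) ->
  (forall x, `|f x| <= C) -> bmeas f.
Proof. by move=> cf fC; split; [exact: continuous_measurable_fun|exists C]. Qed.

Lemma bmeas_levy_drift : bmeas (fun x : TR => x / (1 + x ^+ 2)).
Proof.
have d0 (x : R) : 0 < 1 + x ^+ 2 by have := sqr_ge0 x; lra.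
apply: (@bmeas_continuous _ 1) => [x|x].
  apply: cvgM; first exact: cvg_id.
  apply: cvgV; first by rewrite gt_eqF.
  by apply: cvgD; [exact: cvg_cst|exact: exprn_continuous].
rewrite normrM normfV [X in _ / X]ger0_norm ?(ltW (d0 _))// ler_pdivrMr// mul1r.
rewrite -[x ^+ 2]real_normK ?num_real//; have := sqr_ge0 (`|x| - 1).
by rewrite sqrrB mulr1; have := normr_ge0 x; lra.
Qed.

(** For a finite Levy measure the exponent is the integral of [e^(i t x) - 1] minus [i t b];
    inserting the compensator [x / (1 + x ^ 2)] moves its integral into the linear coefficient. All
    integrands vanish at 0, so the origin may be left out. *)
Lemma shifted_cpoisson_LK_triplet b c nu
    (eta : {measure set TR -> \bar R}) : 0 <= c ->
  (forall A, measurable A -> eta A = (c%:E * nu A)%E) ->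
  eta [set 0] = 0%E ->
  LK_triplet (shifted_cpoisson b c nu)
    (\int[eta]_x (x / (1 + x ^+ 2)) - b) 0 eta.
Proof.
move=> c0 etaE eta0; have bJ := bmeas_levy_drift.
have propE := Rintegral_proportional c0 etaE.
have int0 (f : TR -> R) : bmeas f -> f 0 = 0 ->
    \int[eta]_(x in [set~ 0]) f x = c * \int[nu]_x f x.
  move=> bf f0; rewrite -(propE _ bf) Rintegral_mkcond; apply: eq_Rintegral => x _.
  rewrite patchE; case: ifPn => //; rewrite notin_setE/= => /contrapT -> //.
split=> //.
  apply: (@le_lt_trans _ _ (\int[eta]_x 1%:E)%E).
    apply: (@le_trans _ _ (\int[eta]_(x in [set~ 0%R]) 1%:E)%E).
      apply: ge0_le_integral => //.
      - exact: measurableC.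
      - by move=> x _; rewrite lee_fin le_min sqr_ge0 ler01.
      - apply/measurable_EFinP/measurable_funTS.
        by apply: measurable_minr => //; exact: exprn_measurable.
      - by move=> x _; rewrite lee_fin ge_min lexx orbT.
    apply: ge0_subset_integral => //; exact: measurableC.
  rewrite integral_cst// mul1e etaE//.
  by have /= -> := probability_setT nu; rewrite mule1 ltry.
move=> t; set p := \int[nu]_x cos (t * x); set q := \int[nu]_x sin (t * x).
have bc := bmeas_cos t; have bs := bmeas_sin t.
have bcst (r : R) : bmeas (fun _ : TR => r) by exact: bmeas_cst.
have -> : char_fun (shifted_cpoisson b c nu) t =
    cexp (0 +i* (- (t * b))) * char_fun (cpoisson c nu) t.
  rewrite !char_funE cexpE expR0 !mul1r cosN sinN.
  rewrite (Rintegral_shifted_cpoisson b c nu bc) (Rintegral_shifted_cpoisson b c nu bs).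
  set P := cpoisson c nu.
  have -> : \int[P]_x cos (t * (x - b)) =
      cos (t * b) * \int[P]_x cos (t * x) + sin (t * b) * \int[P]_x sin (t * x).
    rewrite -(Rintegral_lincomb P _ _ bc bs); apply: eq_Rintegral => x _.
    by rewrite mulrBr cosB; ring.
  have -> : \int[P]_x sin (t * (x - b)) =
      - sin (t * b) * \int[P]_x cos (t * x) + cos (t * b) * \int[P]_x sin (t * x).
    rewrite -(Rintegral_lincomb P _ _ bc bs); apply: eq_Rintegral => x _.
    by rewrite mulrBr sinB; ring.
  by apply/eqP; rewrite eq_complex/=; apply/andP; split; apply/eqP; ring.
rewrite char_cpoisson// -cexpD -/p -/q (propE _ bJ).
set J := \int[nu]_x _.
have bjt : bmeas (fun x : TR => t * (x / (1 + x ^+ 2))) by exact: bmeasM.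
have CE : Cintegral eta [set~ 0] (fun x =>
    cexp ('i * (t * x)%:C) - 1 - 'i * (t * x / (1 + x ^+ 2))%:C) =
    (c * (p - 1)) +i* (c * (q - t * J)).
  rewrite /Cintegral; congr (_ +i* _).
    transitivity (\int[eta]_(x in [set~ 0]) (cos (t * x) - 1)).
      apply: eq_Rintegral => x _; rewrite /cexp/=.
      by rewrite !(mul0r, mulr0, mul1r, mulr1, subr0, addr0, add0r, expR0, sub0r, oppr0).
    rewrite (int0 _ (bmeasB bc (bcst 1))); last by rewrite mulr0 cos0 subrr.
    rewrite (RintegralB measurableT (bmeas_integrable nu bc) (bmeas_integrable nu (bcst 1))).
    by rewrite Rintegral_cst1.
  transitivity (\int[eta]_(x in [set~ 0]) (sin (t * x) - t * (x / (1 + x ^+ 2)))).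
    apply: eq_Rintegral => x _; rewrite /cexp/=.
    by rewrite !(mul0r, mulr0, mul1r, mulr1, subr0, addr0, add0r, expR0, sub0r, oppr0) mulrA.
  rewrite (int0 _ (bmeasB bs bjt)); last by rewrite mulr0 sin0 mul0r mulr0 subrr.
  rewrite (RintegralB measurableT (bmeas_integrable nu bs) (bmeas_integrable nu bjt)).
  by rewrite (RintegralZl _ measurableT (bmeas_integrable nu bJ)).
rewrite CE; congr cexp; apply/eqP; rewrite eq_complex/=.
by apply/andP; split; apply/eqP; ring.
Qed.

End characteristic_function.

Lemma ge0_integral_scaled_density d (T : measurableType d) (R : realType)
    (P Q : probability T R) (q : T -> R) (c : {nonneg R}) (f : T -> \bar R) :
  0 < c%:num -> (forall x, 0 <= q x) -> measurable_fun setT q ->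
  has_density P Q (fun x => q x / c%:num) ->
  measurable_fun setT f -> (forall x, 0 <= f x)%E ->
  (\int[mscale c Q]_x f x = \int[P]_x (f x * (q x)%:E))%E.
Proof.
move=> c0 q0 mq dQ mf f0; rewrite (ge0_integral_mscale Q measurableT c mf (fun x _ => f0 x)).
rewrite (ge0_integral_density dQ mf f0).
rewrite -(ge0_integralZl _ measurableT).
- apply: eq_integral => x _; rewrite muleCA -EFinM; congr (_ * _%:E)%E.
  by rewrite mulrC divfK// gt_eqF.
- apply: emeasurable_funM => //; apply/measurable_EFinP; apply: measurable_funM => //.
- by move=> x _; rewrite mule_ge0// lee_fin divr_ge0.
- by rewrite lee_fin.
Qed.

(** * The Levy measures built from the limit law *)

Section levy_data.
Context (R : realType).
Local Notation TR := (measurableTypeR R).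
Variable P : probability TR R.
Hypothesis P_npos : P `]-oo, 0]%classic = 0%E.
Hypothesis P_intensity : (\int[P]_y ((excess y)^-1)%:E <= 1)%E.

Local Notation q := (fun y : TR => (excess y)^-1).

Let q0 y : 0 <= q y. Proof. by rewrite invr_ge0 excess_ge0. Qed.
Let mq := @measurable_excessV R.

Lemma ae_gt0 : {ae P, forall y : TR, 0 < y}.
Proof.
exists `]-oo, 0]%classic; split; [exact: measurable_itv|exact: P_npos|].
by move=> y /= /negP; rewrite in_itv/= -leNgt.
Qed.

Lemma intensity_integrable : P.-integrable setT (EFin \o q).
Proof.
apply/integrableP; split; first exact/measurable_EFinP.
under eq_integral do rewrite gee0_abs ?lee_fin//.
by apply: le_lt_trans P_intensity _; rewrite ltry.
Qed.

Definition intensity : R := \int[P]_y q y.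

Lemma intensityE : (\int[P]_y (q y)%:E = intensity%:E)%E.
Proof.
rewrite /intensity fineK//.
exact: (integrable_fin_num measurableT intensity_integrable).
Qed.

Lemma intensity_gt0 : 0 < intensity.
Proof.
rewrite lt_neqAle Rintegral_ge0// andbT eq_sym; apply/eqP => c0.
have := intensityE; rewrite c0 => i0.
have mEq : measurable_fun setT (EFin \o q) by exact/measurable_EFinP.
have /(ae_eq_integral_abs P measurableT mEq) : (\int[P]_y `|(EFin \o q) y| = 0)%E.
  by rewrite -[RHS]i0; apply: eq_integral => y _ /=; rewrite ger0_norm.
move=> qae; have : {ae P, forall y : TR, False}.
  apply: filterS2 ae_gt0 qae => y y0 /(_ I) /= [/eqP].
  by rewrite invr_eq0 gt_eqF// excess_gt0.
move=> [A [mA A0 AT]]; have /= := @probability_setT _ _ _ P.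
rewrite (_ : setT = A) ?A0; last by apply/seteqP; split=> // y _; exact: AT.
by move/eqP; rewrite eq_sym onee_eq0.
Qed.

(** From [e^y / (e^y - 1) = 1 / (e^y - 1) + 1]: tilting adds exactly the total mass 1 of [P]. *)
Lemma tilted_intensityE :
  (\int[P]_y (expR y * q y)%:E = (intensity + 1)%:E)%E.
Proof.
have mE : measurable_fun setT (fun y : TR => (expR y * q y)%:E).
  by apply/measurable_EFinP; exact: measurable_funM (@measurable_expR R) mq.
have h1 : (1%:E = \int[P]_y cst 1%E y :> \bar R)%E.
  by rewrite (integral_cst P measurableT); have /= -> := probability_setT P; rewrite mule1.
rewrite EFinD -intensityE h1.
rewrite -(ge0_integralD P measurableT) //; last exact/measurable_EFinP.
  apply: ge0_ae_eq_integral => //.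
  - by apply: emeasurable_funD => //; exact/measurable_EFinP.
  - by move=> y _; rewrite lee_fin mulr_ge0// expR_ge0.
  - by move=> y _; rewrite adde_ge0// lee_fin.
  apply: filterS ae_gt0 => y y0 _ /=; rewrite -EFinD; congr _%:E.
  have e0 : expR y - 1 != 0 by rewrite -excess_pos// gt_eqF// excess_gt0.
  by rewrite excess_pos//; field.
by move=> y _; rewrite lee_fin.
Qed.

Lemma levy_data : exists nu nu2 : probability TR R,
  has_density P nu (fun y => q y / intensity) /\
  has_density P nu2 (fun y => expR y * q y / (intensity + 1)).
Proof.
have c0 := intensity_gt0; have c20 : 0 < intensity + 1 by rewrite addr_gt0.
have mk (f : TR -> R) (a : R) : 0 < a -> measurable_fun setT f ->
    (forall y, 0 <= f y) -> (\int[P]_y (f y)%:E = a%:E)%E ->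
    exists Q : probability TR R, has_density P Q (fun y => f y / a).
  move=> a0 mf f0 fa; apply: density_probability.
  - exact: measurable_funM.
  - by move=> y; rewrite divr_ge0// ltW.
  - transitivity (\int[P]_y ((f y)%:E * (a^-1)%:E))%E; first exact: eq_integral.
    rewrite ge0_integralZr//; last 3 first.
    + exact/measurable_EFinP.
    + by move=> y _; rewrite lee_fin.
    + by rewrite lee_fin invr_ge0 ltW.
    by rewrite fa -EFinM mulfV// gt_eqF.
have [nu nuP] := mk _ _ c0 mq q0 intensityE.
have [||nu2 nu2P] := mk _ _ c20 _ _ tilted_intensityE.
- exact: measurable_funM (@measurable_expR R) mq.
- by move=> y; rewrite mulr_ge0// expR_ge0.
by exists nu, nu2.
Qed.

End levy_data.

Lemma log_increment_mild (R : realType) (C : R) f f1 x :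
  test_pair C f f1 -> mild (3 * C) (log_increment f f1 x).
Proof.
move=> ff1; have C0 := test_pair_ge0 ff1; split.
- by apply: measurable_log_increment; case: ff1.
- by move=> w; exact: (log_increment_le ff1 x).
- move=> w w0; apply: le_trans (log_increment_le_sqr ff1 x w0) _.
  by rewrite ler_wpM2r ?sqr_ge0//; lra.
- by move=> w v; exact: (log_increment_lipschitz ff1 x).
Qed.

Section positive_part.
Context (R : realType).
Local Notation TR := (measurableTypeR R).
Local Notation pos := (`]0%R, +oo[%classic : set TR).

(** Truncated at 0 so that the formulas for nonnegative integrands apply; the Levy measures do not
    charge the negative half-line, so integrals are unchanged. *)
Definition pos_drift (x : TR) : R := Num.max 0 (x / (1 + x ^+ 2)).

Lemma pos_drift_ge0 x : 0 <= pos_drift x.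
Proof. by rewrite le_max lexx. Qed.

Lemma pos_driftE (x : TR) : 0 < x -> pos_drift x = x / (1 + x ^+ 2).
Proof.
by move=> x0; rewrite /pos_drift max_r// divr_ge0 ?addr_ge0 ?sqr_ge0// ltW.
Qed.

Lemma pos_drift_npos (x : TR) : x <= 0 -> pos_drift x = 0.
Proof.
by move=> x0; rewrite /pos_drift max_l// mulr_le0_ge0// invr_ge0 addr_ge0// sqr_ge0.
Qed.

Lemma measurable_pos_drift : measurable_fun setT pos_drift.
Proof.
have [mJ _] := bmeas_levy_drift R.
by apply: measurable_maxr mJ; exact: measurable_cst.
Qed.

Lemma bmeas_pos_drift : bmeas pos_drift.
Proof.
split; first exact: measurable_pos_drift.
have [_ [C JC]] := bmeas_levy_drift R; have C0 : 0 <= C by apply: le_trans (JC 0).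
exists C => x; have [x0|x0] := ltP 0 x; first by rewrite pos_driftE.
by rewrite pos_drift_npos// normr0.
Qed.

Lemma integral_pos (mu : {measure set TR -> \bar R}) (f g : TR -> R) :
  (forall x, 0 < x -> f x = g x) -> (forall x, x <= 0 -> g x = 0) ->
  (\int[mu]_(x in pos) (f x)%:E = \int[mu]_x (g x)%:E)%E.
Proof.
move=> fg g0; rewrite integral_mkcond; apply: eq_integral => x _.
rewrite patchE; case: ifPn; first by rewrite inE/= in_itv/= andbT => /fg ->.
by rewrite notin_setE/= in_itv/= andbT => /negP; rewrite -leNgt => /g0 ->.
Qed.

Lemma integral_levy_drift (Q : probability TR R) (a : {nonneg R}) :
  Q `]-oo, 0]%classic = 0%E ->
  (\int[mscale a Q]_x (pos_drift x)%:E =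
   (\int[mscale a Q]_x (x / (1 + x ^+ 2))%R)%:E)%E.
Proof.
move=> Q0; have bJ := bmeas_levy_drift R.
rewrite (@Rintegral_proportional _ (mscale a Q) a%:num Q)//.
have -> : \int[Q]_x (x / (1 + x ^+ 2)) = \int[Q]_x pos_drift x.
  apply: Rintegral_ae_eq; [by case: bJ|exact: measurable_pos_drift|].
  apply: negligibleS (ae_gt0 Q0) => x /=; apply: contra_not => x0.
  by rewrite pos_driftE.
rewrite EFinM (EFin_Rintegral Q bmeas_pos_drift).
apply: (ge0_integral_mscale Q measurableT).
- by apply/measurable_EFinP; exact: measurable_pos_drift.
- by move=> x _; rewrite lee_fin pos_drift_ge0.
Qed.

End positive_part.

Section levy_consequences.
Context (R : realType).
Local Notation TR := (measurableTypeR R).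
Variables P nu nu2 : probability TR R.
Hypothesis P_npos : P `]-oo, 0]%classic = 0%E.
Hypothesis P_intensity : (\int[P]_y ((excess y)^-1)%:E <= 1)%E.
Local Notation q := (fun y : TR => (excess y)^-1).
Local Notation c := (intensity P).
Hypothesis dnu : has_density P nu (fun y => q y / c).
Hypothesis dnu2 : has_density P nu2 (fun y => expR y * q y / (c + 1)).

Let q0 y : 0 <= q y. Proof. by rewrite invr_ge0 excess_ge0. Qed.
Let mq := @measurable_excessV R.
Let c_gt0 := intensity_gt0 P_npos P_intensity.
Let c2_gt0 : 0 < c + 1. Proof. by rewrite addr_gt0. Qed.

(** At [w = e^y - 1] the step [ln (1 + w)] is [y]. After division by [e^y - 1] the linear term is
    the constant [f1 x], and the mass 1 of [P] turns it into a drift of exactly 1. *)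
Lemma generator_levy C f f1 x : test_pair C f f1 ->
  generator 1 c nu f f1 x =
  \int[P]_y (log_increment f f1 x (excess y) / excess y).
Proof.
move=> ff1; have [mf fC _ _ _] := ff1.
have bfx : bmeas (fun y : TR => f (x + y)).
  by apply: (bmeas_translate x (test_pair_bmeas ff1)); exact: measurable_id.
have bd : bmeas (fun y : TR => f (x + y) - f x).
  by apply: bmeasB => //; exact: bmeas_cst.
have id : P.-integrable setT (EFin \o (fun y : TR => (f (x + y) - f x) * q y)).
  apply: (@integrable_dominated _ TR R P _ (fun y => (C + C) * q y)).
  - by apply: measurable_funM => //; case: bd.
  - exact: integrable_EFinZ (intensity_integrable P_intensity).
  move=> y; rewrite normrM (ger0_norm (q0 y)) ler_wpM2r//.
  by apply: le_trans (ler_normB _ _) _; rewrite lerD.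
have i1 : P.-integrable setT (EFin \o (fun=> f1 x : R)).
  exact/bmeas_integrable/bmeas_cst.
rewrite /generator mul1r.
have -> : c * (\int[nu]_y f (x + y) - f x) = \int[P]_y ((f (x + y) - f x) * q y).
  have -> : \int[nu]_y f (x + y) - f x = \int[nu]_y (f (x + y) - f x).
    have bc := bmeas_cst TR (f x).
    rewrite (RintegralB measurableT (bmeas_integrable nu bfx) (bmeas_integrable nu bc)).
    by rewrite Rintegral_cst1.
  rewrite (Rintegral_density dnu); last by case: bd.
  under eq_Rintegral do rewrite mulrA.
  by rewrite (RintegralZr _ measurableT id) mulrCA mulfV ?mulr1// gt_eqF.
rewrite -[X in _ - X](Rintegral_cst1 P) -(RintegralB measurableT id i1).
have mL : measurable_fun setT (log_increment f f1 x).
  exact: measurable_log_increment.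
apply: Rintegral_ae_eq.
- by apply: measurable_funB; [have /measurable_EFinP := measurable_int _ id|exact: measurable_cst].
- apply: measurable_funM => //; exact: (measurableT_comp mL (@measurable_excess R)).
apply: negligibleS (ae_gt0 P_npos) => y /=; apply: contra_not => y0.
have e0 : excess y != 0 by rewrite gt_eqF// excess_gt0.
have -> : log_increment f f1 x (excess y) = f (x + y) - f x - excess y * f1 x.
  by rewrite /log_increment excess_pos// addrCA subrr addr0 expRK.
by field.
Qed.

Let c_nng : {nonneg R} := NngNum (ltW c_gt0).
Let c2_nng : {nonneg R} := NngNum (ltW c2_gt0).

Definition levy_measure : {measure set TR -> \bar R} := mscale c_nng nu.
Definition tilted_levy_measure : {measure set TR -> \bar R} := mscale c2_nng nu2.

Let ge0_levy (f : TR -> \bar R) : measurable_fun setT f -> (forall x, 0 <= f x)%E ->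
  (\int[levy_measure]_x f x = \int[P]_x (f x * (q x)%:E))%E.
Proof.
by move=> mf f0; apply: ge0_integral_scaled_density.
Qed.

Let ge0_tilted (f : TR -> \bar R) : measurable_fun setT f -> (forall x, 0 <= f x)%E ->
  (\int[tilted_levy_measure]_x f x = \int[P]_x (f x * (expR x * q x)%:E))%E.
Proof.
move=> mf f0; apply: ge0_integral_scaled_density => //.
- by move=> x; rewrite mulr_ge0// expR_ge0.
- exact: measurable_funM (@measurable_expR R) mq.
Qed.

Lemma ge0_integral_tilted_levy (f : TR -> \bar R) : measurable_fun setT f ->
  (forall x, 0 <= f x)%E ->
  (\int[tilted_levy_measure]_x f x = \int[levy_measure]_x (f x * (expR x)%:E))%E.
Proof.
move=> mf f0; rewrite ge0_tilted// ge0_levy.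
- by apply: eq_integral => x _; rewrite -muleA -EFinM.
- by apply: emeasurable_funM => //; apply/measurable_EFinP; exact: measurable_expR.
- by move=> x; rewrite mule_ge0// lee_fin expR_ge0.
Qed.

(** Tilting multiplies the mass of the compound Poisson law by [expR (c + 1 - c) = e], and the shift
    by -1 contributes the inverse factor. The exponential of the limit under the noise thus has mean
    1, and no mass escapes to +oo. *)
Lemma Rintegral_tilted_cpoisson (f : TR -> R) : measurable_fun setT f ->
  \int[shifted_cpoisson 1 (c + 1) nu2]_x f x =
  \int[shifted_cpoisson 1 c nu]_x (f x * expR x).
Proof.
apply: Rintegral_change_of_measure => [x|g mg g0]; first exact: expR_ge0.
have me : measurable_fun setT (fun x : TR => (expR x)%:E : \bar R).
  by apply/measurable_EFinP; exact: measurable_expR.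
have ms : measurable_fun setT (fun x : TR => x - 1 : TR) by exact: measurable_funB.
have mg1 : measurable_fun setT (fun x : TR => g (x - 1)) by exact: (measurableT_comp mg ms).
have tilt (g' : TR -> \bar R) : measurable_fun setT g' -> (forall x, 0 <= g' x)%E ->
    (c%:E * \int[nu]_x (g' x * (expR x)%:E) = (c + 1)%:E * \int[nu2]_x g' x)%E.
  move=> mg' g0'; have := ge0_integral_tilted_levy mg' g0'.
  rewrite /levy_measure /tilted_levy_measure.
  rewrite (ge0_integral_mscale nu2 measurableT c2_nng mg' (fun x _ => g0' x)) => ->.
  rewrite (ge0_integral_mscale nu measurableT c_nng)//; first exact: emeasurable_funM.
  by move=> x _; rewrite mule_ge0// lee_fin expR_ge0.
have mge := emeasurable_funM mg me.
have ge0 x : (0 <= g x * (expR x)%:E)%E by rewrite mule_ge0// lee_fin expR_ge0.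
rewrite (ge0_integral_shifted_cpoisson 1 (c + 1) nu2 mg g0).
rewrite (ge0_integral_shifted_cpoisson 1 c nu mge ge0).
pose g1 (x : TR) : \bar R := (g (x - 1)%R * (expR (-1)%R)%:E)%E.
transitivity (\int[cpoisson c nu]_x (g1 x * (expR x)%:E))%E; last first.
  apply: eq_integral => x _; rewrite /g1 -muleA -EFinM -expRD; congr (_ * (expR _)%:E)%E.
  by rewrite addrC.
rewrite (@tilt_cpoisson _ c (c + 1) nu nu2 g1 (ltW c_gt0) (ltW c2_gt0) tilt).
- rewrite (_ : c + 1 - c = 1); last by ring.
  rewrite -(ge0_integralZl _ measurableT).
  + apply: eq_integral => x _; rewrite /g1 muleCA -EFinM -expRD subrr expR0.
    by rewrite mule1.
  + exact: emeasurable_funM.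
  + by move=> x _; rewrite mule_ge0// lee_fin expR_ge0.
  + by rewrite lee_fin expR_ge0.
- exact: emeasurable_funM.
- by move=> x; rewrite mule_ge0// lee_fin expR_ge0.
Qed.

Local Notation G1 := (\int[levy_measure]_x (x / (1 + x ^+ 2))).
Local Notation G2 := (\int[tilted_levy_measure]_x (x / (1 + x ^+ 2))).
Local Notation pos := (`]0%R, +oo[%classic : set TR).

Let nu_npos : nu `]-oo, 0]%classic = 0%E.
Proof.
have /null_content_dominatesP dom := density_dominates dnu.
exact: (dom _ (measurable_itv _) P_npos).
Qed.

Let nu2_npos : nu2 `]-oo, 0]%classic = 0%E.
Proof.
have /null_content_dominatesP dom := density_dominates dnu2.
exact: (dom _ (measurable_itv _) P_npos).
Qed.

Let mdrift : measurable_fun setT (fun x : TR => (pos_drift x)%:E : \bar R).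
Proof. by apply/measurable_EFinP; exact: measurable_pos_drift. Qed.

Let mexc : measurable_fun setT (fun x : TR => (excess x)%:E : \bar R).
Proof. by apply/measurable_EFinP; exact: measurable_excess. Qed.

Lemma levy_measure_excess : (\int[levy_measure]_x (excess x)%:E = 1)%E.
Proof.
rewrite ge0_levy//; last by move=> x; rewrite lee_fin excess_ge0.
transitivity (\int[P]_x cst 1%E x)%E; last first.
  by rewrite (integral_cst P measurableT); have /= -> := probability_setT P; rewrite mule1.
apply: ge0_ae_eq_integral => //.
- by apply: emeasurable_funM => //; exact/measurable_EFinP.
- by move=> x _; rewrite mule_ge0// lee_fin ?excess_ge0.
apply: filterS (ae_gt0 P_npos) => x x0 _; rewrite -EFinM mulfV//.
by rewrite gt_eqF// excess_gt0.
Qed.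

(** The function [expR x - 1] cancels the density of the Levy measure, so its integral is the mass 1
    of [P]; this is the shift of the compound Poisson law. *)
Lemma levy_drift_compensation :
  (0 = (G1 - 1)%:E - \int[levy_measure]_(x in pos) (1 - expR x + x / (1 + x ^+ 2))%:E)%E.
Proof.
have E1 : (\int[levy_measure]_(x in pos) (x / (1 + x ^+ 2))%R%:E = G1%:E)%E.
  rewrite -(integral_levy_drift c_nng nu_npos); apply: integral_pos => x.
    by move=> /pos_driftE.
  exact: pos_drift_npos.
have E2 : (\int[levy_measure]_(x in pos) (expR x - 1)%R%:E = 1)%E.
  rewrite -[RHS]levy_measure_excess; apply: integral_pos => x.
    by move=> /excess_pos.
  exact: excess_npos.
have mpos : measurable pos by exact: measurable_itv.
have i1 : levy_measure.-integrable pos (fun x => (x / (1 + x ^+ 2))%R%:E).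
  apply/integrableP; split.
    by apply: measurable_funTS; apply/measurable_EFinP; case: (bmeas_levy_drift R).
  under eq_integral => x.
    rewrite inE/= in_itv/= andbT => x0; rewrite ger0_norm; last first.
      by rewrite divr_ge0 ?addr_ge0 ?sqr_ge0// ltW.
    over.
  by rewrite E1 ltry.
have i2 : levy_measure.-integrable pos (fun x => (expR x - 1)%R%:E).
  apply/integrableP; split.
    apply: measurable_funTS; apply/measurable_EFinP.
    exact: measurable_funB (@measurable_expR R) (measurable_cst _).
  under eq_integral => x.
    rewrite inE/= in_itv/= andbT => x0; rewrite ger0_norm; last first.
      by rewrite subr_ge0 ltW// expR_gt1.
    over.
  by rewrite E2 ltry.
have -> : (\int[levy_measure]_(x in pos) (1 - expR x + x / (1 + x ^+ 2))%R%:E =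
    \int[levy_measure]_(x in pos) ((x / (1 + x ^+ 2))%R%:E - (expR x - 1)%R%:E))%E.
  by apply: eq_integral => x _; rewrite -EFinB; congr _%:E; ring.
by rewrite (integralB mpos i1 i2) E1 E2 -!EFinB subrr.
Qed.

Lemma tilted_levy_drift : ((G2 - 1)%:E = (G1 - 1)%:E +
  \int[levy_measure]_(x in pos) ((expR x - 1) * (x / (1 + x ^+ 2)))%:E)%E.
Proof.
have p0 (x : TR) : (0 <= (pos_drift x)%:E)%E by rewrite lee_fin pos_drift_ge0.
have ep0 (x : TR) : (0 <= (excess x * pos_drift x)%:E)%E.
  by rewrite lee_fin mulr_ge0 ?excess_ge0 ?pos_drift_ge0.
have mep : measurable_fun setT (fun x : TR => (excess x * pos_drift x)%:E).
  apply/measurable_EFinP.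
  exact: measurable_funM (@measurable_excess R) (@measurable_pos_drift R).
have -> : (\int[levy_measure]_(x in pos) ((expR x - 1) * (x / (1 + x ^+ 2)))%R%:E =
    \int[levy_measure]_x (excess x * pos_drift x)%:E)%E.
  apply: integral_pos => x x0; first by rewrite excess_pos// pos_driftE.
  by rewrite excess_npos// mul0r.
rewrite !EFinB addeAC; congr (_ - _)%E.
rewrite -(integral_levy_drift c_nng nu_npos) -(integral_levy_drift c2_nng nu2_npos).
rewrite (ge0_integral_tilted_levy mdrift p0).
rewrite -(ge0_integralD levy_measure measurableT (fun x _ => p0 x) mdrift (fun x _ => ep0 x) mep).
apply: eq_integral => x _; rewrite -EFinM -EFinD; congr _%:E.
have [x0|x0] := ltP 0 x; first by rewrite excess_pos//; ring.
by rewrite pos_drift_npos//; ring.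
Qed.

Section radon_nikodym.
Variable M : {measure set (\bar R) -> \bar R}.
Hypothesis PM : forall A : set TR, measurable A -> P A = M (fine @^-1` A).

Let integral_lift (g : TR -> R) (A : set TR) : measurable A -> A `<=` pos ->
  measurable_fun setT g -> (forall x, 0 <= g x) ->
  (\int[P]_(x in A) (g x)%:E = \int[M]_(y in EFin @` A) (g (fine y))%:E)%E.
Proof.
move=> mA Apos mg g0.
have mf : measurable_fun setT (fine : \bar R -> TR) by exact: fine_measurable.
pose MP : {measure set TR -> \bar R} :=
  measure_function_pushforward__canonical__measure_function_Measure M mf.
rewrite (@eq_measure_integral _ _ _ A MP P); last by move=> B mB _; exact: PM.
(* [fine] sends both infinities to 0, which is not in [A], so they do not enter the preimage. *)
have -> : (EFin @` A) = fine @^-1` A.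
  apply/seteqP; split=> y; first by case=> x Ax <-.
  by case: y => [y| |] /= Ay; [exists y|move: (Apos _ Ay); rewrite /= in_itv/= ltxx..].
apply: (ge0_integral_pushforward mf M mA).
- by apply: measurable_funTS; exact/measurable_EFinP.
- by move=> x _; rewrite lee_fin.
Qed.

Lemma scaled_density_set (Q : probability TR R) (f : TR -> R) (a : {nonneg R}) A :
  0 < a%:num -> (forall x, 0 <= f x) -> measurable_fun setT f ->
  has_density P Q (fun x => f x / a%:num) -> measurable A ->
  (mscale a Q A = \int[P]_(x in A) (f x)%:E)%E.
Proof.
move=> a0 f0 mf dQ mA; rewrite /mscale/=; case: dQ => _ _ ->//.
rewrite -(ge0_integralZl P mA).
- by apply: eq_integral => x _; rewrite -EFinM mulrC divfK// gt_eqF.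
- by apply: measurable_funTS; apply/measurable_EFinP; exact: measurable_funM.
- by move=> x _; rewrite lee_fin divr_ge0.
- by rewrite lee_fin.
Qed.

Let concentrated (Q : probability TR R) (f g : TR -> R) (a : {nonneg R}) :
  0 < a%:num -> (forall x, 0 <= f x) -> measurable_fun setT f ->
  has_density P Q (fun x => f x / a%:num) -> Q `]-oo, 0]%classic = 0%E ->
  (forall x, 0 < x -> f x = g x) -> concentrated_density M g (mscale a Q).
Proof.
move=> a0 f0 mf dQ Q0 fg; split=> [|A mA Apos].
  by transitivity (a%:num%:E * Q `]-oo, 0%R]%classic)%E; last by rewrite Q0 mule0.
apply: etrans (scaled_density_set a0 f0 mf dQ mA) _.
rewrite (integral_lift mA Apos mf f0).
apply: eq_integral => y; rewrite inE => -[x Ax <-]; congr _%:E; apply: fg.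
by have := Apos _ Ax; rewrite /= in_itv/= andbT.
Qed.

Lemma concentrated_levy_measure :
  concentrated_density M (fun x => (expR x - 1)^-1) levy_measure.
Proof.
apply: (@concentrated nu q _ c_nng c_gt0 q0 mq dnu nu_npos) => x x0.
by rewrite excess_pos.
Qed.

Lemma concentrated_tilted_levy_measure :
  concentrated_density M (fun x => expR x / (expR x - 1)) tilted_levy_measure.
Proof.
apply: (@concentrated nu2 (fun y => expR y * q y) _ c2_nng c2_gt0 _ _ dnu2 nu2_npos).
- by move=> x; rewrite mulr_ge0// expR_ge0.
- exact: measurable_funM (@measurable_expR R) mq.
- by move=> x x0; rewrite excess_pos.
Qed.

End radon_nikodym.
End levy_consequences.

(** * Limit laws *)

Section limit_laws.
Context (R : realType).
Local Notation TR := (measurableTypeR R).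
Local Notation U := (unif01 R).
Local Notation lambda := (@lebesgue_measure R).

Lemma bmeas_EFin (f : \bar R -> R) : bmeas f -> bmeas (fun x : TR => f x%:E).
Proof. by apply: (bmeas_comp (@measurable_fun_EFin R)). Qed.

Lemma bmeas_exp_tilt (f : \bar R -> R) (a : R) : bmeas f ->
  (forall x, (a%:E <= x)%E -> f x = 0) -> bmeas (fun x : TR => f x%:E * expR x).
Proof.
move=> bf fa; have [mf _] := bmeas_EFin bf; split.
  exact: measurable_funM mf (@measurable_expR R).
have [_ [C fC]] := bf; have C0 : 0 <= C by apply: le_trans (fC 0%E).
exists (C * expR a) => x; have [xa|/ltW xa] := leP a x.
  by rewrite fa ?lee_fin// mul0r normr0 mulr_ge0// expR_ge0.
by rewrite normrM ler_pM// ger0_norm ?expR_ge0// ler_expR.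
Qed.

Lemma weak_cvg_eq (nu : nat -> probability (\bar R) R) (xi xi' : probability (\bar R) R) :
  weak_cvg nu xi -> (forall f, bmeas f -> \int[xi]_x f x = \int[xi']_x f x) ->
  weak_cvg nu xi'.
Proof.
by move=> nuxi E f cf fC; rewrite -E; [exact: nuxi|exact: continuous_ereal_bmeas].
Qed.

Variables (k : nat -> nat) (k_gt0 : forall n, (0 < k n)%N).
Hypothesis k_cvg : k n @[n --> \oo] --> \oo.
Variables (kappa : nat -> R) (kappa01 : forall n, 0 < kappa n <= 1).
Variables h rho : forall n, 'I_(k n) -> R -> R.
Hypothesis h_density : forall n (i : 'I_(k n)), density01 (h i).
Hypothesis rho_int : forall n (i : 'I_(k n)),
  lambda.-integrable `]0, 1[ (EFin \o rho i).
Hypothesis rho_int0 : forall n (i : 'I_(k n)),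
  (\int[lambda]_(u in `]0%R, 1%R[) (rho i u)%:E = 0)%E.
Hypothesis rho_small :
  (\sum_(i < k n) (((k n)%:R^-1) ^+ 2)%:E *
    \int[lambda]_(u in `]0%R, 1%R[) ((rho i u) ^+ 2)%:E)%E @[n --> \oo] --> 0%E.
Hypothesis signal_ge0 : forall n (i : 'I_(k n)) (u : R), u \in `]0, 1[ ->
  0 <= signal_density (kappa n) (h i) (rho i) u.
Variable mu : forall n, 'I_(k n) -> probability TR R.
Hypothesis mu_density : forall n (i : 'I_(k n)) (A : set TR), measurable A ->
  mu i A = (\int[lambda]_(u in A `&` `]0%R, 1%R[)
    (signal_density (kappa n) (h i) (rho i) u)%:E)%E.

Variables (b c : R) (nu : probability TR R).
Hypothesis c_ge0 : 0 <= c.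
Hypothesis generator_cvg : forall C f f1, test_pair C f f1 ->
  forall del, 0 < del -> \forall n \near \oo, forall (i : 'I_(k n)) x,
  `|(k n)%:R * kappa n *
      \int[U]_u log_increment f f1 x (h i u / ((k n)%:R * kappa n)) -
    generator b c nu f f1 x| <= del.

Let P n := fun _ : 'I_(k n) => U.
Let Q n := contaminated (@mu n).

Let dq n (i : 'I_(k n)) : has_density (P i) (Q i) (array_density kappa h rho i).
Proof.
exact: (contaminated_has_density (k_gt0 n) (kappa01 n) (h_density i) (rho_int i)
  (@signal_ge0 n i) (mu_density i)).
Qed.

Let mS n : measurable_fun [set: (k n).-tuple TR]
  (sum_ln (fun i : 'I_(k n) => array_density kappa h rho i) : _ -> TR).
Proof. by apply: measurable_sum_ln (@dq n). Qed.

(** In a row of length 1 the noise has weight 0 and the density may vanish; positivity holds only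
    once [k n > 1]. *)
Let near_gt0 : \forall n \near \oo,
  forall (i : 'I_(k n)) u, 0 < array_density kappa h rho i u.
Proof.
have : \forall n \near \oo, (1 < k n)%N by exact: (k_cvg (nbhs_infty_gt 1)).
apply: filterS => n kn i u; apply: lt_le_trans
  (row_density_ge (k_gt0 n) (kappa01 n) (h_density i) (@signal_ge0 n i) u).
by rewrite subr_gt0 invf_lt1 ?ltr0n// ltr1n.
Qed.

Let nuR n := law_of (prod_prob (@P n)) (@mS n).

Let nuR_cvg (f : R -> R) : test_fun f ->
  \int[nuR n]_x f x @[n --> \oo] --> \int[shifted_cpoisson b c nu]_x f x.
Proof.
exact: (sum_ln_cvg k_gt0 k_cvg kappa01 h_density rho_int rho_int0 rho_small
  signal_ge0 c_ge0 generator_cvg (@mS)).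
Qed.

Lemma weak_cvg_noise (xi : probability (\bar R) R) :
  (forall f, bmeas f -> \int[xi]_x f x = \int[shifted_cpoisson b c nu]_x f x%:E) ->
  weak_cvg (fun n => log_lr_law (@P n) (@Q n) (@P n)) xi.
Proof.
move=> xiE; apply: (@weak_cvg_eq _ (distribution (shifted_cpoisson b c nu) (@extended_real R))).
  apply: (weak_cvg_real nuR_cvg); apply: filterS near_gt0 => n q0 f bf.
  rewrite (Rintegral_log_lr_law (@dq n) q0 _ bf) => [|i]; last by move=> A.
  by rewrite Rintegral_law_of//; exact: bmeas_EFin.
by move=> f bf; rewrite xiE// Rintegral_distribution.
Qed.

Lemma weak_cvg_signal (xi : probability (\bar R) R) :
  (forall f (a : R), bmeas f -> (forall x, (a%:E <= x)%E -> f x = 0) ->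
    \int[xi]_x f x = \int[shifted_cpoisson b c nu]_x (f x%:E * expR x)) ->
  weak_cvg (fun n => log_lr_law (@P n) (@Q n) (@Q n)) xi.
Proof.
move=> xiE; apply: (weak_cvg_tilt nuR_cvg) => // f a bf fa.
apply: filterS near_gt0 => n q0.
rewrite (Rintegral_log_lr_law_tilt (@dq n) q0 bf) Rintegral_law_of//.
exact: bmeas_exp_tilt bf fa.
Qed.

End limit_laws.

(** * Limits of the generator when the scale tends to +oo or to 0 *)

Section generator_limits.
Context (R : realType).
Local Notation TR := (measurableTypeR R).
Local Notation U := (unif01 R).

Lemma near_powR_ge (k : nat -> nat) (p A : R) : k n @[n --> \oo] --> \oo -> 0 < p ->
  \forall n \near \oo, A <= (k n)%:R `^ p.
Proof.
move=> k_cvg p0; set B := Num.max A 1.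
have B0 : 0 <= B by rewrite le_max ler01 orbT.
have b0 : 0 <= B `^ p^-1 by exact: powR_ge0.
have : \forall n \near \oo, ((Num.trunc (B `^ p^-1)).+1 <= k n)%N.
  exact: (k_cvg _ (nbhs_infty_ge _)).
apply: filterS => n kn; apply: (@le_trans _ _ B); first by rewrite le_max lexx.
have -> : B = (B `^ p^-1) `^ p by rewrite -powRrM mulVf ?powRr1// gt_eqF.
apply: ge0_ler_powR; rewrite ?nnegrE ?(ltW p0)//.
by apply: le_trans (ltW (truncnS_gt _)) _; rewrite ler_nat.
Qed.

Variables (k : nat -> nat) (h : forall n, 'I_(k n) -> R -> R).
Hypothesis h_density : forall n (i : 'I_(k n)), density01 (h i).
Variable s : nat -> R.
Hypothesis s_gt0 : forall n, 0 < s n.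
Variables (C : R) (f f1 : R -> R).
Hypothesis ff1 : test_pair C f f1.

Let C0 : 0 <= C.
Proof. exact: test_pair_ge0 ff1. Qed.

Let mpsi n (i : 'I_(k n)) x :
  measurable_fun setT (fun u : TR => log_increment f f1 x (h i u / s n)).
Proof.
have [mh _ _ _] := h_density i; have [mf _ _ _ _] := ff1.
apply: (measurableT_comp (measurable_log_increment f1 x mf)).
exact: measurable_funM.
Qed.

Let ipsi n (i : 'I_(k n)) x :
  U.-integrable setT (EFin \o (fun u => log_increment f f1 x (h i u / s n))).
Proof.
apply: (@integrable_dominated _ TR R U _ (fun u : TR => (3 * C / s n) * h i u)).
- exact: mpsi.
- exact: integrable_EFinZ (density01_integrable (h_density i)).
move=> u; have [_ h0 _ _] := h_density i.
have hs : 0 <= h i u / s n by rewrite divr_ge0// ltW.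
have -> : 3 * C / s n * h i u = 3 * C * (h i u / s n) by ring.
by have := log_increment_le ff1 x hs.
Qed.

(** Uniform integrability: where [h > K] the linear bound is used and the tail mass is small; where
    [h <= K] the quadratic bound leaves at most [2 * C * K / s n] after multiplication by [s n]. *)
Lemma generator_cvg_large nu del : 0 < del ->
  (forall A, \forall n \near \oo, A <= s n) ->
  (forall e, 0 < e -> exists t : R, 0 <= t /\ \forall n \near \oo,
    forall i : 'I_(k n), tail_mass U (h i) (h i) t <= e) ->
  \forall n \near \oo, forall (i : 'I_(k n)) x,
    `|s n * \int[U]_u log_increment f f1 x (h i u / s n) -
      generator 0 0 nu f f1 x| <= del.
Proof.
move=> del0 sA tails; have C1 : 0 < C + 1 by have := C0; lra.
have e0 : 0 < del / (6 * (C + 1)) by rewrite divr_gt0// mulr_gt0.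
have [K [K0 tK]] := tails _ e0.
apply: filterS2 (sA (4 * (C + 1) * (K + 1) / del)) tK => n sn tn i x.
rewrite /generator !mul0r subrr subr0.
have [mh h0 _ _] := h_density i; have ih := density01_integrable (h_density i).
have iT := @tail_mass_integrable R _ TR U (h i) (h i) h0 mh ih K.
rewrite -(RintegralZl _ measurableT (ipsi i x)).
have iz := integrable_EFinZ (s n) (ipsi i x).
have ib := integrable_EFinD (integrable_EFinZ (3 * C) iT)
  (integrable_EFinZ (2 * C * K / s n) ih).
apply: (le_trans (le_Rintegral_norm _ ib _)).
- by have /measurable_EFinP := measurable_int _ iz.
- move=> u; rewrite normrM (gtr0_norm (s_gt0 n)).
  have hs : 0 <= h i u / s n by rewrite divr_ge0// ltW.
  have [hK|hK] := ltP K (h i u).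
    rewrite mulr1; apply: (@le_trans _ _ (3 * C * h i u)).
      rewrite mulrC -ler_pdivlMr//; apply: le_trans (log_increment_le ff1 x hs) _.
      by rewrite mulrA.
    by rewrite lerDl mulr_ge0// divr_ge0 ?mulr_ge0// ltW.
  rewrite !mulr0 add0r mulrC -ler_pdivlMr//.
  apply: le_trans (log_increment_le_sqr ff1 x hs) _.
  have -> : 2 * C * K / s n * h i u / s n = 2 * C * (K * h i u / s n ^+ 2).
    by field; rewrite gt_eqF.
  rewrite ler_wpM2l ?mulr_ge0// expr_div_n expr2.
  by rewrite ler_wpM2r ?invr_ge0 ?sqr_ge0// ler_wpM2r.
rewrite (RintegralD measurableT (integrable_EFinZ _ iT) (integrable_EFinZ _ ih)).
rewrite (RintegralZl _ measurableT iT) (RintegralZl _ measurableT ih).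
rewrite (density01_Rintegral (h_density i)) mulr1.
have h1 : 3 * C * tail_mass U (h i) (h i) K <= del / 2.
  apply: (@le_trans _ _ (3 * (C + 1) * (del / (6 * (C + 1))))).
    apply: ler_pM; [by rewrite mulr_ge0| |by have := C0; lra|exact: tn].
    by apply: Rintegral_ge0 => u _; rewrite mulr_ge0.
  by rewrite le_eqVlt; apply/orP; left; apply/eqP; field; rewrite gt_eqF.
have h2 : 2 * C * K / s n <= del / 2.
  rewrite ler_pdivrMr//; move: sn; rewrite ler_pdivrMr// => sn.
  have : C * K <= (C + 1) * (K + 1) by have := C0; rewrite ler_pM//; lra.
  lra.
rewrite /tail_mass in h1 *; lra.
Qed.

(** Adding back the linear term, whose integral is exactly [f1 x / s n] because [h] has integral 1,
    leaves a function bounded by [2 * C], and this is multiplied by [s n]. *)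
Lemma generator_cvg_small nu del : 0 < del ->
  (forall e, 0 < e -> \forall n \near \oo, s n <= e) ->
  \forall n \near \oo, forall (i : 'I_(k n)) x,
    `|s n * \int[U]_u log_increment f f1 x (h i u / s n) -
      generator 1 0 nu f f1 x| <= del.
Proof.
move=> del0 se; have C1 : 0 < 2 * (C + 1) by have := C0; lra.
apply: filterS (se _ (divr_gt0 del0 C1)) => n sn i x.
rewrite /generator mul0r sub0r opprK mul1r.
have [mh h0 _ _] := h_density i; have ih := density01_integrable (h_density i).
have i2 := integrable_EFinZ (f1 x / s n) ih.
have -> : s n * \int[U]_u log_increment f f1 x (h i u / s n) + f1 x =
    s n * \int[U]_u (log_increment f f1 x (h i u / s n) + f1 x / s n * h i u).
  rewrite (RintegralD measurableT (ipsi i x) i2) (RintegralZl _ measurableT ih).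
  rewrite (density01_Rintegral (h_density i)) mulr1 mulrDr; congr (_ + _).
  by rewrite mulrC divfK// gt_eqF.
have bnd u : `|log_increment f f1 x (h i u / s n) + f1 x / s n * h i u| <= 2 * C.
  have := log_increment_drift ff1 x (h i u / s n).
  by rewrite (_ : h i u / s n * f1 x = f1 x / s n * h i u)//; ring.
have := Rintegral_norm_le (integrable_EFinD (ipsi i x) i2) bnd.
set I := \int[U]_u _ => IC; rewrite normrM (gtr0_norm (s_gt0 n)).
apply: (@le_trans _ _ (del / (2 * (C + 1)) * (2 * C))).
  by rewrite ler_pM// ltW.
by rewrite mulrAC ler_pdivrMr// ler_wpM2l ?(ltW del0)//; lra.
Qed.

End generator_limits.

Section real_law.
Context (R : realType).
Local Notation TR := (measurableTypeR R).
Variable M : {measure set (\bar R) -> \bar R}.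

(** The image of [M] on the reals; [fine] collapses the infinities to 0, which is harmless because
    [M] does not charge them. The proof of mass 1 is an argument so that the probability structure
    can be attached. *)
Definition real_law of M setT = 1%E : set TR -> \bar R :=
  fun A => M (fine @^-1` A).

Hypothesis M1 : M setT = 1%E.

Let mfine : measurable_fun setT (fine : \bar R -> TR).
Proof. exact: fine_measurable. Qed.

Let pf : {measure set TR -> \bar R} :=
  measure_function_pushforward__canonical__measure_function_Measure M mfine.

HB.instance Definition _ := isMeasure.Build _ _ _ (real_law M1)
  (measure0 pf) (measure_ge0 pf) (@measure_semi_sigma_additive _ _ _ pf).

HB.instance Definition _ := @Measure_isProbability.Build _ _ R (real_law M1) M1.

Lemma exists_real_law : exists P : probability TR R,
  forall A, P A = M (fine @^-1` A).
Proof. by exists (real_law M1). Qed.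

End real_law.

Section mixture_of_diracs.
Context d (T : measurableType d) (R : realType).

Lemma Rintegral_dirac (a : T) (f : T -> R) : measurable_fun setT f ->
  \int[dirac a]_x f x = f a.
Proof.
move=> mf; rewrite /Rintegral (integral_dirac a measurableT); last exact/measurable_EFinP.
by rewrite diracT mul1e.
Qed.

Lemma Rintegral_mixture (e : R) (e01 : 0 <= e <= 1) (P Q : probability T R) f :
  bmeas f -> \int[mixture e01 P Q]_x f x =
  (1 - e) * \int[P]_x f x + e * \int[Q]_x f x.
Proof.
move=> bf; have e0 : 0 <= e by case/andP: e01.
have e1 : 0 <= 1 - e by rewrite subr_ge0; case/andP: e01.
have ge0 (g : T -> R) : bmeas g -> (forall x, 0 <= g x) ->
    \int[mixture e01 P Q]_x g x = (1 - e) * \int[P]_x g x + e * \int[Q]_x g x.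
  move=> bg g0; have mg : measurable_fun setT (EFin \o g).
    by apply/measurable_EFinP; case: bg.
  have g0' x : setT x -> (0 <= (g x)%:E)%E by move=> _; rewrite lee_fin.
  rewrite /Rintegral /mixture.
  rewrite (ge0_integral_measure_add (mscale (NngNum _) P) _ measurableT g0' mg).
  rewrite (ge0_integral_mscale P measurableT _ mg g0').
  rewrite (ge0_integral_mscale Q measurableT _ mg g0').
  by rewrite -(EFin_Rintegral P bg) -(EFin_Rintegral Q bg).
have [mf [C fC]] := bf.
have bc : bmeas (fun _ : T => C) by exact: bmeas_cst.
have shift (S : probability T R) : \int[S]_x f x = \int[S]_x (f x + C) - C.
  rewrite (RintegralD measurableT (bmeas_integrable S bf) (bmeas_integrable S bc)).
  by rewrite Rintegral_cst1 addrK.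
rewrite !shift ge0; [by ring|exact: bmeasD|].
by move=> x; have := fC x; rewrite ler_norml; lra.
Qed.

End mixture_of_diracs.

Lemma bigmax_tail_near (R : realType) (k : nat -> nat) (F : forall n, 'I_(k n) -> R) (e : R) :
  \big[Num.max/0]_(i < k n) `|F n i| @[n --> \oo] --> (0 : R) -> 0 < e ->
  \forall n \near \oo, forall i : 'I_(k n), `|F n i| <= e.
Proof.
move=> /cvgrPdist_le Fcvg e0; apply: filterS (Fcvg _ e0) => n Fe i.
apply: le_trans Fe; rewrite sub0r normrN; apply: le_trans (ler_norm _).
exact: (le_bigmax 0 (fun i => `|F n i|) i).
Qed.

Section real_law_tails.
Context (R : realType).
Local Notation TR := (measurableTypeR R).
Variables (M : {measure set (\bar R) -> \bar R}) (P : probability TR R).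
Hypotheses (M_pos : M [set y : \bar R | (y <= 0)%E] = 0%E) (M_infty : M [set +oo%E] = 0%E).
Hypothesis PM : forall A, P A = M (fine @^-1` A).

Lemma real_law_tail (x : R) : 0 < x -> P `]x, +oo[%classic = M `]x%:E, +oo%E[%classic.
Proof.
move=> x0; rewrite PM; congr (M _); apply/seteqP; split=> -[y| |] /=;
  rewrite !in_itv/= ?andbT ?lte_fin ?ltry ?andbT//=; by rewrite ?ltNge ?(ltW x0)// ?andbF.
Qed.

(** The preimage contains +oo as well as the nonpositive points, since [fine] maps +oo to 0; this is
    where [M_infty] enters. *)
Lemma real_law_npos : P `]-oo, 0]%classic = 0%E.
Proof.
rewrite PM; have mn : measurable [set y : \bar R | (y <= 0)%E].
  by have := @emeasurable_itv R `]-oo, 0%E]; rewrite set_itvE.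
rewrite (_ : _ @^-1` _ = [set y : \bar R | (y <= 0)%E] `|` [set +oo%E]).
  by rewrite (measureU0 mn (emeasurable_set1 _) M_infty).
apply/seteqP; split=> -[y| |] /=; rewrite in_itv/= ?lee_fin ?lexx ?leNye//.
all: first [by move=> ?; left|by move=> ?; right|by case=> // /eqP].
Qed.

End real_law_tails.

Section asymptotics.
Context (R : realType).
Local Notation TR := (measurableTypeR R).
Local Notation U := (unif01 R).
Local Notation lambda := (@lebesgue_measure R).
Variables (k : nat -> nat) (k_gt0 : forall n, (0 < k n)%N).
Variables (h : forall n, 'I_(k n) -> R -> R).
Hypothesis h_density : forall n (i : 'I_(k n)), density01 (h i).
Variable D : set R.
Hypotheses (D_pos : D `<=` `]0, +oo[) (D_dense : `]0, +oo[ `<=` closure D).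
Variable M : {measure set (\bar R) -> \bar R}.
Hypotheses (M_pos : M [set y : \bar R | (y <= 0)%E] = 0%E) (M_infty : M [set +oo%E] = 0%E).
Hypothesis M_fin : forall x, D x -> (M `]x%:E, +oo%E[%classic < +oo)%E.
Hypothesis h_cvg : forall x, D x ->
  \big[Num.max/0]_(i < k n)
    `| \int[lambda]_(u in `]0, 1[) (h i u * \1_[set v | expR x - 1 < h i v] u)
       - fine (M `]x%:E, +oo%E[%classic) | @[n --> \oo] --> (0 : R).

Let tails_near x (e : R) : D x -> 0 < e -> \forall n \near \oo, forall i : 'I_(k n),
  `|tail_mass U (h i) (h i) (expR x - 1) - fine (M `]x%:E, +oo%E[%classic)| <= e.
Proof.
move=> Dx e0; have := bigmax_tail_near (h_cvg Dx) e0.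
by apply: filterS => n H i; rewrite -density01_tail.
Qed.

Let D_gt0 x : D x -> 0 < x.
Proof. by move=> /D_pos; rewrite /= in_itv/= andbT. Qed.

Let tails_bound x : D x -> 2 - expR x <= fine (M `]x%:E, +oo%E[%classic) <= 1.
Proof.
move=> Dx; have near0 (e : R) : 0 < e -> exists t : R,
    [/\ 2 - expR x <= t, t <= 1 & `|t - fine (M `]x%:E, +oo%E[%classic)| <= e].
  move=> e0; have [n _ /(_ n (leqnn n)) /= H] := tails_near Dx e0.
  exists (tail_mass U (h (Ordinal (k_gt0 n))) (h (Ordinal (k_gt0 n))) (expR x - 1)); split.
  - have x1 : 0 <= expR x - 1 by rewrite subr_ge0 ltW// expR_gt1 D_gt0.
    have := tail_mass_density01_ge (h_density (Ordinal (k_gt0 n))) x1; lra.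
  - exact: (tail_mass_density01_le1 (h_density (Ordinal (k_gt0 n)))).
  - exact: H.
apply/andP; split; apply/ler_addgt0Pr => e /near0[t [t1 t2]]; rewrite ler_norml; lra.
Qed.

Lemma exists_limit_law : exists P : probability TR R,
  [/\ forall A, P A = M (fine @^-1` A), P `]-oo, 0]%classic = 0%E,
      (\int[P]_y ((excess y)^-1)%:E <= 1)%E &
      forall x (e : R), D x -> 0 < e -> \forall n \near \oo, forall i : 'I_(k n),
        `|tail_mass U (h i) (h i) (expR x - 1) - fine (P `]x, +oo[%classic)| <= e].
Proof.
have M1 := total_mass1 D_dense M_pos M_infty M_fin tails_bound.
have [P PM] := exists_real_law M1; exists P.
have tP x (e : R) : D x -> 0 < e -> \forall n \near \oo, forall i : 'I_(k n),
    `|tail_mass U (h i) (h i) (expR x - 1) - fine (P `]x, +oo[%classic)| <= e.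
  by move=> Dx; rewrite (real_law_tail PM (D_gt0 Dx)); exact: tails_near.
split=> //; first exact: real_law_npos PM.
exact: (intensity_le1 D_pos D_dense h_density tP k_gt0).
Qed.

Variable P : probability TR R.
Hypothesis tail_cvg : forall x (e : R), D x -> 0 < e -> \forall n \near \oo,
  forall i : 'I_(k n),
    `|tail_mass U (h i) (h i) (expR x - 1) - fine (P `]x, +oo[%classic)| <= e.

(** Tightness of the limit law gives a far point whose tail is at most [e / 2]; a nearby point of
    [D] transfers the estimate to all densities of a late row. *)
Lemma uniform_tails (e : R) : 0 < e -> exists t : R, 0 <= t /\
  \forall n \near \oo, forall i : 'I_(k n), tail_mass U (h i) (h i) t <= e.
Proof.
move=> e0; have e2 : 0 < e / 2 by exact: divr_gt0.
have [x [x0 xP]] := probability_tail_cvg0 P e2.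
have [||y Dy /andP[xy _]] := @dense_between _ D D_dense x (x + 1).
- exact: ltW.
- by rewrite ltrDl.
exists (expR y - 1); split; first by rewrite subr_ge0 ltW// expR_gt1 D_gt0.
apply: filterS (tail_cvg Dy e2) => n H i.
by move: (H i) (xP y (ltW xy)); rewrite ler_norml; lra.
Qed.

Lemma generator_cvg_levy nu C f f1 del : P `]-oo, 0]%classic = 0%E ->
  (\int[P]_y ((excess y)^-1)%:E <= 1)%E ->
  has_density P nu (fun y => (excess y)^-1 / intensity P) ->
  test_pair C f f1 -> 0 < del ->
  \forall n \near \oo, forall (i : 'I_(k n)) x,
    `|\int[U]_u log_increment f f1 x (h i u) -
      generator 1 (intensity P) nu f f1 x| <= del.
Proof.
move=> P0 Pi dnu ff1 del0.
apply: filterS (mild_ratio_cvg D_pos D_dense h_density tail_cvg (3 * C) del0).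
move=> n H i x; rewrite (generator_levy P0 Pi dnu x ff1).
by apply: H; exact: log_increment_mild.
Qed.

End asymptotics.

(** * The three regimes *)

Unset Implicit Arguments.

Theorem theorem4p3 (R : realType)
  (k : nat -> nat) (k_gt0 : forall n, (0 < k n)%N)
  (k_cvg : k n @[n --> \oo] --> \oo)
  (r : R) (r_gt0 : 0 < r)
  (h : forall n, 'I_(k n) -> R -> R)
  (h_density : forall n (i : 'I_(k n)), density01 (h n i))
  (rho : forall n, 'I_(k n) -> R -> R)
  (rho_int : forall n (i : 'I_(k n)),
    (@lebesgue_measure R).-integrable `]0, 1[ (EFin \o rho n i))
  (rho_int0 : forall n (i : 'I_(k n)),
    (\int[@lebesgue_measure R]_(u in `]0%R, 1%R[) (rho n i u)%:E = 0)%E)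
  (rho_small :
    (\sum_(i < k n) (((k n)%:R^-1) ^+ 2)%:E *
       \int[@lebesgue_measure R]_(u in `]0%R, 1%R[) ((rho n i u) ^+ 2)%:E)%E
    @[n --> \oo] --> 0%E)
  (signal_ge0 : forall n (i : 'I_(k n)) (u : R), u \in `]0, 1[ ->
    0 <= signal_density ((k n)%:R `^ (- r)) (h n i) (rho n i) u)
  (mu : forall n, 'I_(k n) -> probability (measurableTypeR R) R)
  (mu_density : forall n (i : 'I_(k n)) (A : set (measurableTypeR R)),
    measurable A ->
    mu n i A = (\int[@lebesgue_measure R]_(u in A `&` `]0%R, 1%R[)
      (signal_density ((k n)%:R `^ (- r)) (h n i) (rho n i) u)%:E)%E)
  (D : set R) (D_pos : D `<=` `]0, +oo[) (D_dense : `]0, +oo[ `<=` closure D)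
  (M : {measure set (\bar R) -> \bar R})
  (M_pos : M [set y : \bar R | (y <= 0)%E] = 0%E)
  (M_infty : M [set +oo%E] = 0%E)
  (M_fin : forall x, D x -> (M `]x%:E, +oo%E[%classic < +oo)%E)
  (h_cvg : forall x, D x ->
    \big[Num.max/0]_(i < k n)
      `| \int[@lebesgue_measure R]_(u in `]0, 1[)
           (h n i u * \1_[set v | expR x - 1 < h n i v] u)
         - fine (M `]x%:E, +oo%E[%classic) |
    @[n --> \oo] --> (0 : R)) :
  let P n := fun _ : 'I_(k n) => unif01 R in
  let Q n := contaminated (mu n) in
  exists xi1 xi2 : probability (\bar R) R,
  [/\ weak_cvg (fun n => log_lr_law (P n) (Q n) (P n)) xi1,
      weak_cvg (fun n => log_lr_law (P n) (Q n) (Q n)) xi2,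
      r < 1 -> forall A : set (\bar R), measurable A ->
        xi1 A = dirac (0 : \bar R) A /\ xi2 A = dirac (0 : \bar R) A,
      r = 1 ->
        exists (zeta1 zeta2 : probability (measurableTypeR R) R)
          (gamma1 gamma2 : R)
          (eta1 eta2 : {measure set (measurableTypeR R) -> \bar R}),
        [/\ forall A : set (\bar R), measurable A ->
              xi1 A = pushforward zeta1 EFin A /\
              xi2 A = pushforward zeta2 EFin A,
            [/\ infinitely_divisible zeta1, infinitely_divisible zeta2,
                LK_triplet zeta1 gamma1 0 eta1 & LK_triplet zeta2 gamma2 0 eta2],
            concentrated_density M (fun x => (expR x - 1)^-1) eta1,
            concentrated_density M (fun x => expR x / (expR x - 1)) eta2 &
            (0 = gamma1%:E - \int[eta1]_(x in `]0%R, +oo[)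
                   (1 - expR x + x / (1 + x ^+ 2))%:E)%E /\
            (gamma2%:E = gamma1%:E + \int[eta1]_(x in `]0%R, +oo[)
                   ((expR x - 1) * (x / (1 + x ^+ 2)))%:E)%E] &
      1 < r -> forall A : set (\bar R), measurable A ->
        xi1 A = dirac ((- 1)%:E : \bar R) A /\
        xi2 A = ((expR (- 1))%:E * dirac ((- 1)%:E : \bar R) A +
                 (1 - expR (- 1))%:E * dirac (+oo : \bar R) A)%E].
Proof.
move=> P Q.
pose kap n : R := (k n)%:R `^ (- r).
have k1 n : 1 <= (k n)%:R :> R by rewrite ler1n.
have kap01 n : 0 < kap n <= 1.
  rewrite powR_gt0 ?(lt_le_trans ltr01)//=.
  by rewrite -[leRHS](powRr0 (k n)%:R) ler_powR// oppr_le0 ltW.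
pose s n := (k n)%:R * kap n.
(* The regime is decided by this scale: it tends to +oo, is constantly 1, or tends to 0. *)
have sE n : s n = (k n)%:R `^ (1 - r).
  rewrite [RHS]powRD ?powRr1 ?ler0n//.
  by apply/implyP => _; rewrite gt_eqF// (lt_le_trans ltr01).
have s0 n : 0 < s n by rewrite sE powR_gt0// (lt_le_trans ltr01).
have [law [lawM law0 law_le law_tail]] :=
  exists_limit_law k_gt0 h_density D_pos D_dense M_pos M_infty M_fin h_cvg.
have noise := weak_cvg_noise k_gt0 k_cvg kap01 h_density rho_int rho_int0 rho_small
  signal_ge0 mu_density.
have signal := weak_cvg_signal k_gt0 k_cvg kap01 h_density rho_int rho_int0 rho_small
  signal_ge0 mu_density.
(* At intensity 0 there are no jumps and the limit is the Dirac mass at [- b]; [law] merely fills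
   the place of the jump law. *)
have cp0 b (f : R -> R) : bmeas (f : measurableTypeR R -> R) ->
    \int[shifted_cpoisson b 0 law]_x f x = f (- b).
  move=> bf; rewrite Rintegral_shifted_cpoisson// Rintegral_cpoisson0 ?sub0r//.
  by apply: bmeas_comp bf; exact: measurable_funB.
have tilt0 b (f : \bar R -> R) (a : R) : bmeas f -> (forall x, (a%:E <= x)%E -> f x = 0) ->
    \int[shifted_cpoisson b 0 law]_x (f x%:E * expR x) = f (- b)%:E * expR (- b).
  move=> bf fa; rewrite (cp0 b (fun x => f x%:E * expR x))//.
  exact: bmeas_exp_tilt bf fa.
have dirac_int (a : \bar R) f : bmeas f -> \int[dirac a]_x f x = f a.
  by move=> [mf _]; exact: Rintegral_dirac.
case: (ltgtP r 1) => r1.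
- have sA A : \forall n \near \oo, A <= s n.
    have p0 : 0 < 1 - r by rewrite subr_gt0.
    by apply: filterS (near_powR_ge A k_cvg p0) => n; rewrite sE.
  have gen C f f1 (ff1 : test_pair C f f1) (del : R) (del0 : 0 < del) :=
    generator_cvg_large h_density s0 ff1 law del0 sA (uniform_tails D_pos D_dense law_tail).
  exists (dirac (0 : \bar R)), (dirac (0 : \bar R)); split.
  + apply: (noise 0 0 law (lexx 0) gen) => f bf.
    rewrite dirac_int// (cp0 0 (fun x => f x%:E)) ?oppr0//.
    exact: bmeas_EFin.
  + apply: (signal 0 0 law (lexx 0) gen) => f a bf fa.
    by rewrite (tilt0 _ _ _ bf fa) oppr0 expR0 mulr1 dirac_int.
  + by [].
  + by move=> r1'; rewrite r1' ltxx in r1.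
  + by [].
- have se (e : R) : 0 < e -> \forall n \near \oo, s n <= e.
    move=> e0; have p0 : 0 < r - 1 by rewrite subr_gt0.
    apply: filterS (near_powR_ge e^-1 k_cvg p0) => n.
    rewrite sE -(opprB r 1) powRN => ke.
    by rewrite -[leRHS]invrK lef_pV2// posrE ?invr_gt0// powR_gt0// (lt_le_trans ltr01).
  have gen C f f1 (ff1 : test_pair C f f1) (del : R) (del0 : 0 < del) :=
    generator_cvg_small h_density s0 ff1 law del0 se.
  have e01 : 0 <= 1 - expR (-1 : R) <= 1.
    have : expR (-1) <= 1 :> R by rewrite expR_le1; lra.
    by have := expR_ge0 (-1 : R); lra.
  (* Tilting the Dirac mass at -1 leaves mass [expR (- 1)] there; the missing mass is placed at +oo,
     where the functions tested by [weak_cvg_signal] vanish. *)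
  exists (dirac (-1)%:E), (mixture e01 (dirac (-1)%:E) (dirac +oo%E)); split.
  + apply: (noise 1 0 law (lexx 0) gen) => f bf.
    rewrite dirac_int// (cp0 1 (fun x => f x%:E))//.
    exact: bmeas_EFin.
  + apply: (signal 1 0 law (lexx 0) gen) => f a bf fa.
    rewrite (tilt0 _ _ _ bf fa) Rintegral_mixture// !dirac_int//.
    by rewrite (fa +oo%E) ?leey// mulr0 addr0 subKr mulrC.
  + by [].
  + by move=> r1'; rewrite r1' ltxx in r1.
  + move=> _ A mA; split=> //.
    by rewrite [LHS]mixtureE subKr.
- have s1 n : s n = 1 by rewrite sE r1 subrr powRr0.
  have [nu [nu2 [dnu dnu2]]] := levy_data law0 law_le.
  have c_gt0 := intensity_gt0 law0 law_le.
  have c2_gt0 : 0 < intensity law + 1 by rewrite addr_gt0.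
  have gen C f f1 (ff1 : test_pair C f f1) (del : R) (del0 : 0 < del) :
      \forall n \near \oo, forall (i : 'I_(k n)) x,
      `|(k n)%:R * kap n * \int[unif01 R]_u log_increment f f1 x (h n i u / ((k n)%:R * kap n)) -
        generator 1 (intensity law) nu f f1 x| <= del.
    apply: filterS (generator_cvg_levy h_density D_pos D_dense law_tail law0 law_le dnu ff1 del0).
    move=> n H i x; rewrite -/(s n) s1 mul1r.
    by under eq_Rintegral do rewrite divr1; exact: H.
  (* The same shift 1 serves both laws: under the signal only the jump law and the intensity
     change. *)
  exists (distribution (shifted_cpoisson 1 (intensity law) nu) (@extended_real R)).
  exists (distribution (shifted_cpoisson 1 (intensity law + 1) nu2) (@extended_real R)); split.
  + apply: (noise 1 _ nu (ltW c_gt0) gen) => f bf.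
    by rewrite (Rintegral_distribution _ (@extended_real R) bf).
  + apply: (signal 1 _ nu (ltW c_gt0) gen) => f a bf fa.
    rewrite (Rintegral_distribution _ (@extended_real R) bf).
    exact: (Rintegral_tilted_cpoisson law0 law_le dnu dnu2 (proj1 (bmeas_EFin bf))).
  + by [].
  + move=> _; exists (shifted_cpoisson 1 (intensity law) nu).
    exists (shifted_cpoisson 1 (intensity law + 1) nu2).
    exists (\int[levy_measure nu law0 law_le]_x (x / (1 + x ^+ 2)) - 1).
    exists (\int[tilted_levy_measure nu2 law0 law_le]_x (x / (1 + x ^+ 2)) - 1).
    exists (levy_measure nu law0 law_le), (tilted_levy_measure nu2 law0 law_le).
    have set0 (eta : {measure set (measurableTypeR R) -> \bar R}) :
        eta `]-oo, 0]%classic = 0%E -> eta [set 0] = 0%E.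
      move=> eta0; apply: (@subset_measure0 _ _ _ eta [set 0] `]-oo, 0]%classic) eta0.
      - exact: measurable_set1.
      - exact: measurable_itv.
      - by move=> _ ->; rewrite /= in_itv/= lexx.
    have ceta := concentrated_levy_measure law0 law_le dnu (fun A _ => lawM A).
    have ceta2 := concentrated_tilted_levy_measure law0 law_le dnu2 (fun A _ => lawM A).
    split=> //; last first.
      split; first exact: levy_drift_compensation law0 law_le dnu.
      exact: tilted_levy_drift law0 law_le dnu dnu2.
    split.
    * exact: shifted_cpoisson_infinitely_divisible (ltW c_gt0).
    * exact: shifted_cpoisson_infinitely_divisible (ltW c2_gt0).
    * by apply: shifted_cpoisson_LK_triplet (ltW c_gt0) _ _ => //; apply: set0; case: ceta.
    * by apply: shifted_cpoisson_LK_triplet (ltW c2_gt0) _ _ => //; apply: set0; case: ceta2.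
  + by [].
Qed.
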